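(* Let $C$ be a reduced plane curve of degree $d\ge 3$ in $\mathbb{P}^2$ with exponents $d_1\le d_2\le\ldots\le d_m$, where $m\ge 3$. Then $\tau(C)=(d-1)^2-d_1d_2$ if and only if $m=3$ and $d_3=d-1$. In all the other cases one has $$\tau(C)>(d-1)^2-d_1d_2.$$
   Context: Let $S=\mathbb{C}[x,y,z]$ and let $C:f=0$ be a reduced curve of degree $d$ in the complex projective plane $\mathbb{P}^2$, with $f\in S$ homogeneous of degree $d$. Let $f_x,f_y,f_z$ be the partial derivatives of $f$. The graded $S$-module of Jacobian syzygies of $C$ is $$D_0(C)=\{\theta\in \mathrm{Der}(S): \theta(f)=0\}=\{(a,b,c)\in S^3: af_x+bf_y+cf_z=0\},$$ where $\theta=a\partial_x+b\partial_y+c\partial_z$ is identified with the triple $(a,b,c)$; a homogeneous syzygy $(a,b,c)$ has degree $k$ if $a,b,c$ are homogeneous of degree $k$. If $\rho_1,\ldots,\rho_m$ is a minimal set of homogeneous generators of $D_0(C)$, with degrees $d_j=\deg\rho_j$ ordered so that $d_1\le d_2\le\cdots\le d_m$, then $(d_1,\ldots,d_m)$ are called the exponents of $C$. The module $D_0(C)$ is free if and only if $m=2$. $\tau(C)$ denotes the total Tjurina number of $C$, i.e. the sum of the Tjurina numbers of all singular points of $C$. *)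

(* Defs.v *)
From HB Require Import structures.
From mathcomp Require Import all_boot all_order all_algebra.
From mathcomp Require Import boolp classical_sets fsbigop reals.
From mathcomp Require Import complex.
From mathcomp.multinomials Require Import mpoly.

Set Implicit Arguments.
Unset Strict Implicit.
Unset Printing Implicit Defensive.

Import GRing.Theory.
Local Open Scope classical_set_scope.
Local Open Scope ring_scope.

(* The field of complex numbers is R[i] for R : realType; every definition
   below makes sense over an arbitrary field F. *)

(* f = 0 is a reduced curve: f has no multiple factor. *)
Definition reduced (F : fieldType) (n : nat) (f : {mpoly F[n]}) : Prop :=
  f != 0 /\
  forall g h : {mpoly F[n]}, f = g ^+ 2 * h -> g \is a GRing.unit.

Definition D0 (F : fieldType) (f : {mpoly F[3]}) : set 'rV[{mpoly F[3]}]_3 :=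
  [set r | \sum_(i < 3) r 0 i * f^`M(i) = 0].

Definition homog_triple (F : fieldType) (k : nat) (r : 'rV[{mpoly F[3]}]_3) : Prop :=
  forall i : 'I_3, r 0 i \is k.-homog.

Definition span (A : nzRingType) (V : lmodType A) (m : nat) (rho : 'I_m -> V)
    (J : {set 'I_m}) : set V :=
  [set r | exists c : 'I_m -> A, r = \sum_(j in J) c j *: rho j].

(* The second clause of the conjunction is minimality: no proper subfamily
   generates.  It forces each [rho j] to be nonzero, so that its degree [e j]
   is well defined. *)
Definition minimal_generators (A : nzRingType) (V : lmodType A) (M : set V)
    (m : nat) (rho : 'I_m -> V) : Prop :=
  span rho finset.setT = M /\
  forall J : {set 'I_m}, span rho J = M -> J = finset.setT.

Definition is_exponents (F : fieldType) (f : {mpoly F[3]}) (m : nat)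
    (e : m.-tuple nat) : Prop :=
  sorted leq e /\
  exists rho : 'I_m -> 'rV[{mpoly F[3]}]_3,
    (forall j, homog_triple (tnth e j) (rho j)) /\ minimal_generators (D0 f) rho.

(* The local ring of the affine n-space at [a], inside the field of rational
   functions. *)
Definition local_ring (F : fieldType) (n : nat) (a : 'I_n -> F) :
    set {fraction {mpoly F[n]}} :=
  [set x | exists u v : {mpoly F[n]}, v.@[a] != 0 /\ x = tofrac u / tofrac v].

(* The ideal (g, g_x1, ..., g_xn) of the local ring at [a]. *)
Definition tjurina_ideal (F : fieldType) (n : nat) (a : 'I_n -> F)
    (g : {mpoly F[n]}) : set {fraction {mpoly F[n]}} :=
  [set x | exists (c : {fraction {mpoly F[n]}})
                  (b : 'I_n -> {fraction {mpoly F[n]}}),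
     [/\ local_ring a c, forall i, local_ring a (b i)
       & x = c * tofrac g + \sum_(i < n) b i * tofrac g^`M(i)]].

(* [V / I] has dimension [k] over F: there are [k] elements of [V] whose
   classes form a basis of [V / I]. *)
Definition quotient_dim (F : fieldType) (n : nat)
    (V I : set {fraction {mpoly F[n]}}) (k : nat) : Prop :=
  exists b : 'I_k -> {fraction {mpoly F[n]}},
    (forall i, V (b i)) /\
    forall x, V x ->
      exists! c : 'rV[F]_k, I (x - \sum_(i < k) tofrac (c 0 i)%:MP * b i).

(* Tjurina number at [a] of the affine hypersurface g = 0; it is 0 by
   convention when the quotient is infinite dimensional, which does not happen
   at a point of a reduced plane curve. *)
Definition affine_tjurina (F : fieldType) (n : nat) (a : 'I_n -> F)
    (g : {mpoly F[n]}) : nat :=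
  xget 0%N [set k | quotient_dim (local_ring a) (tjurina_ideal a g) k].

(* Restriction of f to the chart x_i = 1, and coordinates in this chart of the
   point with homogeneous coordinates p. *)
Definition dehomog (F : fieldType) (i : 'I_3) (f : {mpoly F[3]}) :
    {mpoly F[2]} :=
  f \mPo [tuple if unlift i j is Some k then 'X_k else 1 | j < 3].

Definition chart_coord (F : fieldType) (i : 'I_3) (p : 'rV[F]_3) : 'I_2 -> F :=
  fun k => p 0 (lift i k) / p 0 i.

Definition tjurina (F : fieldType) (f : {mpoly F[3]}) (p : 'rV[F]_3) : nat :=
  if [pick i | p 0 i != 0] is Some i
  then affine_tjurina (chart_coord i p) (dehomog i f) else 0%N.

(* Each point of the projective plane has exactly one vector of homogeneous
   coordinates whose first nonzero entry is 1. *)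
Definition proj_plane (F : fieldType) : set 'rV[F]_3 :=
  [set p | exists i : 'I_3, p 0 i = 1 /\ forall j : 'I_3, (j < i)%N -> p 0 j = 0].

Definition sing_points (F : fieldType) (f : {mpoly F[3]}) : set 'rV[F]_3 :=
  [set p | [/\ proj_plane p, f.@[p 0] = 0
             & forall i : 'I_3, (f^`M(i)).@[p 0] = 0]].

(* The operator sums over the support of its argument in [sing_points f], which
   is finite when f is reduced. *)
Definition total_tjurina (F : fieldType) (f : {mpoly F[3]}) : nat :=
  \sum_(p \in sing_points f) tjurina f p.

(* Main.v *)
Require Import Defs.
From HB Require Import structures.
From mathcomp Require Import all_boot all_order all_algebra.
From mathcomp Require Import boolp classical_sets fsbigop reals.
From mathcomp Require Import complex.
From mathcomp.multinomials Require Import mpoly.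
From mathcomp Require Import ring zify.

(** Put [D = d - 1] and [S = F[x, y, z]], and let [J] be the ideal generated by the
    three partial derivatives of [f].

    The total Tjurina number is the dimension of [S / J] in large degrees
    ([total_tjurina_hilbert]).  As [f] is reduced, its derivatives have no common
    factor, and [S] is a factorial domain; eliminating one variable then yields a
    line [l = 0] that avoids the singular points ([cofinite_hyperplane]).
    Multiplication by [l] is surjective on [S / J] in large degrees, so that the
    Hilbert function ends up constant, and the Nullstellensatz and the Chinese
    remainder theorem split its value into contributions of the singular points
    ([hilbert_function_local]).  Dehomogenizing, with Euler's relation to recover
    [f] itself, identifies each of them with a local Tjurina algebra
    ([local_tjurina]).

    Let now [r1] be a generator of least degree [d1] of the module of syzygies.
    Two syzygies [r] and [s] are orthogonal to the gradient, so that their cross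
    product is a multiple of it ([cross_gradient]).  Sending [r] to the coefficient
    of [cross r1 r] maps the syzygies onto an ideal [A] of [S], with kernel [S r1]
    because the entries of [r1] have no common factor.  This exact sequence
    expresses the Hilbert function of [J] by that of [A] ([dim_jacobian]).

    The ideal [A] contains the coefficient [h] of the second generator, of degree
    [d1 + d2 - D], and the coefficients of the Koszul syzygies, which are the
    combinations of the entries of [r1]; a generic one with constant coefficients,
    [g], has degree [d1] and is coprime to [h].  If [A] were the complete
    intersection [(g, h)], the Koszul complex would give [D ^ 2 - d1 * d2] for the
    Tjurina number; in general the latter exceeds this value by the codimension of
    [(g, h)] in [A] in large degrees ([hilbert_difference]), whence the inequality.

    Equality means that [A] and [(g, h)] agree in large degrees, hence everywhere,
    since [(g, h)] is saturated ([saturation]).  The syzygies are then generated by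
    the first two generators and by a Koszul syzygy, of degree [D], and minimality
    forces [m = 3] and [d3 = D] ([three_generators]).  Conversely, in that case [A]
    is generated by [h] and by the coefficient of the third generator, whose degree
    is [d1]; this pair is coprime since [A] contains [g], and the same count gives
    equality ([tjurina_bound]). *)

Set Implicit Arguments.
Unset Strict Implicit.
Unset Printing Implicit Defensive.

Import GRing.Theory Num.Theory.
Local Open Scope ring_scope.

(** * Factorial domains *)

Section UFD.
Variable A : idomainType.
Implicit Types a b c p q : A.

Definition divides p a : Prop := exists c, a = c * p.

Definition prime_elt p : Prop :=
  [/\ p != 0, p \isn't a GRing.unit
    & forall a b, divides p (a * b) -> divides p a \/ divides p b].

(** Factoring into primes, rather than irreducible elements, makes the
    factorization unique without a further axiom. *)
Inductive prime_product : A -> Prop :=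
| PrimeUnit u : u \is a GRing.unit -> prime_product u
| PrimeMul p a : prime_elt p -> prime_product a -> prime_product (p * a).

Definition factorial_ring : Prop := forall a, a != 0 -> prime_product a.

Lemma divides_refl a : divides a a.
Proof. by exists 1; rewrite mul1r. Qed.

Lemma divides0 a : divides a 0.
Proof. by exists 0; rewrite mul0r. Qed.

Lemma divides_mull p a b : divides p a -> divides p (b * a).
Proof. by case=> c ->; exists (b * c); rewrite mulrA. Qed.

Lemma divides_mulr p a b : divides p a -> divides p (a * b).
Proof. by rewrite mulrC; apply: divides_mull. Qed.

Lemma divides_trans p a b : divides p a -> divides a b -> divides p b.
Proof. by move=> pa [c ->]; apply: divides_mull. Qed.

Lemma dividesD p a b : divides p a -> divides p b -> divides p (a + b).
Proof. by move=> [c ->] [d ->]; exists (c + d); rewrite mulrDl. Qed.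

Lemma dividesN p a : divides p a -> divides p (- a).
Proof. by move=> [c ->]; exists (- c); rewrite mulNr. Qed.

Lemma dividesB p a b : divides p a -> divides p b -> divides p (a - b).
Proof. by move=> pa /dividesN; apply: dividesD. Qed.

Lemma divides_sum p (I : Type) (r : seq I) (P : pred I) (E : I -> A) :
  (forall i, P i -> divides p (E i)) -> divides p (\sum_(i <- r | P i) E i).
Proof.
by move=> pE; apply: big_ind => //; [apply: divides0|apply: dividesD].
Qed.

Lemma divides_unit p u : u \is a GRing.unit -> divides p u -> p \is a GRing.unit.
Proof. by move=> uU [c cpu]; move: uU; rewrite cpu unitrM => /andP[]. Qed.

Lemma prime_not_unit p u : prime_elt p -> u \is a GRing.unit -> ~ divides p u.
Proof. by case=> _ /negP pU _ uU /(divides_unit uU). Qed.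

Lemma prime_associate p q : prime_elt p -> prime_elt q ->
  divides p q -> divides q p.
Proof.
move=> [p0 /negP pU _] [q0 _ qP] [c qE].
have /qP[[e cE]|//] : divides q (c * p) by rewrite -qE; apply: divides_refl.
case: pU; apply/unitrP; exists e.
suff epE : e * p = 1 by split; rewrite // mulrC.
by apply: (mulIf q0); rewrite mul1r mulrAC -cE -qE.
Qed.

Lemma prime_productM a b :
  prime_product a -> prime_product b -> prime_product (a * b).
Proof.
move=> pa pb; elim: pa => [u uU|p c pP _ IH]; last first.
  by rewrite -mulrA; apply: PrimeMul.
elim: pb => [v vU|p c pP _ IH]; first by apply: PrimeUnit; rewrite unitrM uU.
by rewrite mulrCA; apply: PrimeMul.
Qed.

Lemma prime_product_neq0 a : prime_product a -> a != 0.
Proof.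
elim=> [u|p b [p0 _ _] _ b0]; last by rewrite mulf_neq0.
by apply: contraTneq => ->; rewrite unitr0.
Qed.

Definition coprime_family (I : Type) (n : I -> A) : Prop :=
  forall p, prime_elt p -> exists i, ~ divides p (n i).

(** Dividing the primes of [b] one after the other out of
    [b * w i = c * n i]: each of them must divide [c], for it cannot divide
    every [n i]. *)
Lemma coprime_cancel (I : Type) (n w : I -> A) b c :
  prime_product b -> coprime_family n ->
  (forall i, b * w i = c * n i) -> exists a, c = a * b /\ forall i, w i = a * n i.
Proof.
move=> pb; elim: pb c => [u uU|p a pP _ IH] c cop bw.
  exists (c / u); split=> [|i]; first by rewrite divrK.
  by apply: (mulrI uU); rewrite bw mulrCA mulrA divrK // mulrC.
have [p0 _ pM] := pP.
have [e cE] : divides p c.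
  have [i ni] := cop p pP.
  have /pM[] // : divides p (c * n i) by rewrite -bw -mulrA; apply: divides_mulr (divides_refl p).
have bw' i : a * w i = e * n i.
  by apply: (mulfI p0); rewrite mulrA bw cE; ring.
have [s [eE wE]] := IH e cop bw'.
by exists s; split=> //; rewrite cE eE; ring.
Qed.

End UFD.

Arguments PrimeMul {A p a}.

Section RingIso.
Variables (A B : idomainType) (f : {rmorphism A -> B}) (g : {rmorphism B -> A}).
Hypotheses (fK : cancel f g) (gK : cancel g f).

Lemma divides_morph p c : divides p c -> divides (f p) (f c).
Proof. by case=> e ->; exists (f e); rewrite rmorphM. Qed.

Lemma prime_iso p : prime_elt p -> prime_elt (g p).
Proof.
have gdiv s c : divides s c -> divides (g s) (g c).
  by case=> e ->; exists (g e); rewrite rmorphM.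
move=> [p0 pU pM]; split=> [||s t /divides_morph].
- by rewrite -(rmorph0 g) (inj_eq (can_inj gK)).
- by apply: contra pU => /(rmorph_unit f); rewrite gK.
by rewrite gK rmorphM => /pM[] /gdiv; rewrite fK; [left|right].
Qed.

Lemma factorial_iso : factorial_ring B -> factorial_ring A.
Proof.
move=> factB a a0; have : prime_product (f a).
  by apply: factB; rewrite -(rmorph0 f) (inj_eq (can_inj fK)).
move fa : (f a) => b pb; rewrite -[a]fK fa.
elim: pb {a a0 fa} => [u uU|p c pP _ IH]; first by apply/PrimeUnit/rmorph_unit.
by rewrite rmorphM; apply: PrimeMul => //; apply: prime_iso.
Qed.

End RingIso.

Lemma coprime_family_iso (A B : idomainType) (f : {rmorphism A -> B})
    (g : {rmorphism B -> A}) (I : Type) (n : I -> A) :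
  cancel f g -> cancel g f -> coprime_family n -> coprime_family (f \o n).
Proof.
move=> fK gK cop p pP; have [i ni] := cop _ (prime_iso fK gK pP).
by exists i => /= /(divides_morph g); rewrite fK.
Qed.

(** * Gauss's lemma *)

Section Gauss.
Variable A : idomainType.
Implicit Types (p q : {poly A}) (a c s : A).

Lemma divides_polyC s p : divides s%:P p <-> forall i, divides s p`_i.
Proof.
split=> [[q ->] i|sp]; first by exists q`_i; rewrite coefMC.
exists (\poly_(i < size p) sval (cid (sp i))); apply/polyP=> i.
rewrite coefMC coef_poly; case: ltnP => [_|ip].
  by case: (cid _) => c.
by rewrite nth_default // mul0r.
Qed.

Lemma lead_coef_polyCM s p : lead_coef (s%:P * p) = s * lead_coef p.
Proof. by rewrite lead_coefM lead_coefC. Qed.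

(** Gauss's lemma: when [s] divides [p * q] it divides the product of the
    leading coefficients, hence one of them; the leading term concerned can
    then be removed. *)
Lemma prime_polyC s : prime_elt s -> prime_elt s%:P.
Proof.
move=> [s0 sU sM]; split; first by rewrite polyC_eq0.
  by apply: contra sU; rewrite poly_unitE coefC /= => /andP[].
have drop_lead p q : divides s%:P (p * q) -> divides s (lead_coef p) ->
    exists2 p' : {poly A}, p != 0 -> (size p' < size p)%N &
      divides s%:P (p' * q) /\ (divides s%:P p' -> divides s%:P p).
  move=> spq [c cE]; exists (p - (c * s)%:P * 'X^((size p).-1)).
    move=> p0; rewrite (polySpred p0) ltnS; apply/leq_sizeP => j pj.
    rewrite coefB coefCM coefXn; case: eqP => [->|/eqP jp].
      by rewrite mulr1 -cE lead_coefE subrr.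
    rewrite mulr0 subr0 nth_default // (polySpred p0) ltn_neqAle pj eq_sym.
    by rewrite jp.
  have sX : divides s%:P ((c * s)%:P * 'X^((size p).-1)).
    by rewrite polyCM mulrAC; apply: divides_mull (divides_refl _).
  rewrite mulrBl; split; first exact: dividesB (divides_mulr _ sX).
  by move=> sp'; rewrite -[p](subrK ((c * s)%:P * 'X^((size p).-1))); apply: dividesD.
move=> p q; move: {2}(size p + size q)%N (leqnn (size p + size q)) => n.
elim: n p q => [|n IH] p q pqn spq.
  move: pqn; rewrite leqn0 addn_eq0 size_poly_eq0 => /andP[/eqP-> _].
  by left; apply: divides0.
have [->|p0] := eqVneq p 0; first by left; apply: divides0.
have [->|q0] := eqVneq q 0; first by right; apply: divides0.
have : divides s (lead_coef p * lead_coef q).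
  by rewrite -lead_coefM lead_coefE; have /divides_polyC := spq; apply.
case/sM => sl.
  have [p' /(_ p0) p'p [sp'q p'P]] := drop_lead p q spq sl.
  have /IH[] // : (size p' + size q <= n)%N.
    by rewrite -ltnS; apply: leq_trans pqn; rewrite ltn_add2r.
  - by left; apply: p'P.
  - by right.
rewrite mulrC in spq.
have [q' /(_ q0) q'q [sq'p q'P]] := drop_lead q p spq sl.
rewrite mulrC in sq'p; have /IH[] // : (size p + size q' <= n)%N.
  by rewrite -ltnS; apply: leq_trans pqn; rewrite ltn_add2l.
- by left.
- by right; apply: q'P.
Qed.

Lemma prime_product_polyC c : prime_product c -> prime_product c%:P.
Proof.
elim=> [u uU|s a sP _ IH]; first by apply: PrimeUnit; rewrite rmorph_unit.
by rewrite polyCM; apply: PrimeMul => //; apply: prime_polyC.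
Qed.

Definition primitive p := forall s, prime_elt s -> ~ divides s%:P p.

(** The primes of the leading coefficient are tested one after the other; [b]
    is the product of those already known not to divide [p]. *)
Lemma primitive_part p : p != 0 -> prime_product (lead_coef p) ->
  exists c q, [/\ prime_product c, p = c%:P * q & primitive q].
Proof.
move=> p0 pl; rewrite -[lead_coef p]mul1r in pl *.
suff H a : prime_product a -> forall b p, p != 0 -> lead_coef p = b * a ->
    (forall s, prime_elt s -> divides s b -> ~ divides s%:P p) ->
    exists c q, [/\ prime_product c, p = c%:P * q & primitive q].
  rewrite mul1r in pl; apply: (H _ pl 1) => //; first by rewrite mul1r.
  by move=> s sP s1 _; apply: (prime_not_unit sP) s1; rewrite unitr1.
elim=> [u uU|s {}a sP _ IH] b {pl p0}p p0 lp bP.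
  exists 1, p; split; [by apply: PrimeUnit; rewrite unitr1|by rewrite mul1r|].
  move=> s sP sp; apply: (bP s sP) => //.
  have : divides s (b * u) by rewrite -lp lead_coefE; have /divides_polyC := sp; apply.
  have [_ _ sM] := sP.
  by case/sM => // /(divides_unit uU) /negP[]; case: sP => _ /negP.
have [[q pE]|nsp] := pselect (divides s%:P p); last first.
  apply: (IH (b * s)) => //; first by rewrite lp mulrA.
  move=> t tP; have [_ _ tM] := tP; case/tM => [|ts tp]; first exact: bP.
  apply: nsp; apply: divides_trans tp.
  by case: (prime_associate tP sP ts) => e ->; exists e%:P; rewrite polyCM.
have s0 : s != 0 by case: sP.
have q0 : q != 0 by apply: contraNneq p0 => q0; rewrite pE q0 mul0r.
have lq : lead_coef q = b * a.
  by apply: (mulfI s0); rewrite -lead_coef_polyCM mulrC -pE lp mulrCA.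
have [t tP tb tq|c [r [cP qE rP]]] := IH b q q0 lq.
  by apply: (bP t tP tb); rewrite pE; apply: divides_mulr.
exists (s * c), r; split=> //; first exact: PrimeMul.
by rewrite pE qE polyCM mulrC mulrA.
Qed.

(** By Gauss's lemma each prime of [c] divides one of the two factors, out of
    which it is taken. *)
Lemma cancel_content c p q r : prime_product c -> c%:P * p = q * r ->
  exists q' r', [/\ p = q' * r', size q' = size q & size r' = size r].
Proof.
move=> pc; elim: pc q r => [u uU|s a sP _ IH] q r cpE.
  exists (u^-1%:P * q), r; split=> //.
    by rewrite -mulrA -cpE mulrA -polyCM mulVr // mul1r.
  rewrite mul_polyC size_scale //.
  by apply: contraTneq uU => u0; rewrite -[u]invrK u0 invr0 unitr0.
have s0 : s%:P != 0 by rewrite polyC_eq0; case: sP.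
have [_ _ sM] := prime_polyC sP.
have /sM[[e qE]|[e rE]] : divides s%:P (q * r).
  by rewrite -cpE polyCM -mulrA; apply: divides_mulr (divides_refl _).
- have [|q' [r' [pE q'q r'r]]] := IH e r.
    by apply: (mulfI s0); rewrite mulrA -polyCM cpE qE; ring.
  exists q', r'; split=> //; rewrite q'q qE mulrC mul_polyC size_scale //.
  by case: sP.
- have [|q' [r' [pE q'q r'r]]] := IH q e.
    by apply: (mulfI s0); rewrite mulrA -polyCM cpE rE; ring.
  exists q', r'; split=> //; rewrite r'r rE mulrC mul_polyC size_scale //.
  by case: sP.
Qed.

(** The primes of [c] do not divide [p], so each of them divides [r]. *)
Lemma primitive_cancel c p q r : prime_product c -> primitive p ->
  c%:P * q = r * p -> divides p q.
Proof.
move=> pc pP; elim: pc r => [u uU|s a sP _ IH] r cqE.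
  by exists (u^-1%:P * r); rewrite -mulrA -cqE mulrA -polyCM mulVr ?mul1r.
have s0 : s%:P != 0 by rewrite polyC_eq0; case: sP.
have [_ _ sM] := prime_polyC sP.
have /sM[[e rE]|/(pP s sP)//] : divides s%:P (r * p).
  by rewrite -cqE polyCM -mulrA; apply: divides_mulr (divides_refl _).
by apply: (IH e); apply: (mulfI s0); rewrite mulrA -polyCM cqE rE; ring.
Qed.

(** A primitive polynomial that does not split over the field of fractions is
    prime, by Gauss's lemma; one that splits is a product of two polynomials
    of smaller size. *)
Lemma poly_factorial : factorial_ring A -> factorial_ring {poly A}.
Proof.
move=> factA p; move: {2}(size p) (leqnn (size p)) => n.
elim: n p => [|n IH] p pn p0.
  by move: pn; rewrite leqn0 size_poly_eq0 (negPf p0).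
have lp0 : lead_coef p != 0 by rewrite lead_coef_eq0.
have [c [q [cP pE qP]]] := primitive_part p0 (factA _ lp0).
rewrite pE; apply: prime_productM; first exact: prime_product_polyC.
have c0 := prime_product_neq0 cP.
have {pE pn p0 lp0} [qn q0] : (size q <= n.+1)%N /\ q != 0.
  split; first by move: pn; rewrite pE mul_polyC size_scale.
  by apply: contraNneq p0 => q0; rewrite pE q0 mulr0.
have [q1|q1] := eqVneq (size q) 1%N.
  by rewrite (size1_polyC (eq_leq q1)); apply/prime_product_polyC/factA;
     rewrite -polyC_eq0 -(size1_polyC (eq_leq q1)).
have qU : q \isn't a GRing.unit by rewrite poly_unitE (negPf q1).
have [qirr|] := pselect (irreducible_poly q).
  rewrite -[q]mulr1; apply: PrimeMul; last by apply: PrimeUnit; rewrite unitr1.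
  split=> // a b [e abE].
  have toK r : (q %| r)%R -> divides q r.
    case/Pdiv.Idomain.dvdpP => -[a1 a2] /= a10 a1r.
    by apply: (primitive_cancel (factA _ a10) qP (r := a2)); rewrite mul_polyC.
  have qab : (q %| a * b)%R.
    by apply/Pdiv.Idomain.dvdpP; exists (1, e); rewrite ?oner_neq0 //= scale1r.
  have [cop|] := boolP (coprimep q a).
    by right; apply: toK; rewrite -(Pdiv.Idomain.Gauss_dvdpr b cop).
  rewrite coprimep_def => gn1.
  left; apply: toK; have := Pdiv.Idomain.dvdp_gcdr q a.
  by rewrite (Pdiv.Idomain.eqp_dvdl _ (qirr.2 _ gn1 (Pdiv.Idomain.dvdp_gcdl q a))).
move=> nirr; have q2 : (1 < size q)%N.
  by rewrite ltn_neqAle eq_sym q1 size_poly_gt0.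
have [r [r1 rq rnq]] : exists r : {poly A}, [/\ size r != 1%N, (r %| q)%R & ~~ (r %= q)%R].
  apply: contrapT => H; apply: nirr; split=> // r r1 rq.
  by apply/negPn/negP => rnq; apply: H; exists r.
case/Pdiv.Idomain.dvdpP: (rq) => -[a1 a2] /= a10 a1q.
have [q' [r' [qE q'a2 r'r]]] := cancel_content (factA _ a10) (etrans (mul_polyC _ _) a1q).
have /andP[q'0 r'0] : (q' != 0) && (r' != 0) by rewrite -negb_or -mulf_eq0 -qE.
have rlt : (size r' < size q)%N.
  rewrite r'r ltn_neqAle (Pdiv.Idomain.dvdp_leq q0 rq) andbT.
  by rewrite (Pdiv.Idomain.dvdp_size_eqp rq).
have := size_mul q'0 r'0; rewrite -qE => szq.
rewrite qE; apply: prime_productM; apply: IH => //; rewrite -ltnS; last exact: leq_trans rlt qn.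
apply: leq_trans qn; rewrite szq.
have : (1 < size r')%N by rewrite r'r ltn_neqAle eq_sym r1 -r'r size_poly_gt0.
by case: (size r') => [|[|k]] // _; rewrite !addnS /= ltnS leq_addr.
Qed.

End Gauss.

(** * Adjoining the last variable *)

Section MpolyRing.
Variables (n : nat) (F : fieldType).

Lemma mpoly_alg_ind (P : {mpoly F[n]} -> Prop) :
  (forall c, P c%:MP) -> (forall i, P 'X_i) ->
  (forall p q, P p -> P q -> P (p + q)) ->
  (forall p q, P p -> P q -> P (p * q)) -> forall p, P p.
Proof.
move=> PC PX PD PM; elim/mpolyind => [|c m p _ _ Pp]; first by rewrite -mpolyC0.
apply: PD => //; rewrite -mul_mpolyC; apply: (PM) => //.
rewrite mpolyXE_id; apply: big_ind => [||i _]; [exact: PC 1|exact: PM|].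
by elim: (m i) => [|k IH]; rewrite ?expr0 ?exprS; [exact: PC 1|exact: PM].
Qed.

End MpolyRing.

Section MpolyUnivariate.
Variables (n : nat) (F : fieldType).

Lemma const_mpoly_unit (c : F) : c != 0 -> c%:MP_[n] \is a GRing.unit.
Proof. by move=> c0; rewrite rmorph_unit // unitfE. Qed.

(** The inverse of [muni]. *)
Definition last_var_morph (p : {poly {mpoly F[n]}}) : {mpoly F[n.+1]} :=
  (map_poly (@mwiden n F) p).['X_ord_max].

Lemma last_var_morph_is_additive : additive last_var_morph.
Proof. by move=> p q; rewrite /last_var_morph rmorphB hornerD hornerN. Qed.

Lemma last_var_morph_is_multiplicative : multiplicative last_var_morph.
Proof.
split=> [p q|]; rewrite /last_var_morph ?rmorph1 ?hornerC //.
by rewrite rmorphM hornerM.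
Qed.

HB.instance Definition _ := GRing.isAdditive.Build _ _ last_var_morph
  last_var_morph_is_additive.
HB.instance Definition _ := GRing.isMultiplicative.Build _ _ last_var_morph
  last_var_morph_is_multiplicative.

Lemma muni_widen (i : 'I_n) :
  muni ('X_(widen_ord (leqnSn n) i) : {mpoly F[n.+1]}) = ('X_i)%:P.
Proof.
rewrite muniE msuppX big_seq1 mcoeffX eqxx scale1r.
rewrite mnmE -val_eqE /= ltn_eqF // expr0 alg_polyC; congr ('X_[_])%:P.
by apply/mnmP => j; rewrite !mnmE -!val_eqE.
Qed.

Lemma muni_last : muni ('X_ord_max : {mpoly F[n.+1]}) = 'X.
Proof.
rewrite muniE msuppX big_seq1 mcoeffX eqxx scale1r mnmE eqxx expr1.
rewrite (_ : [multinom _ | i < n] = 0%MM) ?mpolyX0 ?scale1r //.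
by apply/mnmP => j; rewrite !mnmE -val_eqE /= gtn_eqF.
Qed.

Lemma mwidenXU (i : 'I_n) :
  mwiden ('X_i : {mpoly F[n]}) = 'X_(widen_ord (leqnSn n) i).
Proof. by rewrite mwidenX mnmwiden1. Qed.

Lemma muni_mwiden (p : {mpoly F[n]}) : muni (mwiden p) = p%:P.
Proof.
elim/mpoly_alg_ind: p => [c|i|p q IHp IHq|p q IHp IHq].
- by rewrite mwidenC muniC.
- by rewrite mwidenXU muni_widen.
- by rewrite mwidenD muniD IHp IHq polyCD.
- by rewrite mwidenM muniM IHp IHq polyCM.
Qed.

Lemma last_var_morphC (p : {mpoly F[n]}) : last_var_morph p%:P = mwiden p.
Proof. by rewrite /last_var_morph map_polyC hornerC. Qed.

Lemma last_var_morphX : last_var_morph 'X = 'X_ord_max.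
Proof. by rewrite /last_var_morph map_polyX hornerX. Qed.

Lemma last_var_morphK : cancel last_var_morph (@muni n F).
Proof.
move=> p; elim/poly_ind: p => [|p c IH]; first by rewrite rmorph0 muni0.
rewrite rmorphD rmorphM /= last_var_morphC last_var_morphX.
by rewrite muniD muniM IH muni_last muni_mwiden.
Qed.

Lemma ord_lastP (i : 'I_n.+1) :
  i = ord_max \/ exists j, i = widen_ord (leqnSn n) j.
Proof.
have [i_n|] := ltnP i n; first by right; exists (Ordinal i_n); apply: val_inj.
by move=> n_i; left; apply: val_inj; apply/eqP; rewrite eqn_leq n_i -ltnS ltn_ord.
Qed.

Lemma muniK : cancel (@muni n F) last_var_morph.
Proof.
move=> p; elim/mpoly_alg_ind: p => [c|i|p q IHp IHq|p q IHp IHq].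
- by rewrite muniC last_var_morphC mwidenC.
- have [->|[j ->]] := ord_lastP i; first by rewrite muni_last last_var_morphX.
  by rewrite muni_widen last_var_morphC mwidenXU.
- by rewrite muniD (rmorphD last_var_morph); apply: congr2 IHp IHq.
- by rewrite muniM (rmorphM last_var_morph); apply: congr2 IHp IHq.
Qed.

End MpolyUnivariate.

(** Adjoining the variables one by one. *)
Lemma mpoly_factorial n (F : fieldType) : factorial_ring {mpoly F[n]}.
Proof.
elim: n => [p p0|n IH]; last first.
  exact: factorial_iso (@muniK n F) (@last_var_morphK n F) (poly_factorial IH).
apply: PrimeUnit; rewrite -[p]mpolyKC const_mpoly_unit //.
by apply: contraNneq p0 => p0; rewrite -[p]mpolyKC p0 mpolyC0.
Qed.

(** * Ideals and elimination *)

Section Ideals.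
Variable A : comNzRingType.

Definition is_ideal (I : set A) : Prop :=
  [/\ I 0, forall a b, I a -> I b -> I (a + b) & forall a b, I b -> I (a * b)].

Definition gen_ideal r (n : 'I_r -> A) : set A :=
  [set u | exists c : 'I_r -> A, u = \sum_i c i * n i].

Definition add_elt (I : set A) (y : A) : set A :=
  [set u | exists q, I (u - q * y)].

Lemma gen_ideal_ideal r (n : 'I_r -> A) : is_ideal (gen_ideal n).
Proof.
split=> [|a b [c ->] [e ->]|a b [c ->]].
- by exists (fun=> 0); rewrite big1 // => i _; rewrite mul0r.
- exists (fun i => c i + e i); rewrite -big_split /=.
  by apply: eq_bigr => i _; rewrite mulrDl.
- exists (fun i => a * c i); rewrite mulr_sumr.
  by apply: eq_bigr => i _; rewrite mulrA.
Qed.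

Lemma gen_ideal_gen r (n : 'I_r -> A) i : gen_ideal n (n i).
Proof.
exists (fun j => (j == i)%:R); rewrite (bigD1 i) //= eqxx mul1r big1 ?addr0 //.
by move=> j /negPf->; rewrite mul0r.
Qed.

Section Closure.
Variables (I : set A) (idI : is_ideal I).

Lemma ideal0 : I 0. Proof. by case: idI. Qed.

Lemma idealD a b : I a -> I b -> I (a + b).
Proof. by case: idI => _ + _; apply. Qed.

Lemma ideal_mull a b : I b -> I (a * b).
Proof. by case: idI => _ _; apply. Qed.

Lemma ideal_mulr a b : I a -> I (a * b).
Proof. by rewrite mulrC; apply: ideal_mull. Qed.

Lemma idealN a : I a -> I (- a).
Proof. by rewrite -mulN1r; apply: ideal_mull. Qed.

Lemma idealB a b : I a -> I b -> I (a - b).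
Proof. by move=> Ia /idealN; apply: idealD. Qed.

Lemma ideal_trans a b : I (a - b) -> I b -> I a.
Proof. by move=> Iab Ib; rewrite -[a](subrK b); apply: idealD. Qed.

Lemma ideal_sum (J : Type) (r : seq J) (P : pred J) (E : J -> A) :
  (forall j, P j -> I (E j)) -> I (\sum_(j <- r | P j) E j).
Proof. by move=> IE; apply: big_ind => //; [apply: ideal0|apply: idealD]. Qed.

Lemma ideal_exp a k l : (k <= l)%N -> I (a ^+ k) -> I (a ^+ l).
Proof. by move=> kl Ia; rewrite -(subnK kl) exprD; apply: ideal_mull. Qed.

Lemma ideal_expD a b k l : I (a ^+ k) -> I (b ^+ l) -> I ((a + b) ^+ (k + l)).
Proof.
move=> Ia Ib; rewrite exprDn; apply: ideal_sum => i _.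
rewrite -mulr_natl; apply: ideal_mull; have [il|li] := leqP l i.
  by apply: ideal_mull; apply: ideal_exp Ib.
by apply: ideal_mulr; apply: ideal_exp Ia; rewrite -addnBA ?leq_addr // ltnW.
Qed.

Lemma add_elt_ideal y : is_ideal (add_elt I y).
Proof.
split=> [|a b [p Ia] [q Ib]|a b [q Ib]].
- by exists 0; rewrite mul0r subr0; apply: ideal0.
- exists (p + q); have -> : a + b - (p + q) * y = (a - p * y) + (b - q * y) by ring.
  exact: idealD.
- exists (a * q); have -> : a * b - a * q * y = a * (b - q * y) by ring.
  exact: ideal_mull.
Qed.

Lemma sub_add_elt y a : I a -> add_elt I y a.
Proof. by move=> Ia; exists 0; rewrite mul0r subr0. Qed.

Lemma mem_add_elt y : add_elt I y y.
Proof. by exists 1; rewrite mul1r subrr; apply: ideal0. Qed.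

End Closure.

End Ideals.

Lemma preim_ideal (A B : comNzRingType) (f : {rmorphism A -> B}) (I : set B) :
  is_ideal I -> is_ideal [set a | I (f a)].
Proof.
move=> idI; split=> [|a b /= Ia Ib|a b /= Ib] /=.
- by rewrite rmorph0; apply: ideal0 idI.
- by rewrite rmorphD; apply: idealD.
- by rewrite rmorphM; apply: ideal_mull.
Qed.

(** A nonzero element of least size of the ideal divides all the [n i] up to
    multiplication by nonzero elements of [A]; were its primitive part not
    constant, a prime factor of the latter would be common to all the [n i]. *)
Lemma elimination (A : idomainType) r (n : 'I_r -> {poly A}) i0 :
  factorial_ring A -> n i0 != 0 -> coprime_family n ->
  exists2 a : A, a != 0 & gen_ideal n a%:P.
Proof.
move=> factA n0 cop; have idn := gen_ideal_ideal n.
pose P k := `[< exists G, [/\ gen_ideal n G, G != 0 & size G = k] >].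
have exP : exists k, P k.
  exists (size (n i0)); apply/asboolP; exists (n i0); split=> //.
  exact: gen_ideal_gen.
have [k /asboolP[G [IG G0 <-]] Gmin] := ex_minnP exP.
have Gdiv i : exists2 c, c != 0 & exists q, c%:P * n i = q * G.
  exists (lead_coef G ^+ scalp (n i) G); first by rewrite expf_neq0 // lead_coef_eq0.
  exists (n i %/ G)%R; have := Pdiv.Idomain.divp_eq (n i) G.
  rewrite -mul_polyC => E; rewrite E.
  have [->|m0] := eqVneq (n i %% G)%R 0; first by rewrite addr0.
  have := Pdiv.Idomain.ltn_modp (n i) G; rewrite G0 ltnNge Gmin //.
  apply/asboolP; exists (n i %% G)%R; split=> //.
  have -> : (n i %% G)%R = (lead_coef G ^+ scalp (n i) G)%:P * n i - (n i %/ G)%R * G.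
    by rewrite E; ring.
  by apply: (idealB idn); apply: (ideal_mull idn) => //; apply: gen_ideal_gen.
have lG0 : lead_coef G != 0 by rewrite lead_coef_eq0.
have [c [H [cP GE HP]]] := primitive_part G0 (factA _ lG0).
have [H1|H1] := leqP (size H) 1.
  have H0 : H != 0 by apply: contraNneq G0 => H0; rewrite GE H0 mulr0.
  exists (c * H`_0).
    apply: mulf_neq0; first exact: prime_product_neq0.
    by rewrite -polyC_eq0 -size1_polyC.
  by rewrite polyCM -(size1_polyC H1) -GE.
have H0 : H != 0 by rewrite -size_poly_gt0 ltnW.
have : prime_product H by apply: poly_factorial.
case HE : _ / => [u uU|p q pP _].
  by move: uU H1; rewrite -HE poly_unitE => /andP[/eqP->].
have [i []] := cop p pP; have [e e0 [s ns]] := Gdiv i.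
have [p0 _ pM] := pP; have pH : divides p H by rewrite HE; apply/divides_mulr/divides_refl.
have : divides p (e%:P * n i).
  by rewrite ns GE; apply/divides_mull/divides_mull.
case/pM => // -[t et]; exfalso.
have t0 : t != 0 by apply: contraNneq e0 => t0; rewrite -polyC_eq0 et t0 mul0r.
have p1 : (size p <= 1)%N.
  have := size_mul t0 p0; rewrite -et size_polyC e0 /=.
  have : (0 < size t)%N by rewrite size_poly_gt0.
  by case: (size t) => // a _; rewrite addSn /= => ->; apply: leq_addl.
have pC := size1_polyC p1.
apply: (HP p`_0); last by rewrite -pC.
split.
- by rewrite -polyC_eq0 -pC.
- by case: pP => _ + _; apply: contra => pU; rewrite pC rmorph_unit.
move=> a b [d abE].
have : divides p (a%:P * b%:P) by exists d%:P; rewrite -polyCM abE polyCM -pC.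
by case/pM => -[f fE]; [left|right]; exists f`_0;
   have := congr1 (fun g : {poly A} => g`_0) fE; rewrite coefC {1}pC coefMC /=.
Qed.

(** * Forms *)

Section Homogeneous.
Variables (n : nat) (F : fieldType).
Implicit Types (u f : {mpoly F[n]}).

Lemma pihomogM k e u f : f \is e.-homog ->
  pihomog mdeg (k + e) (u * f) = pihomog mdeg k u * f.
Proof.
move=> fe; elim/mpolyind: u => [|c m p _ _ IH].
  by rewrite mul0r !linear0 mul0r.
rewrite mulrDl !linearD /= mulrDl IH; congr (_ + _).
rewrite -scalerAl !linearZ /= -scalerAl; congr (_ *: _).
have Xf : 'X_[m] * f \is (mdeg m + e).-homog by apply: dhomogM; rewrite ?dhomogX.
rewrite pihomogX; case: eqP => [<-|mk]; first by rewrite pihomog_dE.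
by rewrite mul0r (pihomog_ne0 _ Xf) // eqn_add2r; apply/eqP.
Qed.

Lemma pihomogM_lt k e u f : f \is e.-homog -> (k < e)%N ->
  pihomog mdeg k (u * f) = 0.
Proof.
move=> fe ke; elim/mpolyind: u => [|c m p _ _ IH].
  by rewrite mul0r linear0.
rewrite mulrDl linearD /= IH addr0 -scalerAl linearZ /=.
have Xf : 'X_[m] * f \is (mdeg m + e).-homog by apply: dhomogM; rewrite ?dhomogX.
by rewrite (pihomog_ne0 _ Xf) ?scaler0 // gtn_eqF // (leq_trans ke) ?leq_addl.
Qed.

Lemma gen_ideal_pihomog r (f : 'I_r -> {mpoly F[n]}) (e : 'I_r -> nat) k u :
  (forall i, f i \is (e i).-homog) -> gen_ideal f u ->
  gen_ideal f (pihomog mdeg k u).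
Proof.
move=> fe [c ->]; rewrite linear_sum.
apply: (ideal_sum (gen_ideal_ideal f)) => i _ /=.
have [ik|ki] := leqP (e i) k; last first.
  by rewrite (pihomogM_lt _ (fe i)) //; apply: ideal0 (gen_ideal_ideal f).
rewrite -(subnK ik) (pihomogM _ _ (fe i)).
by apply: (ideal_mull (gen_ideal_ideal f)); apply: gen_ideal_gen.
Qed.

Lemma pihomog_neq0 u : u != 0 -> exists k, pihomog mdeg k u != 0.
Proof.
move=> u0; apply: contrapT => /forallNP H; case/eqP: u0.
rewrite (pihomog_partitionE (leqnn (mmeasure mdeg u))) big1 // => k _.
by apply/eqP/negPn/negP => /H.
Qed.

Lemma comp_mpoly_homog m s (l : n.-tuple {mpoly F[m]}) u :
  (forall i, tnth l i \is 1.-homog) -> u \is s.-homog -> u \mPo l \is s.-homog.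
Proof.
move=> l1 /dhomogP us; rewrite comp_mpolyEX big_seq; apply: rpred_sum => /= t tu.
have <- : mdeg t = s := us t tu.
rewrite rpredZ // comp_mpolyX mdegE.
elim/big_rec2: _ => [|i a b _ ba]; first exact: dhomog1.
by apply: dhomogM => //; have := dhomogMn (t i) (l1 i); rewrite mul1n.
Qed.

Lemma meval_homogZ s u (c : F) (v w : 'I_n -> F) : u \is s.-homog ->
  (forall i, w i = c * v i) -> u.@[w] = c ^+ s * u.@[v].
Proof.
move=> /dhomogP us wE; rewrite !mevalE mulr_sumr; apply: eq_big_seq => m mu.
have <- : mdeg m = s := us m mu.
rewrite mulrCA; congr (_ * _); rewrite mdegE -prodrXr -big_split /=.
by apply: eq_bigr => i _; rewrite wE exprMn.
Qed.

Lemma comp_mpoly_scalar m s u (P : 'I_n -> F) (l : {mpoly F[m]}) :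
  u \is s.-homog -> u \mPo [tuple P i *: l | i < n] = u.@[P] *: l ^+ s.
Proof.
move=> /dhomogP us; rewrite comp_mpolyEX mevalE scaler_suml.
apply: eq_big_seq => t tu; rewrite comp_mpolyX -scalerA; congr (_ *: _).
have <- : mdeg t = s := us t tu.
rewrite mdegE -prodrXr -scaler_prod.
by apply: eq_bigr => i _; rewrite tnth_mktuple exprZn.
Qed.

(** Modulo the equations of the line through [P], parametrised by a linear
    form [l], a form is determined by its value at [P]. *)
Lemma homog_congr (I : set {mpoly F[n]}) s u (P : 'I_n -> F) l :
  is_ideal I -> (forall i, I ('X_i - P i *: l)) -> u \is s.-homog ->
  I (u - u.@[P] *: l ^+ s).
Proof.
move=> idI IP us; rewrite -(comp_mpoly_scalar P l us).
elim/mpoly_alg_ind: u {us} => [c|i|p q Ip Iq|p q Ip Iq].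
- by rewrite comp_mpolyC subrr; apply: ideal0 idI.
- by rewrite comp_mpolyXU -tnth_nth tnth_mktuple.
- rewrite comp_mpolyD (_ : _ - _ = (p - (p \mPo [tuple P i *: l | i < n])) +
    (q - (q \mPo [tuple P i *: l | i < n]))); first exact: (idealD idI).
  by rewrite opprD addrACA.
rewrite rmorphM /=; set p' := p \mPo _ in Ip *; set q' := q \mPo _ in Iq *.
rewrite (_ : _ - _ = q * (p - p') + p' * (q - q')); last by ring.
by apply: (idealD idI); apply: (ideal_mull idI).
Qed.

(** A monomial of degree greater than [n * M] has an exponent at least [M]. *)
Lemma homog_in_ideal (I : set {mpoly F[n]}) M k u :
  is_ideal I -> (forall i, I ('X_i ^+ M)) -> (n * M < k)%N -> u \is k.-homog -> I u.
Proof.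
move=> idI IX nMk /dhomogP uk; rewrite [u]mpolyE big_seq; apply: (ideal_sum idI) => m mu.
rewrite -mul_mpolyC; apply: (ideal_mull idI).
have [i Mm] : exists i, (M <= m i)%N.
  have mk : mdeg m = k := uk m mu.
  apply: contrapT => /forallNP mM; move: nMk; rewrite -mk mdegE ltnNge.
  rewrite -[X in (_ <= X * _)%N]card_ord -sum_nat_const leq_sum // => i _.
  by have /negP := mM i; rewrite -ltnNge => /ltnW.
rewrite mpolyXE_id (bigD1 i) //=; apply: (ideal_mulr idI).
exact: (ideal_exp idI Mm).
Qed.

End Homogeneous.

Lemma pihomog_mwiden n (F : fieldType) k (p : {mpoly F[n]}) :
  pihomog mdeg k (mwiden p) = mwiden (pihomog mdeg k p).
Proof.
elim/mpolyind: p => [|c m p _ _ IH].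
  by rewrite mwiden0 !linear0 mwiden0.
rewrite mwidenD mwidenZ mwidenX !linearD /= mwidenD IH; congr (_ + _).
rewrite !linearZ /= mwidenZ !pihomogX /=; congr (_ *: _).
have /= -> : mdeg (mnmwiden m) = mdeg m.
  rewrite !mdegE big_ord_recr /= mnmwiden_ordmax addn0.
  by apply: eq_bigr => i _; rewrite mnmwiden_widen.
by case: ifP => _; rewrite ?mwiden0 ?mwidenX.
Qed.

(** * Values of polynomials and changes of coordinates *)

Section Evaluation.
Variable F : numFieldType.

Lemma poly_neq0_eval (p : {poly F}) : p != 0 -> exists c, p.[c] != 0.
Proof.
move=> p0; apply: contrapT => /forallNP H.
pose s := [seq i%:R : F | i <- iota 0 (size p)].
have : (size s < size p)%N.
  apply: max_poly_roots => //.
    by apply/allP => c _; apply/negPn/negP => /H.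
  by rewrite map_inj_uniq ?iota_uniq // => i j /eqP; rewrite eqr_nat => /eqP.
by rewrite size_map size_iota ltnn.
Qed.

Lemma meval_muni n (p : {mpoly F[n.+1]}) (v : 'I_n.+1 -> F) :
  p.@[v] = (map_poly (meval (fun i => v (widen_ord (leqnSn n) i))) (muni p)).[v ord_max].
Proof.
elim/mpoly_alg_ind: p => [c|i|p q IHp IHq|p q IHp IHq].
- by rewrite muniC map_polyC /= hornerC !mevalC.
- rewrite mevalXU; have [->|[j ->]] := ord_lastP i.
    by rewrite muni_last map_polyX hornerX.
  by rewrite muni_widen map_polyC hornerC /= mevalXU.
- by rewrite mevalD muniD IHp IHq -hornerD -(rmorphD (map_poly _)).
- by rewrite mevalM muniM IHp IHq -hornerM -(rmorphM (map_poly _)).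
Qed.

Lemma mpoly_neq0_eval n (p : {mpoly F[n]}) : p != 0 -> exists v, p.@[v] != 0.
Proof.
elim: n p => [|n IH] p p0.
  exists (fun=> 0); rewrite -[p]mpolyKC mevalC.
  by apply: contraNneq p0 => p0; rewrite -[p]mpolyKC p0 mpolyC0.
have : muni p != 0 by rewrite -(muni0 n F) (inj_eq (can_inj (@muniK n F))).
rewrite -lead_coef_eq0 => /IH[v vl].
have /poly_neq0_eval[c cP] : map_poly (meval v) (muni p) != 0.
  apply: contraNneq vl => /(congr1 (fun q : {poly F} => q`_(size (muni p)).-1)).
  by rewrite coef_map coef0 -lead_coefE => ->.
exists (fun i => if unlift ord_max i is Some j then v j else c).
rewrite meval_muni unlift_none (eq_map_poly (g := meval v)) // => q.
apply: meval_eq => i; have -> : widen_ord (leqnSn n) i = lift ord_max i.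
  by apply: val_inj; rewrite /= /bump leqNgt ltn_ord.
by rewrite liftK.
Qed.

(** Multiplying by the [i]-th variable before picking a point makes its [i]-th
    coordinate invertible. *)
Lemma homog_neq0_eval n (p : {mpoly F[n]}) s i : p \is s.-homog -> p != 0 ->
  exists v, v i = 1 /\ p.@[v] != 0.
Proof.
move=> ps p0; have X0 : 'X_i != 0 :> {mpoly F[n]} by rewrite -msize_poly_eq0 msizeX.
have [w] := mpoly_neq0_eval (mulf_neq0 p0 X0).
rewrite mevalM mevalXU mulf_eq0 negb_or => /andP[pw wi].
exists (fun j => (w i)^-1 * w j); split; first by rewrite mulVf.
by rewrite (meval_homogZ ps (fun=> erefl)) mulf_neq0 // expf_neq0 // invr_eq0.
Qed.

End Evaluation.

Section Shear.
Variables (n : nat) (F : fieldType).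
Implicit Types (w : 'I_n.+1 -> F) (p : {mpoly F[n.+1]}).

(** When [w ord_max = 1], this change of coordinates moves the last coordinate
    point to [w]. *)
Definition shear w p : {mpoly F[n.+1]} :=
  p \mPo [tuple if i == ord_max then 'X_i else 'X_i + w i *: 'X_ord_max | i < n.+1].

HB.instance Definition _ w := GRing.RMorphism.copy (shear w)
  (comp_mpoly [tuple if i == ord_max then 'X_i else 'X_i + w i *: 'X_ord_max | i < n.+1]).

Lemma shearXU w i :
  shear w 'X_i = if i == ord_max then 'X_i else 'X_i + w i *: 'X_ord_max.
Proof. by rewrite /shear comp_mpolyXU -tnth_nth tnth_mktuple. Qed.

Lemma shearZ w c p : shear w (c *: p) = c *: shear w p.
Proof. exact: comp_mpolyZ. Qed.

Lemma shearK w : cancel (shear w) (shear (fun i => - w i)).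
Proof.
move=> p; elim/mpoly_alg_ind: p => [c|i|p q IHp IHq|p q IHp IHq].
- by rewrite /shear !comp_mpolyC.
- rewrite shearXU; case: eqP => [->|/eqP i_max]; first by rewrite shearXU eqxx.
  by rewrite rmorphD /= shearZ !shearXU eqxx (negPf i_max) scaleNr subrK.
- by rewrite !rmorphD /= IHp IHq.
- by rewrite !rmorphM /= IHp IHq.
Qed.

Lemma shearVK w : cancel (shear (fun i => - w i)) (shear w).
Proof.
move=> p; rewrite -[RHS](shearK (fun i => - w i) p); congr (shear _ _).
by apply: funext => i; rewrite opprK.
Qed.

Lemma shear_homog w s p : p \is s.-homog -> shear w p \is s.-homog.
Proof.
apply: comp_mpoly_homog => i; rewrite tnth_mktuple.
have XU j : 'X_j \is [in F[n.+1], 1.-homog] by rewrite dhomogX /= mdeg1.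
by case: ifP => _ //; rewrite rpredD ?rpredZ.
Qed.

Lemma meval_shear w p : w ord_max = 1 ->
  (shear w p).@[fun i => (i == ord_max)%:R] = p.@[w].
Proof.
move=> w1; rewrite comp_mpoly_meval; apply: meval_eq => i.
rewrite tnth_mktuple; case: eqP => [->|/eqP i_max]; first by rewrite mevalXU eqxx w1.
by rewrite mevalD mevalZ !mevalXU eqxx (negPf i_max) add0r mulr1.
Qed.

End Shear.

Lemma homogXU n (F : fieldType) (i : 'I_n) : ('X_i : {mpoly F[n]}) \is 1.-homog.
Proof. by rewrite dhomogX /= mdeg1. Qed.

Lemma homogXn n (F : fieldType) (i : 'I_n) k :
  ('X_i ^+ k : {mpoly F[n]}) \is k.-homog.
Proof. by have := dhomogMn k (homogXU F i); rewrite mul1n. Qed.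

(** * Hyperplanes missing a finite set of zeros *)

(** The powers of [z], the last variable, that a form not vanishing at the
    point [x = y = 0] forces into an ideal containing powers of [x] and [y]. *)
Lemma last_var_nilpotent (F : fieldType) (I : set {mpoly F[3]}) f e D :
  is_ideal I -> f \is e.-homog -> f.@[fun i => (i == ord_max)%:R] != 0 -> I f ->
  (forall j : 'I_2, I ('X_(widen_ord (leqnSn 2) j) ^+ D)) ->
  exists M, I ('X_ord_max ^+ M).
Proof.
move=> idI fe f0 If ID; pose w (i : 'I_2) := widen_ord (leqnSn 2) i.
pose J := add_elt (add_elt [set (0 : {mpoly F[3]})]%classic 'X_(w ord0)) 'X_(w ord_max).
have id0 : is_ideal [set (0 : {mpoly F[3]})]%classic.
  by split=> // [p q /= -> ->|p q /= ->]; rewrite ?addr0 ?mulr0.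
have idJ : is_ideal J by do 2![apply: add_elt_ideal].
have Jz i : J ('X_i - (i == ord_max)%:R *: 'X_ord_max).
  have [->|[j ->]] := ord_lastP i.
    by rewrite eqxx scale1r subrr; apply: ideal0 idJ.
  rewrite -val_eqE /= ltn_eqF // scale0r subr0.
  have [->|] := eqVneq j ord_max; first exact: (mem_add_elt (add_elt_ideal id0 _)).
  move=> j_max; have -> : j = ord0 by apply: val_inj; case: j j_max => [[|[|]]].
  exact/sub_add_elt/(mem_add_elt id0).
have [p [q /= /eqP]] := homog_congr idJ Jz fe.
set k := meval _ _ in f0 *; rewrite !subr_eq0 => /eqP zE.
exists (e * (1 + (D + D)))%N; rewrite exprM.
have -> : 'X_ord_max ^+ e = k^-1%:MP *
    (f + (- q * 'X_(w ord0) + - p * 'X_(w ord_max))).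
  have -> : f + (- q * 'X_(w ord0) + - p * 'X_(w ord_max)) = k *: 'X_ord_max ^+ e.
    by rewrite -[RHS](subKr f) mulNr -zE; ring.
  by rewrite mul_mpolyC scalerA mulVf // scale1r.
rewrite exprMn; apply: (ideal_mull idI); apply: (ideal_expD idI) => //.
by apply: (ideal_expD idI); rewrite exprMn; apply: (ideal_mull idI).
Qed.

(** With [z] the last variable: elimination provides a nonzero form [r] in
    [x, y] inside the ideal, so that for generic [c] powers of [x] and [y] lie
    in the ideal enlarged by [x - c * y]; a generator not vanishing at the point
    [x = y = 0] then yields a power of [z]. *)
Lemma cofinite_hyperplane_aux (F : numFieldType) r (f : 'I_r -> {mpoly F[3]})
    (e : 'I_r -> nat) i0 :
  (forall i, f i \is (e i).-homog) -> coprime_family f ->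
  (f i0).@[fun i => (i == ord_max)%:R] != 0 ->
  exists l N, l \is [in F[3], 1.-homog] /\ forall k u, (N <= k)%N ->
    u \is k.-homog -> add_elt (gen_ideal f) l u.
Proof.
move=> fe cop fi0; have idf := gen_ideal_ideal f.
have f0 : f i0 != 0 by apply: contraNneq fi0 => ->; rewrite meval0.
have copm := coprime_family_iso (@muniK 2 F) (@last_var_morphK 2 F) cop.
have mf0 : (@muni 2 F \o f) i0 != 0.
  by rewrite /= -(muni0 2 F) (inj_eq (can_inj (@muniK 2 F))).
have [a a0 [c ac]] := elimination (@mpoly_factorial 2 F) mf0 copm.
have {c ac} Ia : gen_ideal f (mwiden a).
  exists (fun i => last_var_morph (c i)); rewrite -last_var_morphC ac rmorph_sum.
  by apply: eq_bigr => i _; rewrite rmorphM /= muniK.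
have [D aD] := pihomog_neq0 a0; set b := pihomog _ _ a in aD.
have bD : b \is D.-homog by apply: pihomogP.
have {a0 Ia} Ib : gen_ideal f (mwiden b).
  by rewrite -pihomog_mwiden; apply: gen_ideal_pihomog fe Ia.
have [v [v1 bv]] := homog_neq0_eval ord_max bD aD.
pose w (i : 'I_2) := widen_ord (leqnSn 2) i.
pose l : {mpoly F[3]} := 'X_(w ord0) - v ord0 *: 'X_(w ord_max).
pose I := add_elt (gen_ideal f) l; have idI : is_ideal I := add_elt_ideal idf l.
have idI2 := preim_ideal (@mwiden 2 F) idI.
have I2 i : [set q : {mpoly F[2]} | I (mwiden q)]%classic ('X_i - v i *: 'X_ord_max).
  rewrite /= mwidenB mwidenZ !mwidenXU.
  have [->|] := eqVneq i ord_max; first by rewrite v1 scale1r subrr; apply: ideal0 idI.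
  move=> i_max; have -> : i = ord0 by apply: val_inj; case: i i_max => [[|[|]]].
  exact: (mem_add_elt idf).
have Iy : I ('X_(w ord_max) ^+ D).
  have /= := homog_congr idI2 I2 bD.
  rewrite mwidenB mwidenZ rmorphXn /= mwidenXU => H.
  have {}H : I (b.@[v] *: 'X_(w ord_max) ^+ D).
    rewrite -[X in I X](subKr (mwiden b)); apply: (idealB idI) H.
    exact: (sub_add_elt _ Ib).
  have -> : 'X_(w ord_max) ^+ D = (b.@[v])^-1%:MP * (b.@[v] *: 'X_(w ord_max) ^+ D).
    by rewrite mul_mpolyC scalerA mulVf // scale1r.
  exact: (ideal_mull idI).
have Ix : I ('X_(w ord0) ^+ D).
  have := homog_congr idI2 I2 (dhomogMn D (homogXU F ord0)).
  rewrite mul1n /= mwidenB mwidenZ !rmorphXn /= !mwidenXU => /(ideal_trans idI); apply.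
  by rewrite -mul_mpolyC; apply: (ideal_mull idI).
have [|M Iz'] := last_var_nilpotent (D := D) idI (fe i0) fi0 (sub_add_elt _ (gen_ideal_gen _ _)).
  move=> j; have [->|j_max] := eqVneq j ord_max; first exact: Iy.
  by have -> : j = ord0 by apply: val_inj; case: j j_max => [[|[|]]].
exists l, (3 * (D + M)).+1; split.
  by rewrite rpredB ?rpredZ ?homogXU.
move=> k u Nk uk; apply: (homog_in_ideal idI _ Nk uk) => i.
have [->|[j ->]] := ord_lastP i; first exact: (ideal_exp idI (leq_addl D M)).
apply: (ideal_exp idI (leq_addr M D)).
have [->|j_max] := eqVneq j ord_max; first exact: Iy.
by have -> : j = ord0 by apply: val_inj; case: j j_max => [[|[|]]].
Qed.

(** A form [l] as below is a hyperplane missing the common zeros of the [f i]. *)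
Lemma cofinite_hyperplane (F : numFieldType) r (f : 'I_r -> {mpoly F[3]})
    (e : 'I_r -> nat) i0 :
  (forall i, f i \is (e i).-homog) -> coprime_family f -> f i0 != 0 ->
  exists l N, l \is [in F[3], 1.-homog] /\ forall k u, (N <= k)%N ->
    u \is k.+1.-homog -> exists2 q, q \is k.-homog & gen_ideal f (u - q * l).
Proof.
move=> fe cop f0; have [w [w1 fw]] := homog_neq0_eval ord_max (fe i0) f0.
have sfe i : (shear w \o f) i \is (e i).-homog by apply: shear_homog.
have copw := coprime_family_iso (shearK w) (shearVK w) cop.
have [|l [N [l1 lP]]] := cofinite_hyperplane_aux sfe copw (i0 := i0).
  by rewrite /= meval_shear.
have l'1 := shear_homog (fun i => - w i) l1.
exists (shear (fun i => - w i) l), N; split=> // k u Nk uk.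
have [q [c qE]] := lP k.+1 _ (leqW Nk) (shear_homog w uk).
set w' := fun i => - w i in l'1 *.
have : gen_ideal f (u - shear w' q * shear w' l).
  exists (fun i => shear w' (c i)).
  rewrite -[u](shearK w) -rmorphM -rmorphB qE rmorph_sum.
  by apply: eq_bigr => i _; rewrite rmorphM /= shearK.
move=> /(gen_ideal_pihomog k.+1 fe); rewrite linearB /= (pihomog_dE uk).
rewrite -[X in pihomog _ X (_ * _)]addn1 (pihomogM _ _ l'1) => H.
by exists (pihomog mdeg k (shear w' q)) => //; apply: pihomogP.
Qed.

(** * Saturation of complete intersections *)

Section CompleteIntersection.
Variable F : numFieldType.

Definition pair_ideal (A : nzRingType) (g h : A) : set A :=
  [set u | exists s t, u = s * g + t * h].

Definition coprime_pair (A : idomainType) (g h : A) : Prop :=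
  forall p, prime_elt p -> divides p g -> ~ divides p h.

Lemma pair_ideal_ideal (A : comNzRingType) (g h : A) : is_ideal (pair_ideal g h).
Proof.
split=> [|a b [s [t ->]] [s' [t' ->]]|a b [s [t ->]]].
- by exists 0, 0; rewrite !mul0r addr0.
- by exists (s + s'), (t + t'); ring.
- by exists (a * s), (a * t); ring.
Qed.

Lemma pair_ideal_l (A : comNzRingType) (g h : A) : pair_ideal g h g.
Proof. by exists 1, 0; rewrite mul1r mul0r addr0. Qed.

Lemma pair_ideal_r (A : comNzRingType) (g h : A) : pair_ideal g h h.
Proof. by exists 0, 1; rewrite mul1r mul0r add0r. Qed.

Lemma coprime_pair_cancel (A : idomainType) (g h s t : A) :
  factorial_ring A -> coprime_pair g h -> h != 0 -> s * g = t * h ->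
  exists c, s = c * h /\ t = c * g.
Proof.
move=> factA cop h0 sg.
have [] := @coprime_cancel A bool (fun b => if b then g else h)
  (fun b => if b then t else s) h s (factA _ h0).
- move=> p pP; have [pg|] := pselect (divides p g); last by exists true.
  by exists false; apply: cop.
- by case; rewrite mulrC.
by move=> c [sE wE]; exists c; split=> //; apply: (wE true).
Qed.

Lemma prime_divides_exp (A : idomainType) (p a : A) k :
  prime_elt p -> divides p (a ^+ k) -> divides p a.
Proof.
move=> pP; elim: k => [|k IH]; last by have [_ _ pM] := pP; rewrite exprS => /pM[].
by move=> /(prime_not_unit pP (unitr1 _)).
Qed.

Lemma prime_divides_var n (K : fieldType) (p : {mpoly K[n]}) i :
  prime_elt p -> divides p 'X_i -> exists c, p = c *: 'X_i.
Proof.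
move=> [p0 pU _] [e eE]; have X0 : 'X_i != 0 :> {mpoly K[n]}.
  by rewrite -msize_poly_eq0 msizeX.
have e0 : e != 0 by apply: contraNneq X0 => e0; rewrite eE e0 mul0r.
have p1 : (1 < msize p)%N.
  rewrite ltnNge; apply: contra pU => /msize1_polyC pC; rewrite pC const_mpoly_unit //.
  by apply: contraNneq p0 => c0; rewrite pC c0 mpolyC0.
have e1 : (msize e <= 1)%N.
  have : msize ('X_i : {mpoly K[n]}) = 2 by rewrite msizeX mdeg1.
  rewrite eE msizeM // => eq2; move: eq2 p1.
  by move: (msize e) (msize p) => a b; lia.
have eC := msize1_polyC e1; have c0 : e@_0 != 0.
  by apply: contraNneq e0 => c0; rewrite eC c0 mpolyC0.
by exists (e@_0)^-1; rewrite eE {2}eC mul_mpolyC scalerA mulVf // scale1r.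
Qed.

Lemma coprime_vars n (K : fieldType) (i j : 'I_n) k l : i != j ->
  coprime_pair ('X_i ^+ k : {mpoly K[n]}) ('X_j ^+ l).
Proof.
move=> ij p pP /(prime_divides_exp pP)/(prime_divides_var pP)[c pE].
move=> /(prime_divides_exp pP)[e /(congr1 (meval (fun m => (m == j)%:R)))].
rewrite pE mevalM mevalZ !mevalXU eqxx (negPf ij) !mulr0 => /eqP.
by rewrite oner_eq0.
Qed.

(** The generators not containing the last variable, the ideal is stable under
    taking coefficients in that variable. *)
Lemma last_var_cancel n (K : fieldType) (a b : {mpoly K[n]}) c M :
  pair_ideal (mwiden a) (mwiden b) (c * 'X_ord_max ^+ M) ->
  pair_ideal (mwiden a) (mwiden b) c.
Proof.
move=> [s [t /(congr1 (@muni n K))]].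
rewrite muniD !muniM !muni_mwiden (rmorphXn (@muni n K)) /= muni_last.
rewrite -[X in pair_ideal _ _ X]muniK; move: (muni c) (muni s) (muni t) => C S T.
rewrite (mulrC S) (mulrC T) !mul_polyC => /(congr1 (drop_poly M)).
rewrite drop_polyMXn_id drop_polyD !drop_polyZ => ->.
rewrite -!mul_polyC (rmorphD (@last_var_morph n K)).
rewrite !(rmorphM (@last_var_morph n K)) /= !last_var_morphC.
do 2!eexists; rewrite (mulrC (mwiden a)) (mulrC (mwiden b)); reflexivity.
Qed.

(** The relations [x ^+ N * p = s * g + t * h] and
    [y ^+ N * p = s' * g + t' * h] give, [g] and [h] being coprime, an element
    [c] with [c * h] in the ideal of [x ^+ N] and [y ^+ N].  Since [h] is a
    power of [z] up to nilpotents there, [c] itself lies in that ideal, which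
    makes [x ^+ N] divisible out of the first relation. *)
Lemma saturation_aux (g h p : {mpoly F[3]}) b N :
  h \is b.-homog -> h.@[fun i => (i == ord_max)%:R] != 0 -> coprime_pair g h ->
  (forall i, pair_ideal g h ('X_i ^+ N * p)) -> pair_ideal g h p.
Proof.
move=> hb hz cop Ip; have fact := @mpoly_factorial 3 F.
have h0 : h != 0 by apply: contraNneq hz => ->; rewrite meval0.
pose w (j : 'I_2) := widen_ord (leqnSn 2) j.
have w01 : w ord_max != w ord0 by [].
have [s [t stE]] := Ip (w ord0); have [s' [t' st'E]] := Ip (w ord_max).
set x := 'X_(w ord0) in stE; set y := 'X_(w ord_max) in st'E.
have x0 : x ^+ N != 0 by rewrite expf_neq0 // -msize_poly_eq0 msizeX.
have [c [sc tc]] : exists c, y ^+ N * s - x ^+ N * s' = c * h /\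
    x ^+ N * t' - y ^+ N * t = c * g.
  apply: (coprime_pair_cancel fact cop h0).
  have : y ^+ N * (x ^+ N * p) = x ^+ N * (y ^+ N * p) by ring.
  by rewrite stE st'E => E; apply/eqP; rewrite -subr_eq0; apply/eqP;
     rewrite -[RHS](subrr (y ^+ N * (s * g + t * h))) {2}E; ring.
have [u [v cE]] : pair_ideal (x ^+ N) (y ^+ N) c.
  pose I := [set q | pair_ideal (x ^+ N) (y ^+ N) (c * q)]%classic.
  have idL := pair_ideal_ideal (x ^+ N) (y ^+ N).
  have idI : is_ideal I.
    rewrite /I; split=> [|q r /= Iq Ir|q r /= Ir] /=.
    - by rewrite mulr0; apply: ideal0 idL.
    - by rewrite mulrDr; apply: (idealD idL).
    - by rewrite mulrCA; apply: (ideal_mull idL).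
  have [||M] := last_var_nilpotent (D := N) idI hb hz.
  - by rewrite /I /= -sc; exists (- s'), s; ring.
  - move=> j; rewrite /I /=; apply: (ideal_mull idL).
    have [->|j_max] := eqVneq j ord_max; first exact: pair_ideal_r.
    have -> : j = ord0 by apply: val_inj; case: j j_max => [[|[|]]].
    exact: pair_ideal_l.
  have XE j : 'X_(w j) ^+ N = mwiden ('X_j ^+ N : {mpoly F[2]}).
    by rewrite (rmorphXn (@mwiden 2 F)) /= mwidenXU.
  by rewrite /I /= /x /y !XE; apply: last_var_cancel.
have [|q [sE _]] := @coprime_pair_cancel _ (y ^+ N) (x ^+ N) (s - v * h) (s' + u * h)
    fact (@coprime_vars 3 F _ _ N N w01) x0.
  apply/eqP; rewrite -subr_eq0; apply/eqP.
  have -> : (s - v * h) * y ^+ N - (s' + u * h) * x ^+ N =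
    (y ^+ N * s - x ^+ N * s') - (u * x ^+ N + v * y ^+ N) * h by ring.
  by rewrite sc -cE subrr.
have copx : coprime_pair h (x ^+ N).
  move=> r rP rh /(prime_divides_exp rP)/(prime_divides_var rP)[k rE].
  case: rh => e /(congr1 (meval (fun m => (m == ord_max)%:R))) /eqP.
  by rewrite rE mevalM mevalZ mevalXU !mulr0 (negPf hz).
have [|r [_ rE]] := @coprime_pair_cancel _ h (x ^+ N) (v * g + t) (p - q * g) fact copx x0.
  have sE' : s = q * x ^+ N + v * h by rewrite -sE subrK.
  have -> : (p - q * g) * x ^+ N = x ^+ N * p - q * x ^+ N * g by ring.
  by rewrite stE sE'; ring.
by exists q, r; rewrite -rE; ring.
Qed.

(** A change of coordinates brings a point off the curve [h = 0] to the point
    where all variables but the last one vanish. *)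
Lemma saturation (g h p : {mpoly F[3]}) b N :
  h \is b.-homog -> h != 0 -> coprime_pair g h ->
  (forall u, u \is N.-homog -> pair_ideal g h (u * p)) -> pair_ideal g h p.
Proof.
move=> hb h0 cop Ip; have [w [w1 hw]] := homog_neq0_eval ord_max hb h0.
have sI k q : pair_ideal g h q -> pair_ideal (shear k g) (shear k h) (shear k q).
  by move=> [s [t ->]]; exists (shear k s), (shear k t); rewrite rmorphD !rmorphM.
have copw : coprime_pair (shear w g) (shear w h).
  move=> q qP qg qh; apply: (cop _ (prime_iso (shearK w) (shearVK w) qP)).
    by have /= := divides_morph [the {rmorphism _ -> _} of shear (fun i => - w i)] qg;
       rewrite shearK.
  by have /= := divides_morph [the {rmorphism _ -> _} of shear (fun i => - w i)] qh;
     rewrite shearK.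
have [||s [t E]] := saturation_aux (p := shear w p) (N := N) (shear_homog w hb) _ copw.
- by rewrite meval_shear.
- move=> i; rewrite -['X_i ^+ N](shearVK w) -rmorphM; apply/sI/Ip.
  by apply: shear_homog; apply: homogXn.
exists (shear (fun i => - w i) s), (shear (fun i => - w i) t).
rewrite -[p](shearK w) -[g](shearK w) -[h](shearK w) E.
exact: etrans (rmorphD _ _ _) (congr2 _ (rmorphM _ _ _) (rmorphM _ _ _)).
Qed.

End CompleteIntersection.

(** * Dimension counts *)

Section Codimension.
Variable K : fieldType.
Implicit Types V W : vectType K.

Definition linear_closed V (P : V -> Prop) : Prop :=
  P 0 /\ forall a u v, P u -> P v -> P (a *: u + v).

(** The ideals considered are arbitrary predicates, but a linearly closed
    predicate on a finite dimensional space does define a subspace. *)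
Definition vsp V (P : V -> Prop) : {vspace V} :=
  xget 0%VS [set U : {vspace V} | forall v, v \in U <-> P v].

(** Take a subspace of the largest dimension among those contained in [P]. *)
Lemma mem_vsp V (P : V -> Prop) v : linear_closed P -> v \in vsp P <-> P v.
Proof.
move=> [P0 Plin]; rewrite /vsp; case: xgetP => [U _|/(_ _) noU]; first exact.
exfalso; pose D k := `[< exists2 U : {vspace V}, {in U, forall u, P u} & \dim U = k >].
have exD : exists k, D k.
  by exists 0%N; apply/asboolP; exists 0%VS; rewrite ?dimv0 // => u; rewrite memv0 => /eqP->.
have Dmax k : D k -> (k <= \dim {:V})%N.
  by move=> /asboolP[U _ <-]; apply/dimvS/subvf.
have [k /asboolP[U UP Uk] kmax] := ex_maxnP exD Dmax.
apply: (noU U) => u; split=> [/UP//|Pu].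
have UuP : {in (U + <[u]>)%VS, forall w, P w}.
  move=> w /memv_addP[a aU [b /vlineP[c ->] ->]]; rewrite addrC.
  by apply: Plin => //; apply: UP.
have /kmax : D (\dim (U + <[u]>)) by apply/asboolP; exists (U + <[u]>)%VS.
rewrite -Uk => dU; have /eqP -> : U == (U + <[u]>)%VS.
  by rewrite eqEdim addvSl.
by apply: (subvP (addvSr _ _)); apply: memv_line.
Qed.

Definition codim V (U : {vspace V}) : nat := \dim {:V} - \dim U.

Lemma codim_dim V (U : {vspace V}) : (codim U + \dim U = \dim {:V})%N.
Proof. by rewrite subnK // dimvS // subvf. Qed.

Lemma codim_le V (U1 U2 : {vspace V}) : (U1 <= U2)%VS -> (codim U2 <= codim U1)%N.
Proof. by move=> /dimvS; apply: leq_sub2l. Qed.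

Lemma codim_preim V W (T : 'Hom(V, W)) (U : {vspace W}) :
  (codim (T @^-1: U) + \dim U = \dim (U + limg T))%N.
Proof.
have kerU : (T @^-1: U :&: lker T = lker T)%VS.
  by apply/capv_idPr; rewrite -lpreim0 lpreimS // sub0v.
have imU : (T @: (T @^-1: U) = U :&: limg T)%VS.
  by rewrite -lpreim_cap_limg lpreimK // capvSr.
have := limg_ker_dim T (T @^-1: U); rewrite kerU imU => dpre.
have := limg_ker_dim T fullv; rewrite capfv => dV.
have := dimv_sum_cap U (limg T); have := codim_dim (T @^-1: U).
by rewrite -dV -dpre; lia.
Qed.

Section Map.
Variables (V W : vectType K) (T : {linear V -> W}).
Variables (U : {vspace V}) (U' : {vspace W}).
Let f := linfun T.

Lemma codim_le_inj : (forall v, T v \in U' -> v \in U) -> (codim U <= codim U')%N.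
Proof.
move=> inj; apply: leq_trans (_ : codim (f @^-1: U') <= _)%N.
  by apply/codim_le/subvP => v; rewrite -memv_preim lfunE; apply: inj.
have := codim_preim f U'; have := codim_dim U'.
have : (\dim (U' + limg f) <= \dim {:W})%N by rewrite dimvS // subvf.
lia.
Qed.

Lemma codim_le_surj : (forall v, v \in U -> T v \in U') ->
  (forall w, exists v, w - T v \in U') -> (codim U' <= codim U)%N.
Proof.
move=> TU surj; apply: leq_trans (_ : codim (f @^-1: U') <= _)%N; last first.
  by apply/codim_le/subvP => v vU; rewrite -memv_preim lfunE; apply: TU.
have fullE : (U' + limg f)%VS = fullv.
  apply/eqP; rewrite eqEsubv subvf /=; apply/subvP => w _.
  have [v wv] := surj w; rewrite -[w](subrK (T v)) memv_add //.
  by rewrite -[T v]lfunE memv_img // memvf.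
have := codim_preim f U'; rewrite fullE; have := codim_dim U'; lia.
Qed.

Lemma inj_of_codim : (forall v, v \in U -> T v \in U') ->
  (forall w, exists v, w - T v \in U') -> (codim U <= codim U')%N ->
  forall v, T v \in U' -> v \in U.
Proof.
move=> TU surj UU' v TvU'.
have Upre : (U <= f @^-1: U')%VS.
  by apply/subvP => w wU; rewrite -memv_preim lfunE; apply: TU.
have fullE : (U' + limg f)%VS = fullv.
  apply/eqP; rewrite eqEsubv subvf /=; apply/subvP => w _.
  have [x wx] := surj w; rewrite -[w](subrK (T x)) memv_add //.
  by rewrite -[T x]lfunE memv_img // memvf.
have /eqP -> : U == (f @^-1: U')%VS.
  rewrite eqEdim Upre /=; have := codim_preim f U'; rewrite fullE.
  have := codim_dim U'; have := codim_dim U; have := codim_dim (f @^-1: U')%VS.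
  lia.
by rewrite -memv_preim lfunE.
Qed.

Lemma surj_of_codim : (forall v, T v \in U' -> v \in U) ->
  (codim U' <= codim U)%N -> forall w, exists v, w - T v \in U'.
Proof.
move=> inj U'U w.
have preU : (f @^-1: U' <= U)%VS.
  by apply/subvP => v; rewrite -memv_preim lfunE; apply: inj.
have : w \in (U' + limg f)%VS.
  suff -> : (U' + limg f)%VS = fullv by rewrite memvf.
  apply/eqP; rewrite eqEdim subvf /=; have := codim_preim f U'.
  by have := codim_le preU; have := codim_dim U'; lia.
move=> /memv_addP[a aU' [b /memv_imgP[v _ ->] ->]]; exists v.
by rewrite lfunE /= addrK.
Qed.

End Map.

(** Counting dimensions along a short exact sequence. *)
Lemma dim_exact V W (X : vectType K) (f : {linear W -> V}) (g : {linear V -> X}) :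
  injective f -> (forall v, g v = 0 <-> exists w, v = f w) ->
  (\dim {:V} = \dim {:W} + \dim (limg (linfun g)))%N.
Proof.
move=> finj ker; rewrite -(limg_ker_dim (linfun g) fullv) capfv; congr (_ + _)%N.
have -> : lker (linfun g) = limg (linfun f).
  apply/vspaceP => v; rewrite memv_ker lfunE /=; apply/eqP/memv_imgP.
    by move=> /ker[w ->]; exists w; rewrite ?memvf // lfunE.
  by move=> [w _ ->]; apply/ker; exists w; rewrite lfunE.
have := limg_ker_dim (linfun f) fullv; rewrite capfv.
have -> : lker (linfun f) = 0%VS.
  by apply/eqP/lker0P => u v; rewrite !lfunE; apply: finj.
by rewrite dimv0.
Qed.

Lemma codim_capv V (U1 U2 : {vspace V}) : (U1 + U2)%VS = fullv ->
  codim (U1 :&: U2) = (codim U1 + codim U2)%N.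
Proof.
move=> U12; have := dimv_sum_cap U1 U2; rewrite U12.
by have := codim_dim U1; have := codim_dim U2; have := codim_dim (U1 :&: U2); lia.
Qed.

End Codimension.

(** * Graded pieces and Hilbert functions *)

Section GradedPieces.
Variables (n : nat) (F : fieldType).
Implicit Types (I : set {mpoly F[n.+1]}) (u : {mpoly F[n.+1]}).

Definition gr k u : dhomog n.+1 F k := DHomog (pihomogP mdeg k u).

Lemma gr_is_linear k : linear (gr k).
Proof. by move=> a u v; apply: val_inj; rewrite /= linearP. Qed.

HB.instance Definition _ k := GRing.isLinear.Build F _ _ _ (gr k) (gr_is_linear k).

Lemma val_gr k u : u \is k.-homog -> val (gr k u) = u.
Proof. by move=> uk; rewrite /= pihomog_dE. Qed.

(** The degree [K] of the product is kept apart from the sum of the degrees of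
    the factors, so that no cast along an addition is needed. *)
Definition mulh a k K (u : dhomog n.+1 F k) : dhomog n.+1 F K := gr K (a * val u).

Lemma mulh_is_linear a k K : linear (@mulh a k K).
Proof. by move=> c u v; rewrite /mulh linearP mulrDr -scalerAr linearP. Qed.

HB.instance Definition _ a k K :=
  GRing.isLinear.Build F _ _ _ (@mulh a k K) (@mulh_is_linear a k K).

Lemma val_mulh a s k K (u : dhomog n.+1 F k) : a \is s.-homog -> K = (s + k)%N ->
  val (mulh a K u) = a * val u.
Proof. by move=> ak ->; rewrite val_gr //; apply: dhomogM => //; apply: valP. Qed.

Definition gp I k : {vspace dhomog n.+1 F k} :=
  vsp (fun u : dhomog n.+1 F k => I (val u)).

(** The Hilbert function of the quotient by [I]. *)
Definition hf I k : nat := codim (gp I k).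

Lemma mem_gp I k (u : dhomog n.+1 F k) : is_ideal I -> u \in gp I k <-> I (val u).
Proof.
move=> idI; apply: (mem_vsp u); split=> [|a v w Iv Iw]; first exact: (ideal0 idI).
rewrite linearP; apply: (idealD idI) => //; rewrite -mul_mpolyC.
exact: (ideal_mull idI).
Qed.

Lemma mem_gp_mulh I a s k K (u : dhomog n.+1 F k) : is_ideal I ->
  a \is s.-homog -> K = (s + k)%N -> mulh a K u \in gp I K <-> I (a * val u).
Proof. by move=> idI aS KE; rewrite -(val_mulh u aS KE); apply: mem_gp. Qed.

Lemma mem_gp_gr I k u : is_ideal I -> u \is k.-homog -> gr k u \in gp I k <-> I u.
Proof. by move=> idI uk; rewrite -{2}(val_gr uk); apply: mem_gp. Qed.

Lemma mem_gp_sub_mulh I a s k K (u : dhomog n.+1 F k) (w : dhomog n.+1 F K) :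
  is_ideal I -> a \is s.-homog -> K = (s + k)%N ->
  w - mulh a K u \in gp I K <-> I (val w - a * val u).
Proof.
move=> idI aS KE; rewrite -(val_mulh u aS KE).
by have := @mem_gp I K (w - mulh a K u) idI; rewrite linearB.
Qed.

Lemma dim_homog k : \dim {:dhomog n.+1 F k} = 'C(k + n, k).
Proof. by rewrite dimvf. Qed.

End GradedPieces.

(** * Hilbert functions in dimension zero *)

Lemma eventually_constant (u : nat -> nat) N :
  (forall k, (N <= k)%N -> (u k.+1 <= u k)%N) ->
  exists K, (N <= K)%N /\ forall k, (K <= k)%N -> u k = u K.
Proof.
move=> udec; pose D v := `[< exists2 k, (N <= k)%N & u k = v >].
have exD : exists v, D v by exists (u N); apply/asboolP; exists N.
have [v /asboolP[K NK uK] vmin] := ex_minnP exD; exists K; split=> // k Kk.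
have NkE : (N <= k)%N by apply: leq_trans Kk.
apply/eqP; rewrite eqn_leq uK vmin; last by apply/asboolP; exists k.
rewrite andbT -uK; elim: k Kk {NkE} => [|k IH]; first by rewrite leqn0 => /eqP->.
rewrite leq_eqVlt => /orP[/eqP->//|Kk]; apply: leq_trans (IH Kk).
by apply: udec; apply: leq_trans NK _.
Qed.

Section HomogenizedPoly.
Variables (n : nat) (F : fieldType) (b l : {mpoly F[n]}).
Implicit Types p q : {poly F}.

(** [binary_form M p] is the homogenization of [p] in degree [M], evaluated at
    [b] and [l]. *)
Definition binary_form M (p : {poly F}) : {mpoly F[n]} :=
  \sum_(i < M.+1) p`_i *: (b ^+ i * l ^+ (M - i)).

Lemma binary_form_is_linear M : linear (binary_form M).
Proof.
move=> a p q; rewrite /binary_form scaler_sumr -big_split; apply: eq_bigr => i _.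
by rewrite coefD coefZ scalerDl scalerA.
Qed.

HB.instance Definition _ M := GRing.isLinear.Build F _ _ _ (binary_form M)
  (@binary_form_is_linear M).

Lemma binary_formMX M p : binary_form M.+1 ('X * p) = b * binary_form M p.
Proof.
rewrite /binary_form big_ord_recl coefXM /= scale0r add0r mulr_sumr.
apply: eq_bigr => i _; rewrite coefXM /= -scalerAr exprS mulrA.
by rewrite /bump /= add1n subSS.
Qed.

Lemma binary_form_widen M p : (size p <= M.+1)%N ->
  binary_form M.+1 p = l * binary_form M p.
Proof.
move=> pM; rewrite /binary_form big_ord_recr /= nth_default // scale0r addr0 mulr_sumr.
apply: eq_bigr => i _; rewrite -scalerAr subSn; last by rewrite -ltnS.
by rewrite exprS mulrCA.
Qed.

Lemma binary_form_prod e (r : seq F) :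
  binary_form (e + size r) (\prod_(z <- r) ('X - z%:P)) =
  l ^+ e * \prod_(z <- r) (b - z *: l).
Proof.
elim: r => [|z r IH] /=.
  rewrite !big_nil addn0 mulr1 /binary_form (bigD1 ord0) //= coefC eqxx scale1r.
  rewrite expr0 mul1r subn0 big1 ?addr0 // => i i0.
  by rewrite coefC -[(_ == _)%N]/(i == ord0) (negPf i0) scale0r.
rewrite !big_cons addnS mulrBl linearB /= binary_formMX mul_polyC linearZ /=.
rewrite binary_form_widen ?size_prod_XsubC ?ltnS ?leq_addl // IH.
by rewrite -!mul_mpolyC; ring.
Qed.

Lemma binary_form_homog M p : b \is 1.-homog -> l \is 1.-homog ->
  binary_form M p \is M.-homog.
Proof.
move=> b1 l1; apply: rpred_sum => i _; apply: rpredZ.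
have := dhomogM (dhomogMn i b1) (dhomogMn (M - i) l1).
by rewrite !mul1n subnKC // -ltnS.
Qed.

End HomogenizedPoly.

(** Throughout, [l] is a linear form such that multiplication by [l] is
    surjective on [S / J] from degree [N] on: the hyperplane [l = 0] misses the
    zeros of [J]. *)
Section ZeroDimensional.
Variables (F : numClosedFieldType) (n : nat).
Local Notation S := {mpoly F[n.+1]}.
Variables (J : set S) (l : S) (N : nat).
Hypotheses (idJ : is_ideal J) (l1 : l \is 1.-homog).
Hypothesis lP : forall k (u : S), (N <= k)%N -> u \is k.+1.-homog ->
  exists2 q, q \is k.-homog & J (u - q * l).

Lemma hf_noninc (Q : set S) k : is_ideal Q -> (forall u, J u -> Q u) -> (N <= k)%N ->
  (hf Q k.+1 <= hf Q k)%N.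
Proof.
move=> idQ JQ Nk; apply: (@codim_le_surj _ _ _ (@mulh n F l k k.+1)).
  move=> v /mem_gp Qv; apply/(mem_gp_mulh _ idQ l1) => //.
  by apply: (ideal_mull idQ); apply: Qv.
move=> w; have [q qk Jq] := lP Nk (valP w); exists (gr k q).
apply/(mem_gp_sub_mulh _ _ idQ l1) => //.
by rewrite val_gr // mulrC; apply: JQ.
Qed.

Lemma hf_nondec (Q : set S) k : is_ideal Q ->
  (forall u, u \is k.-homog -> Q (l * u) -> Q u) -> (hf Q k <= hf Q k.+1)%N.
Proof.
move=> idQ lQ; apply: (@codim_le_inj _ _ _ (@mulh n F l k k.+1)).
move=> v /(mem_gp_mulh v idQ l1 (erefl _)) Qlv; apply/mem_gp => //.
by apply: lQ Qlv; apply: valP.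
Qed.

Lemma hf_constant (Q : set S) k : is_ideal Q -> (forall u, J u -> Q u) ->
  (forall k u, u \is k.-homog -> Q (l * u) -> Q u) -> (N <= k)%N -> hf Q k = hf Q N.
Proof.
move=> idQ JQ lQ; elim: k => [|k IH]; first by rewrite leqn0 => /eqP->.
rewrite leq_eqVlt => /orP[/eqP->//|Nk]; rewrite -IH //.
by apply/eqP; rewrite eqn_leq hf_noninc // hf_nondec // => u; apply: lQ.
Qed.

Lemma lift_power k M (u : S) : (N <= k)%N -> u \is (M + k).-homog ->
  exists2 q, q \is k.-homog & J (u - q * l ^+ M).
Proof.
move=> Nk; elim: M u => [|M IH] u uk.
  by exists u => //; rewrite mulr1 subrr; apply: ideal0 idJ.
have [q qk Jq] := lP (leq_trans Nk (leq_addl M k)) uk.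
have [q' q'k Jq'] := IH q qk; exists q' => //.
have -> : u - q' * l ^+ M.+1 = (u - q * l) + l * (q - q' * l ^+ M).
  by rewrite exprS; ring.
by apply: (idealD idJ) => //; apply: (ideal_mull idJ).
Qed.

(** The Hilbert function of [J] does not increase from [N] on, multiplication
    by [l] being surjective modulo [J]; once it is constant this multiplication
    is also injective. *)
Lemma stabilization : exists K, [/\ (N <= K)%N, forall k, (K <= k)%N -> hf J k = hf J K &
  forall k (u : S), (K <= k)%N -> u \is k.-homog -> J (l * u) -> J u].
Proof.
have [K [NK KP]] := eventually_constant (fun k => hf_noninc idJ (fun _ => id)).
exists K; split=> // k u Kk uk Jlu.
have Nk := leq_trans NK Kk.
suff : gr k u \in gp J k by move/(mem_gp_gr idJ uk).
apply: (@inj_of_codim _ _ _ (@mulh n F l k k.+1) _ (gp J k.+1)).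
- move=> v /mem_gp Jv; apply/(mem_gp_mulh _ idJ l1) => //.
  by apply: (ideal_mull idJ); apply: Jv.
- move=> w; have [q qk Jq] := lP Nk (valP w); exists (gr k q).
  by apply/(mem_gp_sub_mulh _ _ idJ l1) => //; rewrite val_gr // mulrC.
- by rewrite -/(hf J k) -/(hf J k.+1) KP // (KP k.+1) // leqW.
- by apply/(mem_gp_mulh _ idJ l1) => //; rewrite val_gr.
Qed.

(** In large degree there are more monomials in [b] and [l] than the
    dimension of [S / J], and a binary form splits into linear factors. *)
Lemma linear_relation (b : S) : b \is 1.-homog ->
  exists e (r : seq F), J (l ^+ e * \prod_(z <- r) (b - z *: l)).
Proof.
move=> b1; have [K [_ KP _]] := stabilization.
(* The [M.+1] coefficients of a binary form exceed [hf J M]. *)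
pose M := maxn K (hf J K).
have [p [pM p0 Jp]] : exists p : {poly F},
    [/\ (size p <= M.+1)%N, p != 0 & J (binary_form b l M p)].
  apply: contrapT => nop.
  have : (codim (0%VS : {vspace 'rV[F]_M.+1}) <= codim (gp J M))%N.
    pose T := gr M \o (binary_form b l M \o @rVpoly F M.+1).
    apply: (@codim_le_inj _ _ _ T) => v vJ.
    rewrite memv0; apply/negPn/negP => v0; apply: nop; exists (rVpoly v); split.
    - exact: size_poly.
    - by apply: contraNneq v0 => /(congr1 (poly_rV (d := M.+1))); rewrite rVpolyK linear0 => ->.
    - exact: (mem_gp_gr idJ (binary_form_homog M (rVpoly v) b1 l1)).1 vJ.
  rewrite -/(hf J M) KP ?leq_maxl // /codim dimv0 subn0 dimvf /= => /leq_trans.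
  by rewrite /dim /= mul1n => /(_ M (leq_maxr _ _)); rewrite ltnn.
have [r pE] := closed_field_poly_normal p.
have lp0 : lead_coef p != 0 by rewrite lead_coef_eq0.
have rM : (size r <= M)%N.
  by move: pM; rewrite pE size_scale // size_prod_XsubC ltnS.
exists (M - size r)%N, r; rewrite -binary_form_prod subnK //.
set q := \prod_(z <- r) _ in pE *.
have -> : binary_form b l M q = (lead_coef p)^-1%:MP * binary_form b l M p.
  by rewrite mul_mpolyC {2}pE linearZ /= scalerA mulVf // scale1r.
exact: (ideal_mull idJ).
Qed.

End ZeroDimensional.

(** * Localisation at a zero *)

Lemma memv_bigcap (K : fieldType) (V : vectType K) (T : Type) (s : seq T)
    (U : T -> {vspace V}) v :
  (v \in (\bigcap_(x <- s) U x)%VS) = all (fun x => v \in U x) s.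
Proof. by elim: s => [|x s IH]; rewrite ?big_nil ?memvf // big_cons memv_cap IH. Qed.

Definition vanishes_at (F : fieldType) n (I : set {mpoly F[n]}) (P : 'I_n -> F) : Prop :=
  forall k u, u \is k.-homog -> I u -> u.@[P] = 0.

(** The contraction to [S] of the ideal generated by [J] in the local ring at
    [P]; for a homogeneous [J] denominators may be taken homogeneous. *)
Definition local_ideal (F : fieldType) n (J : set {mpoly F[n]}) (P : 'I_n -> F) :
    set {mpoly F[n]} :=
  [set u | exists s v, [/\ v \is [in F[n], s.-homog], v.@[P] != 0 & J (v * u)]].

Section LocalIdeal.
Variables (F : fieldType) (n : nat) (J : set {mpoly F[n]}) (P : 'I_n -> F).
Hypothesis idJ : is_ideal J.

Lemma local_ideal_ideal : is_ideal (local_ideal J P).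
Proof.
split=> [|a b [s [v [vs vP Ja]]] [t [w [wt wP Jb]]]|a b [s [v [vs vP Jb]]]].
- exists 0%N, 1; rewrite dhomog1 meval1 oner_neq0 mulr0.
  by split=> //; apply: ideal0 idJ.
- exists (s + t)%N, (v * w); split; first exact: dhomogM.
    by rewrite mevalM mulf_neq0.
  have -> : v * w * (a + b) = w * (v * a) + v * (w * b) by ring.
  by apply: (idealD idJ); apply: (ideal_mull idJ).
- by exists s, v; split=> //; rewrite mulrCA; apply: (ideal_mull idJ).
Qed.

Lemma sub_local_ideal u : J u -> local_ideal J P u.
Proof.
by move=> Ju; exists 0%N, 1; rewrite dhomog1 meval1 oner_neq0 mul1r.
Qed.

Lemma local_ideal_cancel s v u : v \is s.-homog -> v.@[P] != 0 ->
  local_ideal J P (v * u) -> local_ideal J P u.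
Proof.
move=> vs vP [t [w [wt wP Jwvu]]]; exists (t + s)%N, (w * v).
by rewrite dhomogM // mevalM mulf_neq0 // -mulrA.
Qed.

End LocalIdeal.

Section Points.
Variables (F : numClosedFieldType) (n : nat).
Local Notation S := {mpoly F[n.+1]}.
Variables (J : set S) (l : S) (N : nat).
Hypotheses (idJ : is_ideal J) (l1 : l \is 1.-homog).
Hypothesis lP : forall k (u : S), (N <= k)%N -> u \is k.+1.-homog ->
  exists2 q, q \is k.-homog & J (u - q * l).

Let rel := linear_relation idJ l1 lP.

(** If each [add_elt I (b - z *: l)] contained a power of [l], so would [I], as
    [l ^+ e * \prod_(z <- r) (b - z *: l)] lies in [J] for some [e] and [r]. *)
Lemma extend_ideal (I : set S) b : is_ideal I -> (forall u, J u -> I u) ->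
  b \is 1.-homog -> (forall k, ~ I (l ^+ k)) ->
  exists z, forall k, ~ add_elt I (b - z *: l) (l ^+ k).
Proof.
move=> idI JI b1 nI; apply: contrapT => /forallNP H.
have [e [r /JI Ir]] := rel b1; elim: r e Ir => [|z r IH] e Ir.
  by apply: (nI e); rewrite big_nil mulr1 in Ir.
have /existsNP[k /contrapT[q Iq]] := H z.
apply: (IH (e + k)%N); apply: (ideal_trans idI _ (ideal_mull idI q Ir)).
rewrite big_cons exprD; set p := \prod_(_ <- _) _.
have -> : l ^+ e * l ^+ k * p - q * (l ^+ e * ((b - z *: l) * p)) =
   l ^+ e * p * (l ^+ k - q * (b - z *: l)) by rewrite -!mul_mpolyC; ring.
exact: (ideal_mull idI).
Qed.

(** The Nullstellensatz in this setting: adding linear forms [X_i - P i *: l]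
    one after the other keeps the powers of [l] out of the ideal. *)
Lemma common_zero (I : set S) : is_ideal I -> (forall u, J u -> I u) ->
  (forall k, ~ I (l ^+ k)) -> exists P, l.@[P] = 1 /\ vanishes_at I P.
Proof.
move=> idI JI nI.
have [P [I' [idI' II' nI' PI']]] : exists (P : 'I_n.+1 -> F) (I' : set S),
    [/\ is_ideal I', forall u, I u -> I' u, forall k, ~ I' (l ^+ k) &
      {in enum 'I_n.+1, forall i, I' ('X_i - P i *: l)}].
  elim: (enum 'I_n.+1) => [|i s [P [I' [idI' II' nI' PI']]]].
    by exists (fun=> 0), I; split.
  have [z nz] := extend_ideal idI' (fun u Ju => II' u (JI u Ju)) (homogXU F i) nI'.
  exists (fun j => if j \in s then P j else z), (add_elt I' ('X_i - z *: l)).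
  split=> // [|u Iu|j]; first exact: add_elt_ideal.
    exact/sub_add_elt/II'.
  have [js _|js] := boolP (j \in s); first exact/sub_add_elt/PI'.
  by rewrite inE (negPf js) orbF => /eqP ->; apply: (mem_add_elt idI').
have PX i : I' ('X_i - P i *: l) by apply: PI'; rewrite mem_enum.
have lP1 : l.@[P] = 1.
  apply/eqP; rewrite -subr_eq0; apply/negPn/negP => lP0; apply: (nI' 1%N).
  have := homog_congr idI' PX l1; rewrite expr1.
  have -> : l - l.@[P] *: l = - (l.@[P] - 1)%:MP * l.
    by rewrite -mul_mpolyC mpolyCB mpolyC1; ring.
  move=> /(ideal_mull idI' (- (l.@[P] - 1)^-1%:MP)).
  by rewrite mulrA mulrNN -mpolyCM mulVf // mpolyC1 mul1r.
exists P; split=> // k u uk /II' Iu; apply/eqP/negPn/negP => uP; apply: (nI' k).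
have := idealB idI' Iu (homog_congr idI' PX uk); rewrite subKr -mul_mpolyC.
by move=> /(ideal_mull idI' (u.@[P])^-1%:MP); rewrite mulrA -mpolyCM mulVf // mpolyC1 mul1r.
Qed.

(** In a relation [l ^+ e * \prod_(z <- r) (w - z *: l)] of [J], the factors with
    [z != 0] do not vanish at [P]. *)
Lemma vanishing_nilpotent P w : l.@[P] != 0 -> w \is 1.-homog -> w.@[P] = 0 ->
  exists E, local_ideal J P (w ^+ E).
Proof.
move=> lP0 w1 wP; have [e [r Jr]] := rel w1.
suff [E [s [v [vs vP vE]]]] : exists E s v, [/\ v \is [in F[n.+1], s.-homog], v.@[P] != 0 &
    l ^+ e * \prod_(z <- r) (w - z *: l) = v * w ^+ E].
  by exists E, s, v; split=> //; rewrite -vE.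
elim: r {Jr} => [|z r [E [s [v [vs vP vE]]]]].
  exists 0%N, e, (l ^+ e); rewrite big_nil expr0; split=> //.
    by have := dhomogMn e l1; rewrite mul1n.
  by rewrite rmorphXn /= expf_neq0.
rewrite big_cons mulrCA vE; have [->|z0] := eqVneq z 0.
  by exists E.+1, s, v; split=> //; rewrite exprS scale0r subr0; ring.
exists E, (1 + s)%N, ((w - z *: l) * v); split; last by ring.
  by apply: dhomogM; rewrite // rpredB // rpredZ.
by rewrite mevalM mevalB mevalZ wP sub0r mulf_neq0 // oppr_eq0 mulf_neq0.
Qed.

Definition independent_points (P P' : 'I_n.+1 -> F) : Prop :=
  exists i, P i * l.@[P'] != P' i * l.@[P].

(** A linear form [w] vanishing at [P'] is nilpotent at [P'], while at [P] it
    differs from a multiple [c *: l] of [l] by a nilpotent element; the form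
    [e] is built from high powers of [w]. *)
Lemma separator P P' : l.@[P] != 0 -> l.@[P'] != 0 -> independent_points P P' ->
  exists M c e, [/\ c != 0, e \is [in F[n.+1], M.-homog], local_ideal J P' e &
    local_ideal J P (e - c *: l ^+ M)].
Proof.
move=> lP0 lP'0 [i iP].
have idQ Q : is_ideal (local_ideal J Q) by apply: local_ideal_ideal.
pose w : S := l.@[P'] *: 'X_i - P' i *: l.
have w1 : w \is 1.-homog by rewrite rpredB // rpredZ // homogXU.
have wP' : w.@[P'] = 0 by rewrite mevalB !mevalZ mevalXU mulrC subrr.
have wP : w.@[P] != 0 by rewrite mevalB !mevalZ mevalXU subr_eq0 mulrC.
pose c := w.@[P] / l.@[P]; have c0 : c != 0 by rewrite mulf_neq0 // invr_eq0.
have [E QE] := vanishing_nilpotent lP'0 w1 wP'.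
have u1 : c *: l - w \is 1.-homog by rewrite rpredB // rpredZ.
have [E' QE'] : exists E', local_ideal J P ((c *: l - w) ^+ E').
  apply: vanishing_nilpotent => //.
  by rewrite mevalB mevalZ /c divfK // subrr.
pose a := (c *: l) ^+ E; exists (E * E')%N, (c ^+ (E * E')), (a ^+ E' - (a - w ^+ E) ^+ E').
have wE : w ^+ E \is E.-homog by have := dhomogMn E w1; rewrite mul1n.
have aE : a \is E.-homog.
  by rewrite /a exprZn; apply: rpredZ; have := dhomogMn E l1; rewrite mul1n.
split; first by rewrite expf_neq0.
- by apply: rpredB; apply: dhomogMn => //; apply: rpredB.
- by rewrite subrXX subKr; apply: (ideal_mulr (idQ P')).
have -> : c ^+ (E * E') *: l ^+ (E * E') = a ^+ E' by rewrite /a -exprM exprZn.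
rewrite [_ - _ - _]addrAC subrr sub0r; apply: (idealN (idQ P)).
by rewrite /a subrXX exprMn; apply: (ideal_mulr (idQ P)).
Qed.

Lemma separator_seq P (s : seq 'rV[F]_n.+1) : l.@[P] != 0 ->
  {in s, forall p : 'rV[F]_n.+1, l.@[p 0] != 0 /\ independent_points P (p 0)} ->
  exists M c e, [/\ c != 0, e \is [in F[n.+1], M.-homog],
    {in s, forall p : 'rV[F]_n.+1, local_ideal J (p 0) e} & local_ideal J P (e - c *: l ^+ M)].
Proof.
move=> lP0; have idQ Q : is_ideal (local_ideal J Q) by apply: local_ideal_ideal.
elim: s => [|p s IH] sP.
  exists 0%N, 1, 1; rewrite oner_neq0 dhomog1; split=> //.
  by rewrite scale1r subrr; apply: ideal0 (idQ P).
have [|M [c [e [c0 eM Qe QPe]]]] := IH.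
  by move=> q qs; apply: sP; rewrite inE qs orbT.
have [lp Pp] := sP p (mem_head p s).
have [M' [c' [e' [c'0 e'M Qe' QPe']]]] := separator lP0 lp Pp.
exists (M + M')%N, (c * c'), (e * e'); split.
- by rewrite mulf_neq0.
- exact: dhomogM.
- move=> q; rewrite inE => /orP[/eqP->|/Qe]; first exact: (ideal_mull (idQ _)).
  exact: (ideal_mulr (idQ _)).
have -> : e * e' - (c * c') *: l ^+ (M + M') =
    e * (e' - c' *: l ^+ M') + c' *: l ^+ M' * (e - c *: l ^+ M).
  by rewrite exprD -!mul_mpolyC mpolyCM; ring.
by apply: (idealD (idQ P)); apply: (ideal_mull (idQ P)).
Qed.

Lemma local_hf_constant P k : l.@[P] != 0 -> (N <= k)%N ->
  hf (local_ideal J P) k = hf (local_ideal J P) N.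
Proof.
move=> lP0; apply: (hf_constant l1 lP (local_ideal_ideal _ idJ)).
  by move=> u; apply: sub_local_ideal.
by move=> m u _; apply: local_ideal_cancel l1 lP0.
Qed.

(** The Chinese remainder theorem in large degrees: a form lying in the ideals of
    the other points and congruent to a power of [l] at [p] shows that the ideal
    of [p] and the intersection of the others add up to everything. *)
Lemma codim_local_ideals (s : seq 'rV[F]_n.+1) :
  {in s, forall p : 'rV[F]_n.+1, l.@[p 0] != 0} -> uniq s ->
  {in s &, forall p q : 'rV[F]_n.+1, p != q -> independent_points (p 0) (q 0)} ->
  exists K, forall k, (K <= k)%N ->
    codim (\bigcap_(p <- s) gp (local_ideal J (p 0%R)) k)%VS =
    (\sum_(p <- s) hf (local_ideal J (p 0%R)) N)%N.
Proof.
have idQ Q : is_ideal (local_ideal J Q) by apply: local_ideal_ideal.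
elim: s => [|p s IH] lp.
  by exists 0%N => k _; rewrite !big_nil /codim subnn.
rewrite cons_uniq => /andP[ps us] ind.
have [|//||K KP] := IH.
- by move=> q qs; apply: lp; rewrite inE qs orbT.
- by move=> q q' qs q's; apply: ind; rewrite inE ?qs ?q's orbT.
have lp0 := lp p (mem_head p s).
have [|M [c [e [c0 eM Qe QPe]]]] := @separator_seq (p 0) s lp0.
  move=> q qs; split; first by apply: lp; rewrite inE qs orbT.
  apply: ind; rewrite ?inE ?eqxx ?qs ?orbT //.
  by apply: contraNneq ps => ->.
exists (maxn K (M + N)) => k; rewrite geq_max => /andP[Kk Mk].
rewrite !big_cons codim_capv ?KP // -/(hf _ k).
  rewrite local_hf_constant //; exact: leq_trans (leq_addl M N) Mk.
apply/eqP; rewrite eqEsubv subvf /=; apply/subvP => u _.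
have kE : k = (M + (k - M))%N by rewrite subnKC // (leq_trans (leq_addr N M)).
have uk : val u \is (M + (k - M)).-homog by rewrite -kE; apply: valP.
have [|q qk Jq] := lift_power idJ lP _ uk; first by rewrite leq_subRL ?(leq_trans (leq_addr N M)).
pose a := gr k (c^-1 *: (e * q)).
have ak : c^-1 *: (e * q) \is k.-homog.
  by rewrite rpredZ // kE; apply: dhomogM.
rewrite -[u](subrK a); apply: memv_add.
  apply/mem_gp => //; rewrite linearB /= pihomog_dE //.
  have -> : val u - c^-1 *: (e * q) =
     (val u - q * l ^+ M) - (c^-1%:MP * q) * (e - c *: l ^+ M).
    have cc : c^-1%:MP * c%:MP = 1 :> S by rewrite -mpolyCM mulVf.
    by rewrite -!mul_mpolyC mulrBr [_ * (c%:MP * _)]mulrACA cc; ring.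
  by apply: (idealB (idQ _)); [apply: sub_local_ideal|apply: (ideal_mull (idQ _))].
rewrite memv_bigcap; apply/allP => r rs; apply/(mem_gp_gr _ ak) => //.
by rewrite -mul_mpolyC; apply: (ideal_mull (idQ _)); apply/(ideal_mulr (idQ _))/Qe.
Qed.

End Points.

(** * Zeros in the projective plane *)

Section ProjectivePlane.
Variable F : numClosedFieldType.
Local Notation S := {mpoly F[3]}.

Lemma proj_plane_neq0 (p : 'rV[F]_3) : p != 0 ->
  exists2 c, c != 0 & proj_plane (c *: p).
Proof.
move=> p0; have [i pi] : exists i, p 0 i != 0.
  apply: contrapT => /forallNP H; case/eqP: p0; apply/rowP => i; rewrite mxE.
  by apply/eqP/negPn/negP => /H.
pose j := [arg min_(k < i | p 0 k != 0) (k : nat)].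
have [pj jmin] : p 0 j != 0 /\ forall k, p 0 k != 0 -> (j <= k)%N.
  by rewrite /j; case: arg_minnP.
exists (p 0 j)^-1; first by rewrite invr_eq0.
exists j; rewrite mxE mulVf //; split=> // k kj; rewrite mxE.
by case: (eqVneq (p 0 k) 0) => [->|/jmin]; rewrite ?mulr0 // leqNgt kj.
Qed.

Lemma proj_plane_inj (p q : 'rV[F]_3) c : proj_plane p -> proj_plane q ->
  p = c *: q -> p = q.
Proof.
move=> [i [pi p_lt]] [j [qj q_lt]] pq.
have pE k : p 0 k = c * q 0 k by rewrite pq mxE.
have c0 : c != 0 by apply: contra_eq_neq pi => c00; rewrite pE c00 mul0r eq_sym oner_eq0.
have [ij|ji|/val_inj ij] := ltngtP i j.
- by move: pi; rewrite pE q_lt // mulr0 => /esym/eqP; rewrite oner_eq0.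
- by have := pE j; rewrite p_lt // qj mulr1 => c00; rewrite -c00 eqxx in c0.
have c1 : c = 1 by have := pE i; rewrite pi ij qj mulr1.
by rewrite pq c1 scale1r.
Qed.

Variables (J : set S) (l : S) (N : nat).
Hypotheses (idJ : is_ideal J) (l1 : l \is 1.-homog).
Hypothesis lP : forall k (u : S), (N <= k)%N -> u \is k.+1.-homog ->
  exists2 q, q \is k.-homog & J (u - q * l).

Definition zeros : set 'rV[F]_3 :=
  [set p | proj_plane p /\ vanishes_at J (p 0)].

Lemma zeros_hyperplane p : zeros p -> l.@[p 0] != 0.
Proof.
move=> [[i [pi _]] pJ]; have [q qN Jq] := lP (leqnn N) (homogXn F i N.+1).
have ql : 'X_i ^+ N.+1 - q * l \is N.+1.-homog.
  by rewrite rpredB ?homogXn // -[N.+1]addn1 dhomogM.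
have /eqP := pJ _ _ ql Jq; rewrite mevalB mevalM rmorphXn /= mevalXU pi expr1n.
by rewrite subr_eq0; apply: contraTneq => ->; rewrite mulr0 oner_eq0.
Qed.

(** The ratios of the coordinates of a zero to the value of [l] are roots of
    the relations of [linear_relation], which leaves finitely many zeros. *)
Lemma zeros_finite : exists s : seq 'rV[F]_3, uniq s /\ forall p, p \in s <-> zeros p.
Proof.
have /choice[r rP] : forall i : 'I_3, exists r : seq F,
    forall p, zeros p -> exists2 z, z \in r & p 0 i = z * l.@[p 0].
  move=> i; have [e [r Jr]] := linear_relation idJ l1 lP (homogXU F i).
  exists r => p pZ; have lp0 := zeros_hyperplane pZ; have [_ pJ] := pZ.
  have Xz z : 'X_i - z *: l \is [in F[3], 1.-homog] by rewrite rpredB ?rpredZ ?homogXU.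
  have rh : \prod_(z <- r) ('X_i - z *: l) \is [in F[3], (size r).-homog].
    elim: r {Jr} => [|z r IH]; first by rewrite big_nil dhomog1.
    by rewrite big_cons; apply: (dhomogM (Xz z) IH).
  have lh : l ^+ e \is e.-homog by have := dhomogMn e l1; rewrite mul1n.
  have /eqP := pJ _ _ (dhomogM lh rh) Jr.
  rewrite mevalM rmorphXn /= mulf_eq0 expf_eq0 (negPf lp0) andbF /=.
  rewrite rmorph_prod prodf_seq_eq0 => /hasP[z zr /=].
  by rewrite mevalB mevalZ mevalXU subr_eq0 => /eqP ->; exists z.
pose R := flatten [seq r i | i <- enum 'I_3].
pose B := [seq a / b | a <- R, b <- R].
pose row_of (f : {ffun 'I_3 -> 'I_(size B)}) : 'rV[F]_3 := \row_i B`_(f i).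
pose t := undup [seq row_of f | f <- enum {: {ffun 'I_3 -> 'I_(size B)}}].
exists [seq p <- t | `[< zeros p >]]; split; first by rewrite filter_uniq ?undup_uniq.
move=> p; rewrite mem_filter; split=> [/andP[/asboolP]//|pZ].
apply/andP; split; first exact/asboolP.
have Rr i z : z \in r i -> z \in R.
  by move=> zr; apply/flattenP; exists (r i) => //; apply: map_f; rewrite mem_enum.
have lp0 := zeros_hyperplane pZ; have [[i [pi _]] _] := pZ.
have [b br bE] := rP i p pZ.
have b0 : b != 0 by apply: contra_eq_neq pi => b0; rewrite bE b0 mul0r eq_sym oner_eq0.
have lE : l.@[p 0] = b^-1 by apply: (mulfI b0); rewrite -bE pi mulfV.
have pB j : p 0 j \in B.
  have [a ar ->] := rP j p pZ; rewrite lE.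
  by apply: allpairs_f; [apply: Rr ar|apply: Rr br].
have iB (j : 'I_3) : (index (p 0%R j) B < size B)%N by rewrite index_mem.
rewrite mem_undup; apply/mapP; exists [ffun j => Ordinal (iB j)].
  by rewrite mem_enum.
by apply/rowP => j; rewrite mxE ffunE /= nth_index.
Qed.

Lemma zeros_independent p q : zeros p -> zeros q -> p != q ->
  independent_points l (p 0) (q 0).
Proof.
move=> pZ qZ; apply: contra_neqP => /forallNP H.
have lq := zeros_hyperplane qZ.
apply: (proj_plane_inj (c := l.@[p 0] / l.@[q 0]) pZ.1 qZ.1).
apply/rowP => i; rewrite mxE mulrAC; apply: (mulIf lq); rewrite divfK //.
by rewrite mulrC [RHS]mulrC; apply/eqP/negPn/negP; rewrite mulrC => /H.
Qed.

(** The ideal of all [c] with [c * u] in [J] contains a power of [l], since a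
    common zero of its forms would contradict the hypothesis on [u] there; and
    multiplication by [l] is injective modulo [J] in these degrees. *)
Lemma local_to_global K k u : (N <= K)%N ->
  (forall k (u : S), (K <= k)%N -> u \is k.-homog -> J (l * u) -> J u) ->
  (K <= k)%N -> u \is k.-homog ->
  (forall p, zeros p -> local_ideal J (p 0) u) -> J u.
Proof.
move=> NK reg Kk uk Qu; pose I := [set c | J (c * u)]%classic.
have idI : is_ideal I.
  rewrite /I; split=> [|a b /= Ia Ib|a b /= Ib] /=.
  - by rewrite mul0r; apply: ideal0 idJ.
  - by rewrite mulrDl; apply: (idealD idJ).
  - by rewrite -mulrA; apply: (ideal_mull idJ).
have [[m Im]|/forallNP nI] := pselect (exists m, I (l ^+ m)).
  elim: m Im => [|m IH] Im; first by move: Im; rewrite /I /= mul1r.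
  apply: IH; move: Im; rewrite /I /= exprS -mulrA; apply: (reg (m + k)%N).
    exact: leq_trans (leq_addl _ _).
  by apply: dhomogM => //; have := dhomogMn m l1; rewrite mul1n.
have JI v : J v -> I v by move=> Jv; rewrite /I /= mulrC; apply: (ideal_mull idJ).
have [P [lP1 PI]] := common_zero idJ l1 lP idI JI nI.
pose p : 'rV[F]_3 := \row_i P i.
have p0 : p != 0.
  apply: contra_eq_neq lP1 => p0; rewrite eq_sym.
  have -> : l.@[P] = l.@[fun i => 0 * P i].
    by apply: meval_eq => i; have /rowP/(_ i) := p0; rewrite !mxE mul0r.
  by rewrite (meval_homogZ l1 (fun=> erefl)) expr1 mul0r oner_eq0.
have [c c0 cp] := proj_plane_neq0 p0.
have cE s v : v \is s.-homog -> v.@[(c *: p) 0] = c ^+ s * v.@[P].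
  by move=> vs; apply: meval_homogZ => // i; rewrite !mxE.
have pZ : zeros (c *: p).
  by split=> // s v vs /JI Iv; rewrite (cE s) // (PI s) // mulr0.
have [s [v [vs vp Jvu]]] := Qu _ pZ; case/eqP: vp.
by rewrite (cE s) // (PI s v vs Jvu) mulr0.
Qed.

(** In large degrees the dimension of [S / J] is the sum of the local ones. *)
Lemma hilbert_function_local : exists s K,
  [/\ uniq s, forall p, p \in s <-> zeros p & forall k, (K <= k)%N ->
    hf J k = (\sum_(p <- s) hf (local_ideal J (p 0%R)) N)%N].
Proof.
have [s [us sP]] := zeros_finite; have [K [NK KP reg]] := stabilization idJ l1 lP.
have [||K' K'P] := codim_local_ideals idJ l1 lP _ us.
- by move=> p /sP; apply: zeros_hyperplane.
- by move=> p q /sP pZ /sP qZ; apply: zeros_independent.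
exists s, (maxn K K'); split=> // k; rewrite geq_max => /andP[Kk K'k].
rewrite -(K'P k K'k) /hf; congr codim; apply/vspaceP => u; rewrite memv_bigcap.
have idQ Q : is_ideal (local_ideal J Q) by apply: local_ideal_ideal.
apply/idP/allP => [/(mem_gp u idJ) Ju p ps|Qu].
  by apply/(mem_gp u (idQ _)); apply: sub_local_ideal.
apply/(mem_gp u idJ); apply: (local_to_global NK reg Kk (valP u)) => p /sP ps.
by apply/(mem_gp u (idQ _)); apply: Qu.
Qed.

End ProjectivePlane.

(** * Tjurina ideals *)

Lemma euler_relation n (F : fieldType) d (f : {mpoly F[n]}) : f \is d.-homog ->
  \sum_i 'X_i * f^`M(i) = d%:R *: f.
Proof.
move=> /dhomogP fd.
have XE (m : 'X_{1..n}) : \sum_i 'X_i * ('X_[m])^`M(i) = (mdeg m)%:R *: 'X_[m] :> {mpoly F[n]}.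
  rewrite mdegE natr_sum scaler_suml; apply: eq_bigr => i _.
  rewrite mderivX -scalerAr; have [->|mi] := posnP (m i); first by rewrite !scale0r.
  rewrite -mpolyXD; congr (_ *: 'X_[_]); apply/mnmP => j.
  rewrite mnmDE mnmBE mnm1E; case: eqP => [<-|_]; last by rewrite subn0.
  by rewrite subnKC.
transitivity (\sum_(m <- msupp f) f@_m *: \sum_i 'X_i * ('X_[m])^`M(i)).
  under [RHS]eq_bigr => m _ do rewrite scaler_sumr.
  rewrite [RHS]exchange_big /=.
  apply: eq_bigr => i _; rewrite {1}[f]mpolyE linear_sum mulr_sumr.
  by apply: eq_bigr => m _; rewrite linearZ /= scalerAr.
rewrite {3}[f]mpolyE scaler_sumr; apply: eq_big_seq => m mf.
have md : mdeg m = d := fd m mf.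
by rewrite XE md !scalerA mulrC.
Qed.

Section LocalRing.
Variables (F : fieldType) (n : nat) (a : 'I_n -> F).
Local Notation O := (local_ring a).

Lemma local_ring_poly u : O (tofrac u).
Proof. by exists u, 1; rewrite meval1 oner_neq0 tofrac1 divr1. Qed.

Lemma local_ring_inv v : v.@[a] != 0 -> O (tofrac v)^-1.
Proof. by move=> va; exists 1, v; rewrite tofrac1 div1r. Qed.

Lemma tofrac_meval_neq0 (v : {mpoly F[n]}) : v.@[a] != 0 -> tofrac v != 0.
Proof. by rewrite tofrac_eq0; apply: contraNneq => ->; rewrite meval0. Qed.

Lemma local_ringM x y : O x -> O y -> O (x * y).
Proof.
move=> [u [v [va ->]]] [s [t [ta ->]]]; exists (u * s), (v * t).
by rewrite mevalM mulf_neq0 // !tofracM mulf_div.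
Qed.

Lemma local_ringD x y : O x -> O y -> O (x + y).
Proof.
move=> [u [v [va ->]]] [s [t [ta ->]]]; exists (u * t + s * v), (v * t).
rewrite mevalM mulf_neq0 // tofracD !tofracM addf_div //; exact: tofrac_meval_neq0.
Qed.

Variable g : {mpoly F[n]}.
Local Notation T := (tjurina_ideal a g).

Lemma tjurina_ideal0 : T 0.
Proof.
exists 0, (fun=> 0); split=> [|i|].
- by rewrite -tofrac0; apply: local_ring_poly.
- by rewrite -tofrac0; apply: local_ring_poly.
by rewrite mul0r big1 ?addr0 // => i _; rewrite mul0r.
Qed.

Lemma tjurina_idealD x y : T x -> T y -> T (x + y).
Proof.
move=> [c [b [Oc Ob ->]]] [c' [b' [Oc' Ob' ->]]].
exists (c + c'), (fun i => b i + b' i); split=> [|i|].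
- exact: local_ringD.
- exact: local_ringD.
rewrite mulrDl addrACA -big_split /=; congr (_ + _).
by apply: eq_bigr => i _; rewrite mulrDl.
Qed.

Lemma tjurina_idealM x y : O x -> T y -> T (x * y).
Proof.
move=> Ox [c [b [Oc Ob ->]]]; exists (x * c), (fun i => x * b i); split=> [|i|].
- exact: local_ringM.
- exact: local_ringM.
rewrite mulrDr mulrA mulr_sumr; congr (_ + _).
by apply: eq_bigr => i _; rewrite mulrA.
Qed.

Lemma tjurina_idealB x y : T x -> T y -> T (x - y).
Proof.
move=> Tx Ty; apply: tjurina_idealD => //; rewrite -mulN1r.
by apply: tjurina_idealM => //; rewrite -tofrac1 -tofracN; apply: local_ring_poly.
Qed.

Lemma tjurina_ideal_sum (I : Type) (r : seq I) (E : I -> {fraction {mpoly F[n]}}) :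
  (forall i, T (E i)) -> T (\sum_(i <- r) E i).
Proof.
by move=> TE; apply: big_ind => //; [apply: tjurina_ideal0|apply: tjurina_idealD].
Qed.

Lemma tjurina_ideal_g : T (tofrac g).
Proof.
exists 1, (fun=> 0); split=> [|i|].
- by rewrite -tofrac1; apply: local_ring_poly.
- by rewrite -tofrac0; apply: local_ring_poly.
by rewrite mul1r big1 ?addr0 // => i _; rewrite mul0r.
Qed.

Lemma tjurina_ideal_deriv k : T (tofrac g^`M(k)).
Proof.
exists 0, (fun i => (i == k)%:R); split=> [|i|].
- by rewrite -tofrac0; apply: local_ring_poly.
- by rewrite -[_%:R]/(tofrac _ *+ _) -tofracMn; apply: local_ring_poly.
rewrite mul0r add0r (bigD1 k) //= eqxx mul1r big1 ?addr0 // => i /negPf->.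
by rewrite mul0r.
Qed.

(** Elements of the Tjurina ideal have representatives with numerator in the
    polynomial ideal of [g] and its derivatives. *)
Lemma tjurina_ideal_numerator (I : set {mpoly F[n]}) x : is_ideal I -> I g ->
  (forall k, I g^`M(k)) -> T x ->
  exists V w, [/\ V.@[a] != 0, I w & tofrac V * x = tofrac w].
Proof.
move=> idI Ig Igk [c [b [Oc Ob ->]]].
pose N y := exists V w, [/\ V.@[a] != 0, I w & tofrac V * y = tofrac w].
have NM y w : O y -> I w -> N (y * tofrac w).
  move=> [u [v [va ->]]] Iw; exists v, (u * w); split=> //.
    exact: (ideal_mull idI).
  by rewrite tofracM mulrA mulrCA divff ?mulr1 // tofrac_meval_neq0.
have ND y z : N y -> N z -> N (y + z).
  move=> [V [w [Va Iw VE]]] [V' [w' [V'a Iw' V'E]]].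
  exists (V * V'), (V' * w + V * w'); split.
  - by rewrite mevalM mulf_neq0.
  - by apply: (idealD idI); apply: (ideal_mull idI).
  by rewrite tofracD !tofracM -VE -V'E; ring.
apply: (ND); first exact: NM.
apply: (big_ind N) => // [|k _]; last exact: NM.
exists 1, 0; rewrite meval1 oner_neq0 mulr0 tofrac0; split=> //.
exact: ideal0 idI.
Qed.

(** The second family being independent modulo the ideal, and a combination of
    the first one, it cannot be larger. *)
Lemma quotient_dim_le k k' : quotient_dim O T k -> quotient_dim O T k' -> (k' <= k)%N.
Proof.
move=> [b [Ob bP]] [b' [Ob' b'P]]; rewrite leqNgt; apply/negP => kk'.
have /choice[C CP] : forall j, exists c : 'rV[F]_k,
    T (b' j - \sum_(i < k) tofrac (c 0 i)%:MP * b i).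
  by move=> j; have [c [Tc _]] := bP _ (Ob' j); exists c.
pose M : 'M[F]_(k', k) := \matrix_(j, i) C j 0 i.
have [y y0 yM] : exists2 y : 'rV_k', y != 0 & y *m M = 0.
  have : kermx M != 0.
    rewrite kermx_eq0 /row_free; apply: contraTneq kk' => rM.
    by rewrite -leqNgt -rM rank_leq_col.
  by move=> /rowV0Pn[y yk y0]; exists y => //; apply/sub_kermxP.
have Oc c : O (tofrac c%:MP) by apply: local_ring_poly.
have Ty : T (0 - \sum_(j < k') tofrac (y 0 j)%:MP * b' j).
  have E : \sum_(j < k') tofrac (y 0 j)%:MP * (b' j - \sum_(i < k) tofrac (C j 0 i)%:MP * b i)
      = \sum_(j < k') tofrac (y 0 j)%:MP * b' j.
    rewrite -[RHS]subr0 -[X in _ = _ - X](_ : \sum_(i < k) tofrac ((y *m M) 0 i)%:MP * b i = 0).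
      under eq_bigr => j _ do rewrite mulrBr.
      rewrite sumrB; congr (_ - _).
      under eq_bigr => j _ do rewrite mulr_sumr.
      rewrite exchange_big /=.
      apply: eq_bigr => i _; rewrite mxE !rmorph_sum mulr_suml.
      by apply: eq_bigr => j _; rewrite mxE /= mpolyCM tofracM mulrA.
    by rewrite big1 // => i _; rewrite yM mxE mpolyC0 tofrac0 mul0r.
  rewrite -E; apply: tjurina_idealB; first exact: tjurina_ideal0.
  by apply: tjurina_ideal_sum => j; apply: tjurina_idealM.
have T0 : T (0 - \sum_(j < k') tofrac ((0 : 'rV[F]_k') 0 j)%:MP * b' j).
  rewrite big1 ?subr0; first exact: tjurina_ideal0.
  by move=> j _; rewrite mxE mpolyC0 tofrac0 mul0r.
have O0 : O 0 by rewrite -tofrac0; apply: local_ring_poly.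
have [c [_ cU]] := b'P 0 O0.
by rewrite -(cU _ Ty) (cU _ T0) eqxx in y0.
Qed.

Lemma affine_tjurinaE k : quotient_dim O T k -> affine_tjurina a g = k.
Proof.
move=> qk; apply: xget_unique => // k' qk'.
by apply/eqP; rewrite eqn_leq !quotient_dim_le.
Qed.

End LocalRing.

(** * Affine charts *)

Section Chart.
Variables (F : numClosedFieldType) (i : 'I_3).
Local Notation S := {mpoly F[3]}.
Implicit Types (u v : S).

Definition dehomog_tuple : 3.-tuple {mpoly F[2]} :=
  [tuple if unlift i j is Some k then 'X_k else 1 | j < 3].

HB.instance Definition _ := GRing.RMorphism.copy (@dehomog F i) (comp_mpoly dehomog_tuple).

Lemma dehomogC c : dehomog i c%:MP_[3] = c%:MP_[2] :> {mpoly F[2]}.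
Proof. exact: comp_mpolyC. Qed.

Lemma dehomogZ c u : dehomog i (c *: u) = c *: dehomog i u.
Proof. exact: comp_mpolyZ. Qed.

Lemma dehomogD u v : dehomog i (u + v) = dehomog i u + dehomog i v.
Proof. exact: (rmorphD (@dehomog F i)). Qed.

Lemma dehomogB u v : dehomog i (u - v) = dehomog i u - dehomog i v.
Proof. exact: (rmorphB (@dehomog F i)). Qed.

Lemma dehomogM u v : dehomog i (u * v) = dehomog i u * dehomog i v.
Proof. exact: (rmorphM (@dehomog F i)). Qed.

Lemma dehomog_sum (I : Type) (r : seq I) (E : I -> S) :
  dehomog i (\sum_(j <- r) E j) = \sum_(j <- r) dehomog i (E j).
Proof. exact: (rmorph_sum (@dehomog F i)). Qed.

Lemma dehomogXn u k : dehomog i (u ^+ k) = dehomog i u ^+ k.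
Proof. exact: (rmorphXn (@dehomog F i)). Qed.

Lemma dehomogX : dehomog i ('X_i : S) = 1.
Proof. by rewrite /dehomog comp_mpolyXU -tnth_nth tnth_mktuple unlift_none. Qed.

Lemma dehomogX_lift k : dehomog i ('X_(lift i k) : S) = 'X_k.
Proof. by rewrite /dehomog comp_mpolyXU -tnth_nth tnth_mktuple liftK. Qed.

Lemma dehomog_deriv u k : (dehomog i u)^`M(k) = dehomog i u^`M(lift i k).
Proof.
have XU n (j m : 'I_n) : ('X_j : {mpoly F[n]})^`M(m) = (j == m)%:R.
  rewrite mderivX mnm1E; case: eqP => [->|_]; last by rewrite scale0r.
  by rewrite scale1r (_ : (_ - _)%MM = 0%MM) ?mpolyX0 //; apply/mnmP => o; rewrite mnmBE subnn mnm0E.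
elim/mpoly_alg_ind: u => [c|j|u v IHu IHv|u v IHu IHv].
- by rewrite dehomogC !mderivC -[0 in RHS]mpolyC0 dehomogC mpolyC0.
- rewrite XU; case: (unliftP i j) => [m ->|->].
    rewrite dehomogX_lift XU (inj_eq lift_inj).
    by case: eqP => _; rewrite -?mpolyC1 -?mpolyC0 dehomogC.
  by rewrite dehomogX -mpolyC1 mderivC (negPf (neq_lift i k)) -mpolyC0 dehomogC mpolyC0.
- by rewrite mderivD !dehomogD mderivD IHu IHv.
- by rewrite dehomogM mderivM IHu IHv mderivM dehomogD !dehomogM.
Qed.

Lemma meval_dehomog s u (p : 'rV[F]_3) : p 0 i != 0 -> u \is s.-homog ->
  (dehomog i u).@[chart_coord i p] = (p 0 i)^-1 ^+ s * u.@[p 0].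
Proof.
move=> pi us; rewrite -(meval_homogZ us (fun=> erefl)) comp_mpoly_meval.
apply: meval_eq => j; rewrite tnth_mktuple; case: unliftP => [k ->|->].
  by rewrite mevalXU /chart_coord mulrC.
by rewrite meval1 mulVf.
Qed.

Lemma dehomog_inj s u : u \is s.-homog -> dehomog i u = 0 -> u = 0.
Proof.
move=> us u0; apply/eqP/negPn/negP => /(homog_neq0_eval i us)[v [vi /negP[]]].
pose p : 'rV[F]_3 := \row_j v j.
have pi : p 0 i = 1 by rewrite mxE.
have := @meval_dehomog s u p; rewrite pi oner_neq0 u0 meval0 invr1 expr1n mul1r.
by move=> /(_ isT us) ->; apply/eqP/meval_eq => j; rewrite mxE.
Qed.

Lemma homogenize w : exists R, forall r, (R <= r)%N ->
  exists2 W : S, W \is r.-homog & dehomog i W = w.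
Proof.
elim/mpoly_alg_ind: w => [c|k|u v [Ru uP] [Rv vP]|u v [Ru uP] [Rv vP]].
- exists 0%N => r _; exists (c *: 'X_i ^+ r); first by rewrite rpredZ // homogXn.
  by rewrite dehomogZ dehomogXn dehomogX expr1n -mpolyC1 -mul_mpolyC -mpolyCM mulr1.
- exists 1%N => -[|r] // _; exists ('X_(lift i k) * 'X_i ^+ r).
    exact: (dhomogM (homogXU F _) (homogXn F i r)).
  by rewrite dehomogM dehomogXn dehomogX expr1n mulr1 dehomogX_lift.
- exists (maxn Ru Rv) => r; rewrite geq_max => /andP[/uP[U Ur <-] /vP[V Vr <-]].
  by exists (U + V); rewrite ?rpredD // dehomogD.
- exists (Ru + Rv)%N => r Rr; have [U Ur <-] := uP Ru (leqnn _).
  have [|V Vr <-] := vP (r - Ru)%N; first by rewrite leq_subRL // (leq_trans (leq_addr _ _) Rr).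
  exists (U * V); last exact: dehomogM.
  by have := dhomogM Ur Vr; rewrite subnKC // (leq_trans (leq_addr _ _) Rr).
Qed.

Lemma homogenize_family (I : finType) (w : I -> {mpoly F[2]}) :
  exists R, forall r, (R <= r)%N ->
  exists W : I -> S, forall j, W j \is r.-homog /\ dehomog i (W j) = w j.
Proof.
have /choice[R RP] := fun j => homogenize (w j).
exists (\max_j R j)%N => r Rr.
have /choice[W WP] : forall j, exists W : S, W \is r.-homog /\ dehomog i W = w j.
  move=> j; have [|W Wr WE] := RP j r; last by exists W.
  exact: leq_trans (leq_bigmax j) Rr.
by exists W.
Qed.

End Chart.

(** * The Jacobian ideal at a singular point *)

Section LocalTjurina.
Variables (F : numClosedFieldType) (d : nat) (f : {mpoly F[3]}).
Hypotheses (d0 : (0 < d)%N) (fd : f \is d.-homog).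
Local Notation S := {mpoly F[3]}.

Definition jacobian_ideal : set S := gen_ideal (fun j : 'I_3 => f^`M(j)).
Local Notation J := jacobian_ideal.

Lemma deriv_homog n (K : fieldType) e (h : {mpoly K[n]}) j :
  h \is e.-homog -> h^`M(j) \is e.-1.-homog.
Proof.
move=> /dhomogP he; apply/dhomogP => m; rewrite mcoeff_msupp mcoeff_mderiv.
have [mh _|mh] := boolP ((m + U_(j))%MM \in msupp h); last first.
  by rewrite (memN_msupp_eq0 mh) mul0rn eqxx.
have mE : mdeg (m + U_(j)) = e := he _ mh.
by rewrite -mE mdegD mdeg1 addn1.
Qed.

Lemma jacobian_is_ideal : is_ideal J.
Proof. exact: gen_ideal_ideal. Qed.

Let idJ := jacobian_is_ideal.

Lemma sing_pointsE p : sing_points f p <-> zeros J p.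
Proof.
split=> [[pP fp dp]|[pP Jp]].
  split=> // k u _ [c ->]; rewrite rmorph_sum big1 // => j _.
  by rewrite /= mevalM dp mulr0.
have dp j : (f^`M(j)).@[p 0] = 0.
  by apply: (Jp d.-1); [apply: deriv_homog|apply: gen_ideal_gen].
split=> //; have := congr1 (meval (p 0)) (euler_relation fd).
rewrite rmorph_sum big1 => [/esym/eqP|j _]; last by rewrite /= mevalM dp mulr0.
by rewrite mevalZ mulf_eq0 pnatr_eq0 -leqn0 leqNgt d0 => /eqP.
Qed.

Variables (l : S) (N : nat).
Hypothesis l1 : l \is 1.-homog.
Hypothesis lP : forall k (u : S), (N <= k)%N -> u \is k.+1.-homog ->
  exists2 q, q \is k.-homog & J (u - q * l).

Variables (p : 'rV[F]_3) (i : 'I_3).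
Hypotheses (pi : p 0 i != 0) (lp : l.@[p 0] != 0).
Local Notation Q := (local_ideal J (p 0)).
Local Notation a := (chart_coord i p).
Local Notation g := (dehomog i f).
Local Notation O := (local_ring a).
Local Notation T := (tjurina_ideal a g).

Let idQ : is_ideal Q := local_ideal_ideal _ idJ.

Let I2 : set {mpoly F[2]} := gen_ideal (fun j : 'I_3 => dehomog i f^`M(j)).
Let idI2 : is_ideal I2 := gen_ideal_ideal _.

Lemma dehomog_euler : d%:R *: g =
  dehomog i f^`M(i) + \sum_k 'X_k * g^`M(k).
Proof.
rewrite -dehomogZ -(euler_relation fd) dehomog_sum (bigD1_ord i) //=.
rewrite dehomogM dehomogX mul1r; congr (_ + _); apply: eq_bigr => k _.
by rewrite dehomogM dehomogX_lift dehomog_deriv.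
Qed.

Lemma dehomog_local_ideal u : Q u -> T (tofrac (dehomog i u)).
Proof.
move=> [s [v [vs vp [c vu]]]].
have va : (dehomog i v).@[a] != 0.
  by rewrite (meval_dehomog pi vs) mulf_neq0 // expf_neq0 // invr_eq0.
have Tf j : T (tofrac (dehomog i f^`M(j))).
  case: (unliftP i j) => [k ->|->]; first by rewrite -dehomog_deriv; apply: tjurina_ideal_deriv.
  have -> : dehomog i f^`M(i) = d%:R *: g - \sum_k 'X_k * g^`M(k).
    by rewrite dehomog_euler addrK.
  rewrite tofracB -mul_mpolyC tofracM; apply: tjurina_idealB.
    by apply: tjurina_idealM; [apply: local_ring_poly|apply: tjurina_ideal_g].
  rewrite rmorph_sum; apply: tjurina_ideal_sum => k; rewrite /= tofracM; apply: tjurina_idealM.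
    exact: local_ring_poly.
  exact: tjurina_ideal_deriv.
have -> : tofrac (dehomog i u) =
    (tofrac (dehomog i v))^-1 * tofrac (dehomog i (v * u)).
  by rewrite dehomogM tofracM mulKf // (tofrac_meval_neq0 va).
apply: tjurina_idealM; first exact: local_ring_inv.
rewrite vu dehomog_sum rmorph_sum; apply: tjurina_ideal_sum => j.
rewrite /= dehomogM tofracM; apply: tjurina_idealM => //; exact: local_ring_poly.
Qed.

(** Clearing denominators and homogenizing all the coefficients to the same
    degree turns membership in the Tjurina ideal into membership in [J] after
    multiplication by a form not vanishing at [p]. *)
Lemma local_ideal_dehomog k u : u \is k.-homog -> T (tofrac (dehomog i u)) -> Q u.
Proof.
move=> uk Tu; have I2k m : I2 g^`M(m).
  by rewrite dehomog_deriv; apply: (gen_ideal_gen (fun j => dehomog i f^`M(j))).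
have dn0 : d%:R != 0 :> F by rewrite pnatr_eq0 -lt0n.
have I2g : I2 g.
  have -> : g = (d%:R^-1)%:MP * (d%:R *: g).
    by rewrite mul_mpolyC scalerA mulVf // scale1r.
  apply: (ideal_mull idI2); rewrite dehomog_euler; apply: (idealD idI2).
    exact: (gen_ideal_gen (fun j => dehomog i f^`M(j))).
  by apply: (ideal_sum idI2) => m _; apply: (ideal_mull idI2).
have [V [w [Va [c wE] /eqP]]] := tjurina_ideal_numerator idI2 I2g I2k Tu.
rewrite -tofracM tofrac_eq => /eqP VuE.
have [R RP] := homogenize i V; have [R' R'P] := homogenize_family i c.
pose r := (k + (R + R'))%N.
have [|W Ws WE] := RP (r + d.-1 - k)%N; first by rewrite /r; lia.
have [|C CP] := R'P r; first by rewrite /r; lia.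
exists (r + d.-1 - k)%N, W; split=> //.
  by move: Va; rewrite -WE (meval_dehomog pi Ws) mulf_eq0 negb_or => /andP[].
exists C; apply/eqP; rewrite -subr_eq0; apply/eqP.
have fj j : f^`M(j) \is d.-1.-homog by apply: deriv_homog.
apply: (@dehomog_inj F i (r + d.-1)).
  apply: rpredB; last by apply: rpred_sum => j _; apply: dhomogM => //; case: (CP j).
  by have := dhomogM Ws uk; rewrite subnK // /r; lia.
rewrite dehomogB dehomogM WE VuE wE dehomog_sum.
apply/eqP; rewrite subr_eq0; apply/eqP; apply: eq_bigr => j _.
by rewrite dehomogM; case: (CP j) => _ ->.
Qed.

(** Multiplication by a form not vanishing at [p] is a bijection of the graded
    pieces of [S / Q] in large degrees, so every fraction is congruent to a
    dehomogenized form of any large degree. *)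
Lemma dehomog_surjective k x : (N <= k)%N -> O x ->
  exists W : dhomog 3 F k, T (x - tofrac (dehomog i (val W))).
Proof.
move=> Nk [u [v [va ->]]].
have [R RP] := homogenize i u; have [R' R'P] := homogenize i v.
have [|V Vs VE] := R'P (R + R')%N; first exact: leq_addl.
have [|U Us UE] := RP (R + R' + k)%N; first by rewrite -addnA leq_addr.
have Vp : V.@[p 0] != 0.
  by move: va; rewrite -VE (meval_dehomog pi Vs) mulf_eq0 negb_or => /andP[].
have hfE m : (N <= m)%N -> hf Q m = hf Q N.
  by move=> Nm; apply: (local_hf_constant idJ l1 lP lp Nm).
have [||W WP] := @surj_of_codim _ _ _ (@mulh 2 F V k (R + R' + k)) (gp Q k)
    (gp Q (R + R' + k)) _ _ (gr (R + R' + k) U).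
- move=> w /(mem_gp_mulh w idQ Vs (erefl _)) Qw; apply/mem_gp => //.
  exact: local_ideal_cancel Vs Vp Qw.
- by rewrite -/(hf Q k) -/(hf Q _) !hfE // (leq_trans Nk (leq_addl _ _)).
exists W; move: WP => /(mem_gp_sub_mulh _ _ idQ Vs (erefl _)).
rewrite val_gr // => /dehomog_local_ideal; rewrite dehomogB dehomogM UE VE.
rewrite tofracB tofracM => TW.
have -> : tofrac u / tofrac v - tofrac (dehomog i (val W)) =
    (tofrac v)^-1 * (tofrac u - tofrac v * tofrac (dehomog i (val W))).
  by rewrite mulrBr mulKf ?(tofrac_meval_neq0 va) // [_^-1 * _]mulrC.
by apply: tjurina_idealM => //; apply: local_ring_inv.
Qed.

(** Dehomogenization identifies [S / Q] in degree [N] with the local Tjurina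
    algebra. *)
Lemma local_tjurina : affine_tjurina a g = hf Q N.
Proof.
apply: affine_tjurinaE; pose U := gp Q N; pose B := vbasis (U^C)%VS.
have dimC : \dim (U^C) = hf Q N by rewrite dimv_compl.
pose D (w : dhomog 3 F N) := tofrac (dehomog i (val w)).
have DU w : w \in U <-> T (D w).
  split=> [/(mem_gp w idQ)/dehomog_local_ideal//|Tw].
  by apply/(mem_gp w idQ); apply: local_ideal_dehomog Tw; apply: valP.
have DZ c w : D (c *: w) = tofrac c%:MP * D w.
  by rewrite /D linearZ /= dehomogZ -mul_mpolyC tofracM.
have DB v w : D (v - w) = D v - D w by rewrite /D linearB /= dehomogB tofracB.
have Dsum (c : 'rV[F]_(\dim (U^C))) : \sum_(j < \dim (U^C)) tofrac (c 0 j)%:MP * D B`_j =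
    D (\sum_(j < \dim (U^C)) c 0 j *: B`_j).
  rewrite /D linear_sum /= dehomog_sum rmorph_sum; apply: eq_bigr => j _.
  by rewrite -DZ.
rewrite -dimC; exists (fun j => D B`_j); split=> [j|x Ox]; first exact: local_ring_poly.
have [W TW] := dehomog_surjective (leqnn N) Ox.
have /memv_addP[w1 w1U [w2 w2C WE]] : W \in (U + U^C)%VS by rewrite addv_complf memvf.
exists (\row_j coord B j w2); split.
  rewrite Dsum (eq_bigr (fun j => coord B j w2 *: B`_j)) => [|j _]; last by rewrite mxE.
  rewrite -(coord_vbasis w2C); have -> : w2 = W - w1 by rewrite WE addrC addKr.
  have -> : x - D (W - w1) = (x - D W) + D w1 by rewrite DB opprB addrA addrAC.
  by apply: tjurina_idealD => //; apply/DU.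
move=> c; rewrite Dsum => Tc; apply/rowP => j; rewrite mxE.
set z := \sum_(_ < _) _ in Tc.
have zC : z \in (U^C)%VS.
  by apply: memv_suml => m _; apply/memvZ/vbasis_mem/memt_nth.
have zw2 : z = w2.
  apply/eqP; rewrite -subr_eq0 -memv0 -(capv_compl U) memv_cap.
  rewrite [X in _ && X]memvB // andbT; apply/DU.
  have -> : D (z - w2) = (x - D W) + D w1 - (x - D z).
    by rewrite DB WE /D linearD /= dehomogD tofracD; ring.
  by apply: tjurina_idealB => //; apply: tjurina_idealD => //; apply/DU.
by rewrite -zw2 /z coord_sum_free // (basis_free (vbasisP _)).
Qed.

End LocalTjurina.

(** * The total Tjurina number as a Hilbert function *)

Lemma divides_msize n (K : fieldType) (p q : {mpoly K[n]}) :
  q != 0 -> divides p q -> (msize p <= msize q)%N.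
Proof.
move=> q0 [c qE]; move: q0; rewrite qE mulf_eq0 negb_or => /andP[c0 p0].
rewrite msizeM //; have : (0 < msize c)%N by rewrite lt0n msize_poly_eq0.
by case: (msize c) => // a _; rewrite addSn leq_addl.
Qed.

Lemma msize_deriv n (K : fieldType) (p : {mpoly K[n]}) i :
  p^`M(i) != 0 -> (msize p^`M(i) < msize p)%N.
Proof.
move=> pi0; rewrite -(mlead_deg pi0); have := mlead_supp pi0.
set m := mlead _; rewrite mcoeff_msupp mcoeff_mderiv => pm.
have mi : (m + U_(i))%MM \in msupp p.
  by rewrite mcoeff_msupp; apply: contraNneq pm => ->; rewrite mul0rn.
by have := msize_mdeg_lt mi; rewrite mdegD mdeg1 addn1.
Qed.

(** The exponents of the leading monomial are invertible in characteristic
    zero. *)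
Lemma deriv_eq0_const n (K : numFieldType) (p : {mpoly K[n]}) :
  (forall i, p^`M(i) = 0) -> (msize p <= 1)%N.
Proof.
move=> dp; have [->|p0] := eqVneq p 0; first by rewrite msize0.
rewrite -(mlead_deg p0) ltnS leqn0 mdeg_eq0; apply/eqP/mnmP => i; rewrite mnm0E.
apply/eqP; rewrite -leqn0 leqNgt; apply/negP => mi.
have := mlead_supp p0; rewrite mcoeff_msupp => /negP[].
have := mcoeff_mderiv i p (mlead p - U_(i))%MM.
rewrite dp mcoeff0 submK; last by rewrite lep1mP -lt0n.
by move/esym/eqP; rewrite mulrn_eq0.
Qed.

(** A prime common to all the derivatives divides [f] by Euler's relation, and
    then divides it twice, as it cannot divide its own derivatives. *)
Lemma reduced_coprime (F : numFieldType) n d (f : {mpoly F[n]}) :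
  (0 < d)%N -> f \is d.-homog -> reduced f ->
  coprime_family (fun i : 'I_n => f^`M(i)).
Proof.
move=> d0 fd [f0 fred] p pP; apply: contrapT => /forallNP pd.
have {}pd i : divides p f^`M(i) by apply: contrapT => /pd.
have dn0 : d%:R != 0 :> F by rewrite pnatr_eq0 -lt0n.
have [c fE] : divides p f.
  have -> : f = (d%:R^-1)%:MP * \sum_i 'X_i * f^`M(i).
    by rewrite (euler_relation fd) mul_mpolyC scalerA mulVf // scale1r.
  by apply/divides_mull/divides_sum => i _; apply: divides_mull.
have [p0 /negP pU pM] := pP.
have [[e cE]|pc] := pselect (divides p c).
  by apply/pU/(fred p e); rewrite fE cE -mulrA mulrC.
have pdp i : divides p p^`M(i).
  have : divides p (c * p^`M(i)).
    have -> : c * p^`M(i) = f^`M(i) - c^`M(i) * p by rewrite fE mderivM addrC addKr.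
    by apply: dividesB => //; apply/divides_mull/divides_refl.
  by case/pM.
apply: pU; have pC : (msize p <= 1)%N.
  apply: deriv_eq0_const => i; apply/eqP/negPn/negP => pi0.
  by have := divides_msize pi0 (pdp i); rewrite leqNgt msize_deriv.
rewrite (msize1_polyC pC) const_mpoly_unit //.
by apply: contraNneq p0 => c0; rewrite (msize1_polyC pC) c0 mpolyC0.
Qed.

Lemma reduced_deriv_neq0 (F : numFieldType) n d (f : {mpoly F[n]}) :
  (0 < d)%N -> f \is d.-homog -> reduced f -> exists i, f^`M(i) != 0.
Proof.
move=> d0 fd [f0 _]; apply: contrapT => /forallNP H; case/negP: f0.
have := euler_relation fd; rewrite big1 => [/esym/eqP|i _].
  by rewrite mscalerI pnatr_eq0 -[_ == 0%N]negbK -lt0n d0.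
by rewrite (_ : f^`M(i) = 0) ?mulr0 //; apply/eqP/negPn/negP => /H.
Qed.

(** The total Tjurina number is the value in large degrees of the Hilbert
    function of the Milnor algebra. *)
Theorem total_tjurina_hilbert (F : numClosedFieldType) d (f : {mpoly F[3]}) :
  (0 < d)%N -> f \is d.-homog -> reduced f ->
  exists K, forall k, (K <= k)%N -> hf (jacobian_ideal f) k = total_tjurina f.
Proof.
move=> d0 fd fred; have [i0 fi0] := reduced_deriv_neq0 d0 fd fred.
have [l [N [l1 lP]]] := cofinite_hyperplane (fun i => deriv_homog i fd)
  (reduced_coprime d0 fd fred) fi0.
have idJ := jacobian_is_ideal f.
have [s [K [us sP KP]]] := hilbert_function_local idJ l1 lP.
exists K => k /KP ->; rewrite /total_tjurina (fsbig_fwiden s) //; last first.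
- by move=> p [/= ps]; case; apply/(sing_pointsE d0 fd)/sP.
- by move=> p /(sing_pointsE d0 fd)/sP.
rewrite big_seq [RHS]big_seq; apply: eq_bigr => p /sP pZ.
have lp := zeros_hyperplane l1 lP pZ; have [[i [pi _]] _] := pZ.
rewrite /tjurina; case: pickP => [j pj|/(_ i)]; last by rewrite pi oner_neq0.
by rewrite (local_tjurina d0 fd l1 lP pj lp).
Qed.

(** * Cross products *)

Section CrossProduct.
Variable A : comNzRingType.
Implicit Types r s v : 'rV[A]_3.

Definition ix0 : 'I_3 := ord0.
Definition ix1 : 'I_3 := lift ord0 ord0.
Definition ix2 : 'I_3 := lift ord0 (lift ord0 ord0).

Lemma ord3P (P : 'I_3 -> Prop) : P ix0 -> P ix1 -> P ix2 -> forall i, P i.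
Proof.
move=> P0 P1 P2 i; case: (unliftP ord0 i) => [j|] ->; last exact: P0.
case: (unliftP ord0 j) => [k|] ->; last exact: P1.
by rewrite (ord1 k); apply: P2.
Qed.

Lemma sum3E (E : 'I_3 -> A) : \sum_i E i = E ix0 + E ix1 + E ix2.
Proof. by rewrite !big_ord_recl big_ord0 addr0 addrA. Qed.

Definition row3 (a b c : A) : 'rV[A]_3 :=
  \row_i (if i == ix0 then a else if i == ix1 then b else c).

Lemma row3E a b c :
  (row3 a b c 0 ix0 = a) * (row3 a b c 0 ix1 = b) * (row3 a b c 0 ix2 = c).
Proof. by rewrite !mxE. Qed.

Lemma eq_row3 r s : r 0 ix0 = s 0 ix0 -> r 0 ix1 = s 0 ix1 -> r 0 ix2 = s 0 ix2 ->
  r = s.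
Proof. by move=> H0 H1 H2; apply/rowP; apply: ord3P. Qed.

Definition cross r s : 'rV[A]_3 :=
  row3 (r 0 ix1 * s 0 ix2 - r 0 ix2 * s 0 ix1)
       (r 0 ix2 * s 0 ix0 - r 0 ix0 * s 0 ix2)
       (r 0 ix0 * s 0 ix1 - r 0 ix1 * s 0 ix0).

Definition dot r s : A := \sum_i r 0 i * s 0 i.

Lemma crossD r s v : cross r (s + v) = cross r s + cross r v.
Proof. by apply: eq_row3; rewrite [RHS]mxE !row3E !mxE; ring. Qed.

Lemma crossZ r s a : cross r (a *: s) = a *: cross r s.
Proof. by apply: eq_row3; rewrite [RHS]mxE !row3E !mxE; ring. Qed.

Lemma cross_self r : cross r r = 0.
Proof. by apply: eq_row3; rewrite [RHS]mxE !row3E; ring. Qed.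

Lemma dot_crossr v r : dot (cross v r) r = 0.
Proof. by rewrite /dot sum3E !row3E; ring. Qed.

Lemma cross_cross r v s : cross r (cross v s) = dot r s *: v - dot r v *: s.
Proof.
by apply: eq_row3; rewrite [RHS]mxE !row3E !mxE /dot !sum3E; ring.
Qed.

Lemma cross_minor r s i j : cross r s = 0 -> r 0 i * s 0 j = s 0 i * r 0 j.
Proof.
move=> rs; apply/eqP; rewrite -subr_eq0; apply/eqP.
have rsE k : cross r s 0 k = 0 by rewrite rs mxE.
have := (rsE ix0, rsE ix1, rsE ix2); rewrite !row3E => -[[c0 c1] c2].
have n0 : r 0 ix2 * s 0 ix1 - s 0 ix2 * r 0 ix1 = 0 by rewrite -[RHS]oppr0 -c0; ring.
have n1 : r 0 ix0 * s 0 ix2 - s 0 ix0 * r 0 ix2 = 0 by rewrite -[RHS]oppr0 -c1; ring.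
have n2 : r 0 ix1 * s 0 ix0 - s 0 ix1 * r 0 ix0 = 0 by rewrite -[RHS]oppr0 -c2; ring.
move: i j; apply: ord3P; apply: ord3P => //; try ring.
- by rewrite -[RHS]c2; ring.
- by rewrite -[RHS]c0; ring.
- by rewrite -[RHS]c1; ring.
Qed.

End CrossProduct.

(** * The Hilbert function of a complete intersection *)

Section CompleteIntersectionDim.
Variable F : numFieldType.
Local Notation S := {mpoly F[3]}.
Local Notation dimS k := (\dim {:dhomog 3 F k}).

Lemma double_dimS k : (dimS k * 2 = (k + 2) * (k + 1))%N.
Proof.
rewrite dim_homog (_ : 'C(k + 2, k) = 'C(k + 2, 2)); last first.
  by rewrite -[in RHS]bin_sub ?leq_addl // addnK.
by have := bin_ffact (k + 2) 2; rewrite ffactnS ffactn1 addn2 addn1.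
Qed.

(** The Koszul complex of a regular sequence of length two. *)
Lemma dim_pair_ideal p q t (g h : S) :
  g \is p.-homog -> h \is q.-homog -> h != 0 -> coprime_pair g h ->
  (\dim (gp (pair_ideal g h) (t + p + q)) + dimS t = dimS (t + q) + dimS (t + p))%N.
Proof.
move=> gp_ hq h0 cop; have idI := pair_ideal_ideal g h.
pose X := (dhomog 3 F (t + q) * dhomog 3 F (t + p))%type.
pose K := (t + p + q)%N.
pose phi (c : X) : dhomog 3 F K := mulh g K c.1 + mulh h K c.2.
have phi_lin : linear phi.
  by move=> z u v; rewrite /phi !linearP /= scalerDr addrACA.
pose psi (c : dhomog 3 F t) : X := (mulh h (t + q) c, - mulh g (t + p) c).
have psi_lin : linear psi.
  move=> z u v; rewrite /psi; congr (_, _); first exact: linearP.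
  by rewrite linearP opprD -scalerN.
pose phiL : {linear X -> dhomog 3 F K} :=
  HB.pack phi (GRing.isLinear.Build F _ _ _ phi phi_lin).
pose psiL : {linear dhomog 3 F t -> X} :=
  HB.pack psi (GRing.isLinear.Build F _ _ _ psi psi_lin).
have valphi c : val (phi c) = val c.1 * g + val c.2 * h.
  have E1 : val (mulh g K c.1) = g * val c.1 by apply: (val_mulh _ gp_); rewrite /K; lia.
  have E2 : val (mulh h K c.2) = h * val c.2 by apply: (val_mulh _ hq); rewrite /K; lia.
  by rewrite mulrC [_ * h]mulrC -E1 -E2.
have valpsi1 c : val (psi c).1 = val c * h.
  by rewrite mulrC; apply: (val_mulh _ hq); rewrite addnC.
have valpsi2 c : val (psi c).2 = - (val c * g).
  have E : val (mulh g (t + p) c) = g * val c by apply: (val_mulh _ gp_); rewrite addnC.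
  by rewrite mulrC -E.
have psi_inj : injective psiL.
  move=> c c' /(congr1 (fun x : X => val x.1)); rewrite !valpsi1 => E.
  by apply/val_inj/(mulIf h0).
have psi_ker v : phiL v = 0 <-> exists w, v = psiL w.
  split=> [/(congr1 val)|[w ->]].
    rewrite valphi => /eqP; rewrite addr_eq0 -mulNr => /eqP E.
    have [c [c1 c2]] := coprime_pair_cancel (@mpoly_factorial 3 F) cop h0 E.
    have ct : val v.1 = pihomog mdeg t c * h.
      by rewrite -(pihomogM _ _ hq) -c1 pihomog_dE //; apply: valP.
    have ct2 : - val v.2 = pihomog mdeg t c * g.
      rewrite -(pihomogM _ _ gp_) -c2 pihomog_dE // rpredN; exact: valP.
    exists (gr t c); rewrite [v]surjective_pairing; congr (_, _); apply: val_inj.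
      by rewrite valpsi1 ct.
    by rewrite valpsi2 -[LHS]opprK ct2.
  apply: val_inj; rewrite valphi valpsi1 valpsi2 mulNr.
  by rewrite mulrAC subrr.
have := dim_exact psi_inj psi_ker; rewrite dimvf => dE.
have imE : limg (linfun phiL) = gp (pair_ideal g h) K.
  apply/vspaceP => u; apply/memv_imgP/idP => [[v _ ->]|/(mem_gp u idI)[s [w uE]]].
    apply/(mem_gp _ idI); rewrite lfunE valphi.
    by exists (val v.1), (val v.2).
  pose v : X := (gr (t + q) s, gr (t + p) w); exists v; first exact: memvf.
  apply: val_inj; rewrite lfunE valphi /=.
  rewrite -(pihomogM _ _ gp_) -(pihomogM _ _ hq).
  have -> : (t + q + p = K)%N by rewrite /K; lia.
  by rewrite -pihomogD -uE pihomog_dE //; apply: valP.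
by rewrite -imE addnC -dE !dimvf.
Qed.

End CompleteIntersectionDim.

(** * The ideal attached to a Jacobian syzygy *)

Section Syzygies.
Variables (F : numClosedFieldType) (D : nat) (f : {mpoly F[3]}).
Local Notation S := {mpoly F[3]}.
Hypotheses (fd : f \is D.+1.-homog) (cop : coprime_family (fun i : 'I_3 => f^`M(i))).
Local Notation dimS k := (\dim {:dhomog 3 F k}).
Local Notation J := (jacobian_ideal f).

Definition gradient : 'rV[S]_3 := \row_i f^`M(i).

Let fh i : f^`M(i) \is D.-homog := deriv_homog i fd.
Let idJ : is_ideal J := jacobian_is_ideal f.

Lemma D0E (r : 'rV[S]_3) : D0 f r <-> dot r gradient = 0.
Proof.
by rewrite /dot (eq_bigr (fun i => r 0 i * f^`M(i))) // => i _; rewrite mxE.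
Qed.

Lemma D0D (r s : 'rV[S]_3) : D0 f r -> D0 f s -> D0 f (r + s).
Proof.
rewrite /D0 /= => r0 s0.
rewrite (eq_bigr (fun i => r 0 i * f^`M(i) + s 0 i * f^`M(i))) => [|i _].
  by rewrite big_split /= r0 s0 addr0.
by rewrite mxE mulrDl.
Qed.

Lemma D0Z a (r : 'rV[S]_3) : D0 f r -> D0 f (a *: r).
Proof.
rewrite /D0 /= => r0.
rewrite (eq_bigr (fun i => a * (r 0 i * f^`M(i)))) => [|i _]; last by rewrite mxE mulrA.
by rewrite -mulr_sumr r0 mulr0.
Qed.

(** The component of degree [k] of a triple. *)
Definition hrow k (r : 'rV[S]_3) : 'rV[S]_3 := map_mx (pihomog mdeg k) r.

Lemma hrow_id k r : homog_triple k r -> hrow k r = r.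
Proof. by move=> rk; apply/rowP => i; rewrite mxE pihomog_dE. Qed.

Lemma hrow_homog k r : homog_triple k (hrow k r).
Proof. by move=> i; rewrite mxE; apply: pihomogP. Qed.

Lemma D0_hrow k r : D0 f r -> D0 f (hrow k r).
Proof.
rewrite /D0 /= => r0.
rewrite (eq_bigr (fun i => pihomog mdeg (k + D) (r 0 i * f^`M(i)))) => [|i _].
  by rewrite -linear_sum r0 linear0.
by rewrite mxE pihomogM.
Qed.

Lemma hrow_gradient k a : hrow (k + D) (a *: gradient) = pihomog mdeg k a *: gradient.
Proof. by apply/rowP => i; rewrite !mxE pihomogM. Qed.

Lemma hrow_gradient_lt k a : (k < D)%N -> hrow k (a *: gradient) = 0.
Proof. by move=> kD; apply/rowP => i; rewrite !mxE (pihomogM_lt _ (fh i)). Qed.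

Lemma cross_hrow k e r s : homog_triple e r ->
  cross r (hrow k s) = hrow (k + e) (cross r s).
Proof.
move=> re; have E x y : r 0 x * pihomog mdeg k (s 0 y) = pihomog mdeg (k + e) (r 0 x * s 0 y).
  by rewrite mulrC -(pihomogM _ _ (re x)) mulrC.
by apply: eq_row3; rewrite [RHS]mxE !row3E !mxE !E linearB.
Qed.

Variables (i0 : 'I_3).
Hypothesis fi0 : f^`M(i0) != 0.

Lemma gradient_inj a b : a *: gradient = b *: gradient -> a = b.
Proof. by move=> /rowP/(_ i0); rewrite !mxE => /(mulIf fi0). Qed.

(** Both [r] and [s] are orthogonal to the gradient, so their cross product is
    proportional to it, and the partial derivatives have no common factor. *)
Lemma cross_gradient r s : D0 f r -> D0 f s -> exists a, cross r s = a *: gradient.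
Proof.
move=> /D0E r0 /D0E s0; have dotC u v : dot u v = dot v u :> S.
  by apply: eq_bigr => i _; rewrite mulrC.
have H : cross gradient (cross r s) = 0.
  by rewrite cross_cross dotC s0 dotC r0 !scale0r subrr.
have [i|a [_ aE]] := @coprime_cancel S _ (fun i => f^`M(i)) (cross r s 0) f^`M(i0)
    (cross r s 0 i0) (mpoly_factorial fi0) cop.
  by have := cross_minor i0 i H; rewrite ![gradient _ _]mxE.
by exists a; apply/rowP => i; rewrite [RHS]mxE [gradient _ _]mxE aE.
Qed.

Lemma homog_coefficient a k s : homog_triple k s -> s = a *: gradient -> s != 0 ->
  (D <= k)%N /\ a \is (k - D).-homog.
Proof.
move=> sk sE s0; have sH := hrow_id sk; case: leqP => [Dk|kD]; last first.
  by move: s0; rewrite -sH sE hrow_gradient_lt // eqxx.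
split=> //; have : a = pihomog mdeg (k - D) a.
  by apply: gradient_inj; rewrite -hrow_gradient subnK // -sE sH.
by move=> ->; apply: pihomogP.
Qed.

Variables (r1 : 'rV[S]_3) (e1 : nat) (i1 : 'I_3).
Hypotheses (r1e : homog_triple e1 r1) (D0r1 : D0 f r1) (r1i : r1 0 i1 != 0).
Hypothesis r1cop : coprime_family (fun i => r1 0 i).

(** [r] is proportional to [r1], and the entries of [r1] have no common
    factor. *)
Lemma cross_eq0 r : cross r1 r = 0 -> exists c, r = c *: r1.
Proof.
move=> H; have [i|a [_ aE]] := @coprime_cancel S _ (fun i => r1 0 i) (r 0) (r1 0 i1)
    (r 0 i1) (mpoly_factorial r1i) r1cop.
  exact: cross_minor.
by exists a; apply/rowP => i; rewrite mxE.
Qed.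

(** The image of [D0 f] under [r |-> cross r1 r], read off on the gradient; it is
    the quotient of [D0 f] by the submodule generated by [r1]. *)
Definition syzygy_ideal : set S :=
  [set a | exists r, D0 f r /\ cross r1 r = a *: gradient].
Local Notation A := syzygy_ideal.

Lemma syzygy_ideal_ideal : is_ideal A.
Proof.
split=> [|a b [r [r0 ra]] [s [s0 sb]]|a b [s [s0 sb]]].
- by exists r1; rewrite cross_self scale0r.
- exists (r + s); split; first exact: D0D.
  by rewrite crossD ra sb scalerDl.
- exists (a *: s); split; first exact: D0Z.
  by rewrite crossZ sb scalerA.
Qed.

Let idA := syzygy_ideal_ideal.

Lemma D0_koszul v : D0 f (cross v gradient).
Proof. by apply/D0E; apply: dot_crossr. Qed.

Lemma cross_koszul v : cross r1 (cross v gradient) = - dot r1 v *: gradient.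
Proof. by rewrite cross_cross ((D0E r1).1 D0r1) scale0r sub0r scaleNr. Qed.

Lemma syzygy_ideal_koszul v : A (dot r1 v).
Proof.
rewrite -[dot _ _]opprK; apply: (idealN idA); exists (cross v gradient).
by split; [apply: D0_koszul|apply: cross_koszul].
Qed.

Lemma syzygy_ideal_homog j k a : (j + D = k + e1)%N -> a \is j.-homog -> A a ->
  exists r, [/\ homog_triple k r, D0 f r & cross r1 r = a *: gradient].
Proof.
move=> jk aj [r [r0 ra]]; exists (hrow k r); split; first exact: hrow_homog.
  exact: D0_hrow.
by rewrite (cross_hrow _ _ r1e) ra -jk hrow_gradient pihomog_dE.
Qed.

(** Triples of forms of degree [k] are represented by finite functions, which
    carry a structure of vector space over [F]. *)
Section Maps.
Variable k : nat.
Local Notation V3 := {ffun 'I_3 -> dhomog 3 F k}.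

Definition row_of (c : V3) : 'rV[S]_3 := \row_i val (c i).

Lemma row_of_linear z u v : row_of (z *: u + v) = z%:MP *: row_of u + row_of v.
Proof. by apply/rowP => i; rewrite !mxE !ffunE linearP /= mul_mpolyC. Qed.

Definition of_row (r : 'rV[S]_3) : V3 := [ffun i => gr k (r 0 i)].

Lemma of_rowK r : homog_triple k r -> row_of (of_row r) = r.
Proof. by move=> rk; apply/rowP => i; rewrite mxE ffunE val_gr. Qed.

Lemma row_ofK c : of_row (row_of c) = c.
Proof.
by apply/ffunP => i; rewrite ffunE mxE; apply: val_inj; rewrite val_gr //; apply: valP.
Qed.

Lemma row_of_homog c : homog_triple k (row_of c).
Proof. by move=> i; rewrite mxE; apply: valP. Qed.

Lemma of_row_linear z r s : of_row (z%:MP *: r + s) = z *: of_row r + of_row s.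
Proof. by apply/ffunP => i; rewrite !ffunE !mxE mul_mpolyC linearP. Qed.

End Maps.

Definition jacobian_map k (c : {ffun 'I_3 -> dhomog 3 F k}) : dhomog 3 F (k + D) :=
  gr (k + D) (dot (row_of c) gradient).

Lemma jacobian_map_is_linear k : linear (@jacobian_map k).
Proof.
move=> z u v; rewrite /jacobian_map -linearP row_of_linear; congr gr.
rewrite /dot scaler_sumr -big_split; apply: eq_bigr => i _.
by rewrite !mxE /= mulrDl -mulrA mul_mpolyC.
Qed.

HB.instance Definition _ k := GRing.isLinear.Build F _ _ _ (@jacobian_map k)
  (@jacobian_map_is_linear k).

Definition cross_map k K (c : {ffun 'I_3 -> dhomog 3 F k}) :
    {ffun 'I_3 -> dhomog 3 F K} := of_row K (cross r1 (row_of c)).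

Lemma cross_map_is_linear k K : linear (@cross_map k K).
Proof. by move=> z u v; rewrite /cross_map row_of_linear crossD crossZ of_row_linear. Qed.

HB.instance Definition _ k K := GRing.isLinear.Build F _ _ _ (@cross_map k K)
  (@cross_map_is_linear k K).

Definition scale_map k K (r : 'rV[S]_3) (a : dhomog 3 F k) :
    {ffun 'I_3 -> dhomog 3 F K} := of_row K (val a *: r).

Lemma scale_map_is_linear k K r : linear (@scale_map k K r).
Proof.
move=> z u v; rewrite /scale_map -of_row_linear; congr of_row.
by apply/rowP => i; rewrite !mxE linearP /= mulrDl mul_mpolyC scalerAl.
Qed.

HB.instance Definition _ k K r := GRing.isLinear.Build F _ _ _ (@scale_map k K r)
  (@scale_map_is_linear k K r).

Lemma row_of_scale_map k K e r (a : dhomog 3 F k) : homog_triple e r -> K = (k + e)%N ->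
  row_of (scale_map K r a) = val a *: r.
Proof.
move=> re KE; rewrite of_rowK // => i; rewrite mxE KE; apply: dhomogM => //.
exact: valP.
Qed.

Lemma jacobian_map_img k : limg (linfun (@jacobian_map k)) = gp J (k + D).
Proof.
have val_jac c : val (jacobian_map c) = dot (row_of c) gradient.
  rewrite val_gr //; apply: rpred_sum => i _; rewrite !mxE; apply: dhomogM => //.
  exact: valP.
apply/vspaceP => u; apply/memv_imgP/idP => [[c _ ->]|/(mem_gp u idJ)[c uE]].
  apply/(mem_gp _ idJ); rewrite lfunE val_jac /dot; apply: (ideal_sum idJ) => i _.
  by rewrite [gradient _ _]mxE; apply: (ideal_mull idJ); apply: gen_ideal_gen.
exists (of_row k (\row_i c i)); first exact: memvf.
apply: val_inj; rewrite lfunE val_jac -[LHS](pihomog_dE (valP u)) uE linear_sum.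
by apply: eq_bigr => i _; rewrite /= pihomogM // !mxE ffunE mxE.
Qed.

Lemma jacobian_map_ker k c : c \in lker (linfun (@jacobian_map k)) <-> D0 f (row_of c).
Proof.
rewrite memv_ker lfunE D0E; split=> [/eqP/(congr1 val)|E]; last first.
  by apply/eqP; rewrite /= /jacobian_map E linear0.
rewrite /= pihomog_dE //; apply: rpred_sum => i _; rewrite !mxE.
by apply: dhomogM => //; apply: valP.
Qed.

Lemma dim_image_inj (V W : vectType F) (T : {linear V -> W}) (U : {vspace V}) :
  injective T -> \dim (linfun T @: U) = \dim U.
Proof.
move=> Tinj; apply: limg_dim_eq; apply/eqP; rewrite -subv0; apply/subvP => v.
rewrite memv_cap memv_ker lfunE => /andP[_ /eqP Tv].
by rewrite memv0; apply/eqP/Tinj; rewrite Tv linear0.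
Qed.

(** The exact sequence [0 -> S r1 -> D0 f -> A -> 0] in each degree. *)
Lemma dim_syzygies k' k j : k = (k' + e1)%N -> (j + D = k + e1)%N ->
  \dim (lker (linfun (@jacobian_map k))) = (dimS k' + \dim (gp A j))%N.
Proof.
move=> kE jk; pose K := (k + e1)%N.
rewrite -(limg_ker_dim (linfun (@cross_map k K))).
have gradh : homog_triple D gradient by move=> i; rewrite mxE.
have val_cross c : row_of (@cross_map k K c) = cross r1 (row_of c).
  rewrite of_rowK // -{1}(hrow_id (row_of_homog c)) (cross_hrow _ _ r1e).
  exact: hrow_homog.
congr (_ + _)%N.
  have sinj : injective (@scale_map k' k r1).
    move=> u v /(congr1 (@row_of k)); rewrite !(row_of_scale_map _ r1e) //.
    by move=> /rowP/(_ i1); rewrite !mxE => /(mulIf r1i) /val_inj.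
  rewrite -(dim_image_inj fullv sinj); congr (\dim _); apply/vspaceP => c.
  rewrite memv_cap; apply/andP/memv_imgP => [[_]|[a _ ->]].
    rewrite memv_ker lfunE => /eqP/(congr1 (@row_of K)); rewrite val_cross.
    have -> : row_of (0 : {ffun 'I_3 -> dhomog 3 F K}) = 0.
      by apply/rowP => i; rewrite !mxE ffunE.
    move=> /cross_eq0[b cE]; exists (gr k' b); first exact: memvf.
    rewrite lfunE -[LHS]row_ofK; congr of_row.
    rewrite -(hrow_id (row_of_homog c)) cE kE.
    by apply/rowP => i; rewrite !mxE pihomogM.
  rewrite lfunE; split.
    by apply/jacobian_map_ker; rewrite (row_of_scale_map _ r1e) //; apply: D0Z.
  rewrite memv_ker lfunE; apply/eqP; rewrite /= /cross_map (row_of_scale_map _ r1e) //.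
  rewrite crossZ cross_self scaler0; apply/ffunP => i; rewrite !ffunE mxE.
  exact: linear0.
have sinj : injective (@scale_map j K gradient).
  move=> u v /(congr1 (@row_of K)); rewrite !(row_of_scale_map _ gradh) //.
  by move=> /gradient_inj/val_inj.
rewrite -(dim_image_inj _ sinj); congr (\dim _); apply/vspaceP => c.
apply/memv_imgP/memv_imgP => [[u uker ->]|[a aA ->]].
  have /jacobian_map_ker u0 := uker.
  have [a aE] := cross_gradient D0r1 u0; exists (gr j a).
    apply/(mem_gp _ idA); exists (row_of u); split=> //=.
    rewrite -hrow_gradient -aE jk -(cross_hrow _ _ r1e) hrow_id //.
    exact: row_of_homog.
  rewrite !lfunE -[LHS]row_ofK; congr of_row; rewrite val_cross /=.
  rewrite -hrow_gradient -aE jk -(cross_hrow _ _ r1e) hrow_id //.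
  exact: row_of_homog.
have /(mem_gp _ idA) aA' := aA.
have [r [rk r0 ra]] := syzygy_ideal_homog jk (valP a) aA'.
exists (of_row k r); first by apply/jacobian_map_ker; rewrite of_rowK.
by rewrite !lfunE /= /cross_map of_rowK // ra.
Qed.

Lemma dim_jacobian k' k j : k = (k' + e1)%N -> (j + D = k + e1)%N ->
  (dimS k' + \dim (gp A j) + \dim (gp J (k + D)) = 3 * dimS k)%N.
Proof.
move=> kE jk; rewrite -(dim_syzygies kE jk) -jacobian_map_img.
have := limg_ker_dim (linfun (@jacobian_map k)) fullv; rewrite capfv => ->.
by rewrite !dimvf /dim /= card_ord.
Qed.

End Syzygies.

(** * Minimal generators of the module of syzygies *)

(** A prime dividing [n0 + t * n1 + t ^+ 2 * n2] for three values of [t] divides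
    the three coefficients, by inverting a Vandermonde matrix; so each prime
    factor of [h] excludes at most two values of [t]. *)
Lemma generic_combination n (F : numFieldType) (w : 'I_3 -> {mpoly F[n]}) h :
  coprime_family w -> prime_product h ->
  exists t : F, forall p, prime_elt p -> divides p h ->
    ~ divides p (w ix0 + t *: w ix1 + t ^+ 2 *: w ix2).
Proof.
move=> cop; pose q t := w ix0 + t *: w ix1 + t ^+ 2 *: w ix2.
have dZ (p : {mpoly F[n]}) (c : F) (a : {mpoly F[n]}) : c != 0 -> divides p (c *: a) -> divides p a.
  move=> c0 /(divides_mull (c^-1)%:MP).
  by rewrite mul_mpolyC scalerA mulVf // scale1r.
have bad (p : {mpoly F[n]}) : prime_elt p -> exists B : seq F, forall t, t \notin B -> ~ divides p (q t).
  move=> pP; pose bad t := divides p (q t).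
  have [[t1 b1]|no] := pselect (exists t, bad t); last first.
    by exists [::] => t _ bt; apply: no; exists t.
  have [[t2 [b2 t12]]|no] := pselect (exists t, bad t /\ t != t1); last first.
    by exists [:: t1] => t; rewrite inE => tt1 bt; apply: no; exists t.
  have [[t3 [b3 t13 t23]]|no] := pselect (exists t, [/\ bad t, t != t1 & t != t2]); last first.
    by exists [:: t1; t2] => t; rewrite !inE negb_or => /andP[tt1 tt2] bt; apply: no; exists t.
  exfalso; have [i []] := cop p pP.
  have d2 t : bad t -> t != t1 -> divides p (w ix1 + (t1 + t) *: w ix2).
    move=> bt tt1; apply: (dZ _ (t - t1)); first by rewrite subr_eq0.
    have -> : (t - t1) *: (w ix1 + (t1 + t) *: w ix2) = q t - q t1.
      rewrite /q -!mul_mpolyC mpolyCB mpolyCD !mpolyCM /=; ring.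
    exact: dividesB.
  have p2 : divides p (w ix2).
    apply: (dZ _ (t3 - t2)); first by rewrite subr_eq0.
    have -> : (t3 - t2) *: w ix2 =
        (w ix1 + (t1 + t3) *: w ix2) - (w ix1 + (t1 + t2) *: w ix2).
      by rewrite -!mul_mpolyC mpolyCB !mpolyCD; ring.
    by apply: dividesB; apply: d2.
  have p1 : divides p (w ix1).
    rewrite -[w ix1](addrK ((t1 + t2) *: w ix2)); apply: dividesB; first exact: d2.
    by rewrite -mul_mpolyC; apply: divides_mull.
  move: i; apply: ord3P => //.
  have -> : w ix0 = q t1 - (t1%:MP * w ix1 + (t1 ^+ 2)%:MP * w ix2).
    by rewrite /q -!mul_mpolyC; ring.
  by apply: dividesB => //; apply: dividesD; apply: divides_mull.
move=> ph; have [B BP] : exists B : seq F, forall t, t \notin B ->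
    forall p, prime_elt p -> divides p h -> ~ divides p (q t).
  elim: ph => [u uU|p a pP _ [B BP]].
    by exists [::] => t _ p pP /(prime_not_unit pP uU).
  have [B' B'P] := bad p pP; exists (B ++ B') => t.
  rewrite mem_cat negb_or => /andP[tB tB'] r rP; have [_ _ rM] := rP.
  case/rM => [rp|]; last exact: BP.
  move=> rq; apply: (B'P t tB'); apply: divides_trans rq.
  exact: prime_associate.
have [t tB] : exists t, t \notin B.
  have pB0 : \prod_(z <- B) ('X - z%:P) != 0 :> {poly F}.
    by rewrite monic_neq0 // monic_prod_XsubC.
  by have [t] := poly_neq0_eval pB0; rewrite -rootE root_prod_XsubC => tB; exists t.
by exists t; apply: BP.
Qed.

Lemma msize_homog n (K : fieldType) e (u : {mpoly K[n]}) :
  u \is e.-homog -> u != 0 -> msize u = e.+1.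
Proof.
move=> /dhomogP ue u0; rewrite -(mlead_deg u0); congr _.+1.
exact: (ue _ (mlead_supp u0)).
Qed.

Lemma pihomog_lt_msize n (K : fieldType) s (u : {mpoly K[n]}) :
  pihomog mdeg s u != 0 -> (s < msize u)%N.
Proof.
apply: contra_neqT; rewrite -leqNgt => us.
rewrite pihomogE big_seq_cond big1 // => m /andP[mu /eqP ms].
have md : mdeg m = s := ms.
by have := msize_mdeg_lt mu; rewrite md ltnNge us.
Qed.

Section MinimalGenerators.
Variables (F : numClosedFieldType) (D : nat) (f : {mpoly F[3]}).
Local Notation S := {mpoly F[3]}.
Hypothesis fd : f \is D.+1.-homog.
Variables (m : nat) (e : 'I_m -> nat) (rho : 'I_m -> 'rV[S]_3).
Hypothesis rhoe : forall j, homog_triple (e j) (rho j).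
Hypothesis rhoP : minimal_generators (D0 f) rho.

Lemma D0_generated r : D0 f r -> exists c, r = \sum_j c j *: rho j.
Proof.
case: rhoP => <- _ [c rE]; exists c; rewrite rE.
by apply: eq_bigl => j; rewrite finset.in_setT.
Qed.

Lemma D0_generator j : D0 f (rho j).
Proof.
case: rhoP => <- _; exists (fun k => (k == j)%:R).
rewrite (bigD1 j) ?finset.in_setT //= eqxx scale1r big1 ?addr0 // => k.
by move=> /andP[_ /negPf->]; rewrite scale0r.
Qed.

(** A generator which is a combination of the other ones could be left out. *)
Lemma generator_irredundant j (c : 'I_m -> S) : c j = 0 ->
  rho j <> \sum_k c k *: rho k.
Proof.
move=> cj jE; have [gen min] := rhoP.
have /min/setP/(_ j) : Defs.span rho [set~ j]%SET = D0 f.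
  rewrite -gen; apply/seteqP; split=> r [b ->].
    exists (fun k => if k == j then 0 else b k).
    rewrite [RHS](bigD1 j) ?finset.in_setT //= eqxx scale0r add0r.
    apply: eq_big => [k|k]; first by rewrite !inE.
    by rewrite !inE => /negPf->.
  exists (fun k => b k + b j * c k).
  rewrite (bigD1 j) ?finset.in_setT //= {1}jE (bigD1 j) //= cj scale0r add0r.
  rewrite scaler_sumr [X in _ + X](eq_bigl (fun k => k != j)) => [|k]; last by rewrite finset.in_setT.
  rewrite -big_split /= [RHS](eq_bigl (fun k => k != j)) => [|k]; last by rewrite !inE.
  by apply: eq_bigr => k _; rewrite scalerDl scalerA addrC.
by rewrite finset.in_setT finset.in_setC1 eqxx.
Qed.

Lemma D0_homog_generated k r : D0 f r -> homog_triple k r ->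
  exists c, r = \sum_j c j *: rho j /\ forall j, (k < e j)%N -> c j = 0.
Proof.
move=> /D0_generated[c rE] rk.
exists (fun j => if (e j <= k)%N then pihomog mdeg (k - e j) (c j) else 0); split.
- rewrite -[LHS](hrow_id rk) rE; apply/rowP => i; rewrite mxE !summxE linear_sum.
  apply: eq_bigr => j _ /=; rewrite !mxE; case: leqP => [ek|ke].
    by rewrite -(pihomogM _ _ (rhoe j i)) subnK.
  by rewrite mul0r (pihomogM_lt _ (rhoe j i)).
- by move=> j kj; rewrite leqNgt kj.
Qed.

Lemma generator_neq0 j : rho j != 0.
Proof.
apply/eqP => j0; apply: (@generator_irredundant j (fun=> 0)) => //.
by rewrite j0 big1 // => k _; rewrite scale0r.
Qed.

(** Dividing out a common factor of the entries of a generator of least degree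
    would give a syzygy of smaller degree. *)
Lemma least_generator_primitive j0 : (forall j, e j0 <= e j)%N ->
  coprime_family (fun i => rho j0 0 i).
Proof.
move=> emin p pP; apply: contrapT => /forallNP pd.
have /choice[c cE] : forall i, exists c, rho j0 0 i = c * p.
  by move=> i; have /contrapT[c] := pd i; exists c.
have [p0 /negP pU _] := pP.
have p1 : (1 < msize p)%N.
  rewrite ltnNge; apply/negP => /msize1_polyC pC; apply: pU; rewrite pC const_mpoly_unit //.
  by apply: contraNneq p0 => c0; rewrite pC c0 mpolyC0.
have [i ri] : exists i, rho j0 0 i != 0.
  apply: contrapT => /forallNP H; case/eqP: (generator_neq0 j0); apply/rowP => i.
  by rewrite mxE; apply/eqP/negPn/negP => /H.
have ci : c i != 0 by apply: contraNneq ri => c0; rewrite cE c0 mul0r.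
have [s si] := pihomog_neq0 ci.
have s_lt : (s < e j0)%N.
  apply: (leq_trans (pihomog_lt_msize si)).
  have := msize_homog (rhoe j0 i) ri; rewrite cE msizeM // => szE.
  by move: szE p1; move: (msize (c i)) (msize p) => x y; lia.
have D0c : D0 f (\row_i c i).
  have := D0_generator j0; rewrite /D0 /= => E; apply: (mulfI p0); rewrite mulr0 mulr_sumr -[RHS]E.
  by apply: eq_bigr => k _; rewrite mxE cE mulrA [p * _]mulrC.
have [b [hE b0]] := D0_homog_generated (D0_hrow fd s D0c) (hrow_homog s (\row_i c i)).
case/eqP: si; have /rowP/(_ i) := hE; rewrite !mxE => ->.
rewrite big1 ?mxE // => j _; rewrite b0 ?scale0r //.
exact: leq_trans s_lt (emin j).
Qed.

End MinimalGenerators.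

Lemma sum_combination3 (A : nzRingType) (V : lmodType A) m (rho : 'I_m -> V) x y z a b c :
  a *: rho x + b *: rho y + c *: rho z =
  \sum_k (a *+ (k == x) + b *+ (k == y) + c *+ (k == z)) *: rho k.
Proof.
have E d u : d *: rho u = \sum_k (d *+ (k == u)) *: rho k.
  rewrite (bigD1 u) //= eqxx mulr1n big1 ?addr0 // => k /negPf->.
  by rewrite mulr0n scale0r.
rewrite !E -!big_split; apply: eq_bigr => k _.
by rewrite !scalerDl.
Qed.

(** * Comparison with a complete intersection *)

(** Multiplying by all forms of large degree moves [u] to degrees where the two
    ideals agree, and [g], [h] generate a saturated ideal. *)
Lemma saturated_equality (F : numClosedFieldType) (I : set {mpoly F[3]}) g h q N :
  is_ideal I -> h \is q.-homog -> h != 0 -> coprime_pair g h ->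
  (forall u, pair_ideal g h u -> I u) ->
  (forall k, (N <= k)%N -> \dim (gp I k) = \dim (gp (pair_ideal g h) k)) ->
  forall k u, u \is k.-homog -> I u -> pair_ideal g h u.
Proof.
move=> idI hq h0 copgh GI dimE k u uk Iu; have idG := pair_ideal_ideal g h.
apply: (saturation (N := N) hq h0 copgh) => w wN.
have gpE : gp (pair_ideal g h) (N + k) = gp I (N + k).
  apply/eqP; rewrite eqEdim; apply/andP; split.
    apply/subvP => x /(mem_gp x idG) Gx; apply/(mem_gp x idI); exact: GI.
  by rewrite dimE // leq_addr.
have wu := dhomogM wN uk.
apply/(mem_gp_gr idG wu); rewrite gpE; apply/(mem_gp_gr idI wu).
exact: (ideal_mull idI).
Qed.

Section TjurinaBound.
Variables (F : numClosedFieldType) (D : nat) (f : {mpoly F[3]}).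
Local Notation S := {mpoly F[3]}.
Local Notation dimS k := (\dim {:dhomog 3 F k}).
Hypotheses (fd : f \is D.+1.-homog) (cop : coprime_family (fun i : 'I_3 => f^`M(i))).
Variables (i0 : 'I_3) (r1 r2 : 'rV[S]_3) (e1 e2 : nat) (i1 : 'I_3) (q : nat).
Hypothesis fi0 : f^`M(i0) != 0.
Hypotheses (r1e : homog_triple e1 r1) (D0r1 : D0 f r1) (r1i : r1 0 i1 != 0).
Hypothesis r1cop : coprime_family (fun i => r1 0 i).
Hypothesis qE : (q + D = e1 + e2)%N.
Local Notation J := (jacobian_ideal f).
Local Notation A := (syzygy_ideal f r1).

(** [D ^ 2 - e1 * e2] is the value which the Hilbert function of [J] would take
    in large degrees if [A] had the dimensions of the complete intersection of
    degrees [e1] and [q]. *)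
Lemma hilbert_difference (g h : S) t : g \is e1.-homog -> h \is q.-homog ->
  h != 0 -> coprime_pair g h ->
  ((hf J (t + e2 + D + e1 + D))%:Z + (\dim (gp (pair_ideal g h) (t + D + e1 + q)))%:Z =
   D%:Z ^+ 2 - e1%:Z * e2%:Z + (\dim (gp A (t + D + e1 + q)))%:Z)%R.
Proof.
move=> ge hq h0 copgh.
have jE : (t + D + e1 + q + D = t + e2 + D + e1 + e1)%N by move: qE; lia.
have := dim_jacobian fd cop fi0 r1e D0r1 r1i r1cop (erefl (t + e2 + D + e1)%N) jE.
have := dim_pair_ideal (t + D) ge hq h0 copgh.
have -> : (t + D + q = t + e1 + e2)%N by move: qE; lia.
have := codim_dim (gp J (t + e2 + D + e1 + D)); rewrite -/(hf J _).
(* All the dimensions are quadratic polynomials in [t]; they are doubled here to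
   avoid the division by two. *)
have := (double_dimS F (t + e2 + D), double_dimS F (t + e2 + D + e1),
  double_dimS F (t + e2 + D + e1 + D), double_dimS F (t + D),
  double_dimS F (t + e1 + e2), double_dimS F (t + D + e1)).
move: (hf J _) (\dim (gp J _)) (\dim (gp A _)) (\dim (gp (pair_ideal g h) _)) => x1 x2 x3 x4.
move: (dimS (t + e2 + D)) (dimS (t + e2 + D + e1)) (dimS (t + e2 + D + e1 + D)).
move: (dimS (t + D)) (dimS (t + e1 + e2)) (dimS (t + D + e1)).
move=> y1 y2 y3 y4 y5 y6 [[[[[E4 E5] E6] E1] E2] E3] H1 H2 H3.
rewrite expr2; nia.
Qed.

End TjurinaBound.

(** * The case of equality *)

Lemma hrowD (F : numClosedFieldType) k (r s : 'rV[{mpoly F[3]}]_3) :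
  hrow k (r + s) = hrow k r + hrow k s.
Proof. by apply/rowP => x; rewrite !mxE (raddfD (pihomog mdeg k)). Qed.

Lemma hrow_scale (F : numClosedFieldType) l k (a : {mpoly F[3]}) (r : 'rV[{mpoly F[3]}]_3) :
  homog_triple k r -> exists a',
  [/\ hrow l (a *: r) = a' *: r, (l < k)%N -> a' = 0 & a' \is (l - k).-homog].
Proof.
move=> rk; case: (leqP k l) => [kl|lk].
  exists (pihomog mdeg (l - k) a); split=> //; last exact: pihomogP.
  apply/rowP => x; rewrite !mxE -{1}(subnK kl).
  by rewrite (pihomogM _ _ (rk x)).
exists 0; split=> //; last exact: dhomog0.
by apply/rowP => x; rewrite scale0r !mxE (pihomogM_lt _ (rk x)).
Qed.

Lemma irredundant_combination (A : nzRingType) (V : lmodType A) m (rho : 'I_m -> V) :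
  (forall j (c : 'I_m -> A), c j = 0 -> rho j <> \sum_k c k *: rho k) ->
  forall x y j a b c, j != x -> j != y -> c j = 0 ->
  rho j <> a *: rho x + b *: rho y + \sum_k c k *: rho k.
Proof.
move=> irr x y j a b c jx jy cj.
have -> : a *: rho x + b *: rho y = a *: rho x + b *: rho y + 0 *: rho x.
  by rewrite scale0r addr0.
rewrite sum_combination3 -big_split /=.
under eq_bigr => k _ do rewrite -scalerDl.
by apply: irr; rewrite (negPf jx) (negPf jy) cj !mulr0n !addr0.
Qed.

(** As [s] is invertible, [k] may be expressed by [r0], [r1] and [r2]. *)
Lemma exchange_generator (A : comNzRingType) (V : lmodType A) (r0 r1 r2 r3 k : V)
    (c w s z c3 w3 s3 : A) :
  z * s = 1 -> r2 = c *: r0 + w *: r1 + s *: k ->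
  r3 = c3 *: r0 + w3 *: r1 + s3 *: k ->
  r3 = (c3 - s3 * z * c) *: r0 + (w3 - s3 * z * w) *: r1 + (s3 * z) *: r2.
Proof.
move=> zs -> ->; rewrite !scalerDr !scalerA -[s3 * z * s]mulrA zs mulr1 !scalerBl.
by rewrite [RHS]addrA; congr (_ + _); rewrite addrACA !subrK.
Qed.

Section MinimalResolution.
Variables (F : numClosedFieldType) (D : nat) (f : {mpoly F[3]}).
Local Notation S := {mpoly F[3]}.
Hypotheses (fd : f \is D.+1.-homog) (fred : reduced f).
Variables (m : nat) (e : 'I_m.+3 -> nat) (rho : 'I_m.+3 -> 'rV[S]_3).
Hypothesis rhoe : forall j, homog_triple (e j) (rho j).
Hypothesis rhoP : minimal_generators (D0 f) rho.
Hypothesis emin : forall j, (e ord0 <= e j)%N.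

Local Notation j0 := (ord0 : 'I_m.+3).
Local Notation j1 := (lift ord0 ord0 : 'I_m.+3).
Local Notation j2 := (lift ord0 (lift ord0 ord0) : 'I_m.+3).
Local Notation A := (syzygy_ideal f (rho j0)).
Local Notation grad := (gradient f).
Local Notation dimgp I k := (\dim (gp I k)).

Let D0rho j : D0 f (rho j) := D0_generator rhoP j.
Let idA : is_ideal A := syzygy_ideal_ideal (D0rho j0).
Let cop := reduced_coprime (ltn0Sn D) fd fred.
Let r1cop := least_generator_primitive fd rhoe rhoP emin.

Let fi0 : exists i, f^`M(i) != 0 := reduced_deriv_neq0 (ltn0Sn D) fd fred.

Let r1i : exists i, rho j0 0 i != 0.
Proof.
apply: contrapT => /forallNP H; case/eqP: (generator_neq0 rhoP j0); apply/rowP => i.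
by rewrite mxE; apply/eqP/negPn/negP => /H.
Qed.

(** Scalar multiples of [rho j0] are the only syzygies killed by [cross], and
    another generator is not one of them. *)
Lemma cross_generator_neq0 j : j != j0 -> cross (rho j0) (rho j) != 0.
Proof.
move=> jj0; apply/eqP; have [i ri] := r1i.
move=> /(cross_eq0 ri r1cop)[c jE].
apply: (generator_irredundant rhoP (j := j) (c := fun k => c *+ (k == j0))).
  by rewrite (negPf jj0).
rewrite (bigD1 j0) // eqxx mulr1n big1 => [|k /negPf->]; first by rewrite /= addr0.
by rewrite mulr0n scale0r.
Qed.

Lemma generator_coefficient j : j != j0 -> exists a,
  [/\ cross (rho j0) (rho j) = a *: grad, a != 0, (D <= e j + e j0)%N &
      a \is (e j + e j0 - D).-homog].
Proof.
move=> jj0; have [i fi] := fi0; have rj0 := cross_generator_neq0 jj0.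
have [a aE] := cross_gradient cop fi (D0rho j0) (D0rho j).
have crossh : homog_triple (e j + e j0) (cross (rho j0) (rho j)).
  rewrite -{1}(hrow_id (rhoe j)) (cross_hrow _ _ (rhoe j0)); exact: hrow_homog.
have [De ae] := homog_coefficient fd fi crossh aE rj0.
by exists a; split=> //; apply: contraNneq rj0 => a0; rewrite aE a0 scale0r.
Qed.

(** The entries of [rho j0] have no common factor, so that a generic combination
    of them with constant coefficients is coprime to [h].  It belongs to [A] on
    account of the syzygy [cross v grad]. *)
Lemma generic_koszul h : h != 0 -> exists v : 'rV[S]_3,
  homog_triple 0 v /\ coprime_pair (dot (rho j0) v) h.
Proof.
move=> h0; have [t tP] := generic_combination r1cop (mpoly_factorial h0).
exists (row3 1 t%:MP (t ^+ 2)%:MP); split.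
  apply: ord3P; rewrite row3E; first exact: dhomog1.
    by rewrite -[t%:MP]mulr1 mul_mpolyC rpredZ // dhomog1.
  by rewrite -[(_ ^+ 2)%:MP]mulr1 mul_mpolyC rpredZ // dhomog1.
move=> p pP pg ph; apply: (tP p pP ph); move: pg.
by rewrite /dot sum3E !row3E mulr1 ![_ * _%:MP]mulrC !mul_mpolyC.
Qed.

Lemma dot_homog v : homog_triple 0 v -> dot (rho j0) v \is (e j0).-homog.
Proof.
move=> v0; apply: rpred_sum => i _; rewrite -[e j0]addn0.
exact: dhomogM (rhoe j0 i) (v0 i).
Qed.

Lemma koszul_homog v : homog_triple 0 v -> homog_triple D (cross v grad).
Proof.
move=> v0; have gradh : homog_triple D grad.
  by move=> i; rewrite mxE; apply: (deriv_homog i fd).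
rewrite -{1}(hrow_id gradh) (cross_hrow _ _ v0) addn0; exact: hrow_homog.
Qed.

(** If [h] and [g] generate [A], then [rho j0], [rho j1] and one Koszul syzygy
    generate [D0 f]; minimality forces the third generator to replace the
    latter, which has degree [D]. *)
Lemma three_generators v h : homog_triple 0 v ->
  cross (rho j0) (rho j1) = h *: grad ->
  (forall k u, u \is k.-homog -> A u -> pair_ideal (dot (rho j0) v) h u) ->
  m = 0%N /\ e j2 = D.
Proof.
move=> v0 hE AG; set g := dot _ _ in AG; pose kap := cross v grad.
have [i ri] := r1i; have kapE := cross_koszul (D0rho j0) v.
have gen j : exists c w s, rho j = c *: rho j0 + w *: rho j1 + s *: kap.
  have [->|jj0] := eqVneq j j0.
    by exists 1, 0, 0; rewrite scale1r !scale0r !addr0.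
  have [a [aE _ _ ah]] := generator_coefficient jj0.
  have Aa : A a by exists (rho j); split.
  have [s [w aG]] := AG _ _ ah Aa.
  have [|c cE] := cross_eq0 ri r1cop (r := rho j + s *: kap + - w *: rho j1).
    rewrite !crossD !crossZ kapE hE aE aG !scalerA -!scalerDl -/g.
    by rewrite (_ : _ + _ = 0) ?scale0r //; ring.
  by exists c, w, (- s); rewrite -cE !scaleNr subrK addrK.
have kaph : homog_triple D kap := koszul_homog v0.
have [c [w [s j2E]]] := gen j2.
have [b [kapG b0]] := D0_homog_generated rhoe rhoP (D0_koszul f v) kaph.
have irr j c' := generator_irredundant rhoP (j := j) (c := c').
have hparts : exists c' w' s', [/\ rho j2 = c' *: rho j0 + w' *: rho j1 + s' *: kap,
    (e j2 < D)%N -> s' = 0 & s' \is (e j2 - D).-homog].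
  have [c' [cE _ _]] := hrow_scale (e j2) c (rhoe j0).
  have [w' [wE _ _]] := hrow_scale (e j2) w (rhoe j1).
  have [s' [sE s0 sh]] := hrow_scale (e j2) s kaph.
  exists c', w', s'; split; [|exact: s0|exact: sh].
  have := hrow_id (rhoe j2); rewrite {1}j2E 2!hrowD cE wE sE; exact: esym.
have [c' [w' [s' [j2E' s0 sh]]]] := hparts.
(* In degrees less than [D] the Koszul syzygy cannot occur in [rho j2]; in
   degrees greater than [D] the generators giving it do not include [rho j2]. *)
have eD : e j2 = D.
  have [jD|Dj|//] := ltngtP (e j2) D.
    case: (irredundant_combination irr (a := c') (b := w') (x := j0) (y := j1) (j := j2)
      (c := fun=> 0) isT isT (erefl _)).
    rewrite big1 => [|k _]; last exact: scale0r.
    by rewrite j2E' (s0 jD) scale0r.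
  case: (irredundant_combination irr (a := c') (b := w') (x := j0) (y := j1) (j := j2)
    (c := fun k => s' * b k) isT isT); first by rewrite (b0 _ Dj) mulr0.
  under eq_bigr => k _ do rewrite -scalerA.
  by rewrite -scaler_sumr -kapG.
split=> //; apply/eqP; rewrite -leqn0 leqNgt; apply/negP => m0.
rewrite eD subnn in sh.
have s1 : (msize s' <= 1)%N.
  by have [->|sn0] := eqVneq s' 0; rewrite ?msize0 // (msize_homog sh).
have sC := msize1_polyC s1.
have sn0 : s'@_0 != 0.
  apply/eqP => s00.
  case: (irredundant_combination irr (a := c') (b := w') (x := j0) (y := j1) (j := j2)
    (c := fun=> 0) isT isT (erefl _)).
  rewrite big1 => [|k _]; last exact: scale0r.
  by rewrite j2E' sC s00 mpolyC0 scale0r.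
have zs : (s'@_0)^-1%:MP * s' = 1.
  by rewrite {2}sC -mpolyCM mulVf.
(* [rho j2] may now replace [kap], which leaves no room for a fourth generator. *)
have j3lt : (3 < m.+3)%N by [].
pose j3 : 'I_m.+3 := Ordinal j3lt.
have [c3 [w3 [s3 j3E]]] := gen j3.
have := exchange_generator zs j2E' j3E; rewrite sum_combination3.
by apply: irr; rewrite !mulr0n !addr0.
Qed.


(** [A] is the image of [D0 f], and [rho j0] goes to zero. *)
Lemma two_coefficients h a : m = 0%N ->
  cross (rho j0) (rho j1) = h *: grad -> cross (rho j0) (rho j2) = a *: grad ->
  forall u, A u <-> pair_ideal a h u.
Proof.
move=> m0 hE aE u; split=> [[r [r0 rE]]|[x [y ->]]]; last first.
  by apply: (idealD idA); apply: (ideal_mull idA);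
    [exists (rho j2)|exists (rho j1)].
have [c cE] := D0_generated rhoP r0; have [i fi] := fi0.
have sum3 (V : nmodType) (G : 'I_m.+3 -> V) : \sum_k G k = G j0 + G j1 + G j2.
  rewrite !big_ord_recl addrA big1 ?addr0 // => k _.
  by case: k => k km; exfalso; rewrite m0 in km.
exists (c j2), (c j1); apply: (gradient_inj fi).
rewrite -rE cE sum3 !crossD !crossZ cross_self hE aE !scalerA scaler0 add0r.
by rewrite -scalerDl addrC.
Qed.

(** The pair formed by [h] and by the generic [g] bounds [A] from below; in the
    last implication the coefficient [a] of [rho j2] takes the place of [g]. *)
Lemma tjurina_bound :
  D%:Z ^+ 2 - (e j0)%:Z * (e j1)%:Z <= (total_tjurina f)%:Z /\
  ((total_tjurina f)%:Z = D%:Z ^+ 2 - (e j0)%:Z * (e j1)%:Z <->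
   m = 0%N /\ e j2 = D).
Proof.
have [i fi] := fi0; have [i1 ri] := r1i.
have [h [hE h0 Dh hh]] := generator_coefficient (j := j1) isT.
have [v [v0 cop_gh]] := generic_koszul h0.
set g := dot _ v in cop_gh; have gh : g \is (e j0).-homog := dot_homog v0.
have qE : (e j1 + e j0 - D + D = e j0 + e j1)%N by rewrite subnK // addnC.
have [K tauE] := total_tjurina_hilbert (ltn0Sn D) fd fred.
pose s t := (t + D + e j0 + (e j1 + e j0 - D))%N.
have count b t : b \is (e j0).-homog -> coprime_pair b h -> (K <= t)%N ->
    (total_tjurina f)%:Z + (dimgp (pair_ideal b h) (s t))%:Z =
    D%:Z ^+ 2 - (e j0)%:Z * (e j1)%:Z + (dimgp A (s t))%:Z :> int.
  move=> bh cop_bh Kt.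
  rewrite -(hilbert_difference fd cop fi (rhoe j0) (D0rho j0) ri r1cop qE t bh hh h0 cop_bh).
  by rewrite tauE // -!addnA (leq_trans Kt) ?leq_addr.
have GA u : pair_ideal g h u -> A u.
  case=> x [y ->]; apply: (idealD idA); apply: (ideal_mull idA).
    exact: (syzygy_ideal_koszul (D0rho j0)).
  by exists (rho j1).
have dim_le t : (dimgp (pair_ideal g h) (s t) <= dimgp A (s t))%N.
  apply/dimvS/subvP => u /(mem_gp u (pair_ideal_ideal g h)) Gu.
  apply/(mem_gp u idA); exact: GA.
split.
  rewrite -(lerD2r (dimgp A (s K))%:Z) -(count g K gh cop_gh (leqnn K)) lerD2l.
  by rewrite lez_nat.
split=> [tauE2|[m0 eD]].
  apply: (three_generators v0 hE).
  apply: (saturated_equality (N := s K) idA hh h0 cop_gh GA) => k sk.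
  have kE : s (K + (k - s K))%N = k by move: sk; rewrite /s; lia.
  have := count g _ gh cop_gh (leq_addr (k - s K) K).
  by rewrite kE tauE2 => /addrI[].
have [a [aE _ _ ah]] := generator_coefficient (j := j2) isT.
rewrite eD addKn in ah; have AE := two_coefficients m0 hE aE.
have cop_ah : coprime_pair a h.
  have [x [y gE]] : pair_ideal a h g.
    by apply/AE; apply: (syzygy_ideal_koszul (D0rho j0)).
  move=> p pP pa ph; apply: (cop_gh p pP _ ph); rewrite gE.
  by apply: dividesD; apply: divides_mull.
have := count a K ah cop_ah (leqnn K).
have -> : pair_ideal a h = A :> set S by apply/seteqP; split=> u /AE.
by move/addIr.
Qed.

End MinimalResolution.

Theorem theorem2p2 (R : realType) (d : nat) (f : {mpoly R[i][3]})
    (m : nat) (e : m.-tuple nat) :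
  (3 <= d)%N -> f \is d.-homog -> reduced f ->
  (3 <= m)%N -> is_exponents f e ->
  ((total_tjurina f)%:Z = (d%:Z - 1) ^+ 2 - (nth 0%N e 0)%:Z * (nth 0%N e 1)%:Z
     <-> m = 3%N /\ nth 0%N e 2 = (d - 1)%N) /\
  (~ (m = 3%N /\ nth 0%N e 2 = (d - 1)%N) ->
     (total_tjurina f)%:Z > (d%:Z - 1) ^+ 2 - (nth 0%N e 0)%:Z * (nth 0%N e 1)%:Z).
Proof.
case: d => [//|D] _ fd fred; case: m e => [//|[//|[//|m]]] e _ [esort [rho [rhoe rhoP]]].
have eE (j : 'I_m.+3) : tnth e j = nth 0%N e j by apply: tnth_nth.
have emin j : (tnth e ord0 <= tnth e j)%N.
  rewrite !eE (sorted_leq_nth leq_trans leqnn) // inE size_tuple //; exact: ltn_ord.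
have [tau_ge tauP] := tjurina_bound fd fred rhoe rhoP emin.
have DE : D.+1%:Z - 1 = D%:Z by rewrite -addn1 PoszD addrK.
rewrite DE subn1 /=; move: tau_ge tauP; rewrite !eE => tau_ge tauP.
have mE : m.+3 = 3%N /\ nth 0%N e 2 = D <-> m = 0%N /\ nth 0%N e 2 = D.
  by split=> -[mE ->]; split=> //; [case: mE|rewrite mE].
split; first by rewrite mE.
by rewrite mE Order.POrderTheory.lt_neqAle tau_ge andbT => ne; apply/eqP => /esym /tauP.
Qed.
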